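(* The spherical mean operator $f\mapsto M_f$ is positivity-preserving on $C^\infty(\mathbb R^N)$: if $f\in C^\infty(\mathbb R^N)$ is real-valued with $f\geq0$ on $\mathbb R^N$, then $M_f(x,t)\geq 0$ for all $(x,t)\in\mathbb R^N\times[0,\infty)$.
   Context: Let $R\subset\mathbb R^N$ be a reduced root system normalized by $\langle\alpha,\alpha\rangle=2$, $G$ the finite reflection group generated by the reflections $\sigma_\alpha$ ($\alpha\in R$), $R_+$ a positive subsystem, and $k:R\to[0,\infty)$ a $G$-invariant multiplicity function. Dunkl operators: $T_\xi(k)f(x)=\partial_\xi f(x)+\sum_{\alpha\in R_+}k(\alpha)\langle\alpha,\xi\rangle\frac{f(x)-f(\sigma_\alpha x)}{\langle\alpha,x\rangle}$. The intertwining operator $V_k$ is the unique degree-preserving linear isomorphism of polynomials with $T_\xi(k)V_k=V_k\partial_\xi$, $V_k1=1$; it has the form $V_kf(x)=\int f\,d\mu_x^k$ for probability measures $\mu_x^k$ supported in the convex hull of $\{gx:g\in G\}$, and this formula extends $V_k$ to a topological isomorphism of $C^\infty(\mathbb R^N)$. The generalized (Dunkl) translation of $f\in C^\infty(\mathbb R^N)$ is $f(x*_ky):=\tau_yf(x):=V_k^xV_k^y(V_k^{-1}f)(x+y)$ (upper indices indicating the variable acted upon). Put $w_k(x)=\prod_{\alpha\in R_+}|\langle\alpha,x\rangle|^{2k(\alpha)}$, $d_k=\int_{S^{N-1}}w_k\,d\sigma$ (for $N=1$, $S^0=\{\pm1\}$ with counting measure). The Dunkl-type spherical mean of $f\in C^\infty(\mathbb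 R^N)$ is $M_f(x,t)=\frac1{d_k}\int_{S^{N-1}}f(x*_kty)w_k(y)\,d\sigma(y)$, $x\in\mathbb R^N$, $t\ge0$. *)

(* Defs.v *)
From HB Require Import structures.
From mathcomp Require Import all_boot all_order all_algebra.
From mathcomp Require Import all_classical all_reals all_analysis.
Import Order.TTheory GRing.Theory Num.Theory numFieldNormedType.Exports.

Set Implicit Arguments.
Unset Strict Implicit.
Unset Printing Implicit Defensive.

Local Open Scope classical_set_scope.
Local Open Scope ring_scope.

Section Dunkl.
Context {R : realType} {N : nat}.
Local Notation vec := 'rV[R]_N.

Definition dotp (x y : vec) : R := \sum_(i < N) x ord0 i * y ord0 i.
Definition enorm (x : vec) : R := Num.sqrt (dotp x x).

Definition refl (a x : vec) : vec := x - ((2 * dotp a x) / dotp a a) *: a.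

Definition reduced_root_system (Rs : seq vec) : Prop :=
  [/\ uniq Rs,
      (forall a, a \in Rs -> dotp a a = 2),
      (forall a b, a \in Rs -> b \in Rs -> refl a b \in Rs) &
      (forall a (c : R), a \in Rs -> c *: a \in Rs -> c = 1 \/ c = -1)].

Definition positive_subsystem (Rs Rp : seq vec) : Prop :=
  exists b : vec, (forall a, a \in Rs -> dotp a b != 0) /\
                  Rp = [seq a <- Rs | 0 < dotp a b].

(* nonnegative multiplicity function, invariant under the reflection group G
   (equivalently, under its generators sigma_b, b in R) *)
Definition multiplicity (Rs : seq vec) (k : vec -> R) : Prop :=
  (forall a, a \in Rs -> 0 <= k a) /\
  (forall a b, a \in Rs -> b \in Rs -> k (refl b a) = k a).

Inductive orbit (Rs : seq vec) (x : vec) : vec -> Prop :=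
| orbit_refl : orbit Rs x x
| orbit_step : forall a y, a \in Rs -> orbit Rs x y -> orbit Rs x (refl a y).

Definition conv_orbit (Rs : seq vec) (x : vec) : set vec :=
  [set z | exists (n : nat) (p : 'I_n -> vec) (w : 'I_n -> R),
     [/\ (forall i, orbit Rs x (p i)), (forall i, 0 <= w i),
         \sum_(i < n) w i = 1 & z = \sum_(i < n) w i *: p i]].

Fixpoint iterD (vs : seq vec) (f : vec -> R) : vec -> R :=
  if vs is v :: vs' then (fun x => 'D_v (iterD vs' f) x) else f.

Definition smooth (f : vec -> R) : Prop :=
  forall vs : seq vec, continuous (iterD vs f) /\
    (forall (x v : vec), derivable (iterD vs f) x v).

Definition monom (a : {ffun 'I_N -> nat}) (x : vec) : R :=
  \prod_(i < N) x ord0 i ^+ a i.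

Definition poly_fun (p : vec -> R) : Prop :=
  exists s : seq (R * {ffun 'I_N -> nat}),
    forall x, p x = \sum_(c <- s) c.1 * monom c.2 x.

Definition homog_poly (n : nat) (p : vec -> R) : Prop :=
  exists s : seq (R * {ffun 'I_N -> nat}),
    all (fun c : R * {ffun 'I_N -> nat} => \sum_(i < N) c.2 i == n)%N s /\
    forall x, p x = \sum_(c <- s) c.1 * monom c.2 x.

Definition dunkl (Rp : seq vec) (k : vec -> R) (xi : vec) (f : vec -> R)
  (x : vec) : R :=
  'D_xi f x + \sum_(a <- Rp) k a * dotp a xi * (f x - f (refl a x)) / dotp a x.

(* characterizing properties of the intertwining operator V_k on
   polynomials (T_xi V = V d_xi is required off the hyperplanes <a,x> = 0;
   both sides are polynomials, so this is equality of polynomials) *)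
Definition intertwiner (Rp : seq vec) (k : vec -> R)
  (V : (vec -> R) -> vec -> R) : Prop :=
  [/\ (forall n p, homog_poly n p -> homog_poly n (V p)),
      (forall x, V (fun _ => 1) x = 1) &
      (forall xi p x, poly_fun p -> (forall a, a \in Rp -> dotp a x != 0) ->
         dunkl Rp k xi (V p) x = V (fun y => 'D_xi p y) x)].

End Dunkl.

Definition borelV (R : realType) (N : nat) :=
  g_sigma_algebraType (@open 'rV[R]_N).

Section Dunkl2.
Context {R : realType} {N : nat}.
Local Notation vec := 'rV[R]_N.

Definition Vk (mu : vec -> probability (borelV R N) R) (f : vec -> R)
  (x : vec) : R :=
  Rintegral (mu x) setT (f : borelV R N -> R).

(* generalized translation  f(x *_k y) = V^x V^y g (x + y), g = V^{-1} f *)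
Definition dtrans (mu : vec -> probability (borelV R N) R) (g : vec -> R)
  (x y : vec) : R :=
  Vk mu (fun x' => Vk mu (fun y' => g (x' + y')) y) x.

Definition wk (Rp : seq vec) (k : vec -> R) (y : vec) : R :=
  \prod_(a <- Rp) `|dotp a y| `^ (2 * k a).
End Dunkl2.

Fixpoint lebint (R : realType) (n : nat) : ('rV[R]_n -> R) -> R :=
  match n with
  | 0 => fun f => f 0
  | n'.+1 => fun f => Rintegral (@lebesgue_measure R) setT
      (fun a : R => @lebint R n' (fun v => f (row_mx (const_mx a : 'rV_1) v)))
  end.

(* integral against the surface measure of S^{N-1}:
   int_{S^{N-1}} h dsigma = N * int_{|y| <= 1} h(y/|y|) dy
   (for N = 1 this is the counting measure on {+1,-1}) *)
Definition sphere_int (R : realType) (N : nat) (h : 'rV[R]_N -> R) : R :=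
  N%:R * lebint (fun y => if enorm y <= 1 then h ((enorm y)^-1 *: y) else 0).

(* Dunkl-type spherical mean M_f(x,t), where g = V_k^{-1} f *)
Definition spherical_mean (R : realType) (N : nat)
  (mu : 'rV[R]_N -> probability (borelV R N) R) (Rp : seq 'rV[R]_N)
  (k : 'rV[R]_N -> R) (g : 'rV[R]_N -> R) (x : 'rV[R]_N) (t : R) : R :=
  sphere_int (fun y => dtrans mu g x (t *: y) * wk Rp k y) /
  sphere_int (wk Rp k).

(* Main.v *)
(** For a polynomial f = V_k p that is homogeneous of degree d, M_f(x, t) = L(f) where
    L(q) = sum_n t^(2n) / (4^n n! (N/2 + gamma)_n) Delta_k^n q(x) and gamma is the sum of k
    over the positive roots; so it suffices to show that L is positive.  For |z| <= |y| the
    polynomial (|x|^2 + |y|^2 - 2 <x, z>)^m e_(2n)(<x, z>), with e_(2n) the truncated exponential,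
    is nonnegative.  Applying V_k in z, pairing with q >= 0 against the w_k-Gaussian and letting
    n tend to infinity, the factor exp(|x|^2 / 2) cancels and what remains is
    sum_n (N/2 + gamma + n)_m Delta_k^n q(x) / (2^n n!) >= 0; rescaling and m -> oo give
    L(q) >= 0.  Since L(|y|^(2m)) <= (4 (t^2 + |x|^2))^m, it is enough that q >= -eps on a large
    ball to have L(q) >= -eps, and a smooth g is approximated by polynomials on such a ball.

    The w_k-mean over the sphere enters only through the identity that expresses the mean of T_i q
    by that of y_i q.  It follows from the monomial integrals over the ball after w_k and its
    gradient are replaced by polynomials.  The Dunkl operators commute because they are conjugate
    under V_k to partial derivatives. *)

Require Import Defs.
From HB Require Import structures.
From mathcomp Require Import all_boot all_order all_algebra.
From mathcomp Require Import all_classical all_reals all_analysis measurable_realfun.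
From mathcomp Require Import ring lra zify.
Import Order.TTheory GRing.Theory Num.Theory numFieldNormedType.Exports.
Set Implicit Arguments.
Unset Strict Implicit.
Unset Printing Implicit Defensive.
Local Open Scope classical_set_scope.
Local Open Scope ring_scope.

(** The Dunkl translate of a nonnegative function can take negative values, so positivity cannot be
    argued under the integral defining M_f; radial functions are the exception. The kernel used here
    is, up to Gaussian factors and truncation, the classical translate of |y|^(2m) exp(-|y|^2 / 2)
    before V_k is applied. For large m this radial function concentrates near |y| = sqrt(2m), hence
    the rescaling by t / sqrt(2m).

    No Gaussian is integrated: on homogeneous polynomials its w_k-mean is a moment, a product of
    factors N + 2 gamma + 2 i, times the spherical mean. That this functional is nonnegative follows
    from the multipliers c / (c + d) on degree d: each preserves nonnegativity along rays, and their
    rescaled products tend to the moments.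

    Analysis is thus confined to V_k on continuous functions and to the spherical mean. There the
    gradient of w_k may be singular on the hyperplanes of the roots; antisymmetry under reflections
    trades it for the bounded k(a) w_k before any limit is taken. *)

Lemma poly_horner_inj (R : realType) (P Q : {poly R}) :
  (forall t, P.[t] = Q.[t]) -> P = Q.
Proof.
move=> PQ; apply/eqP; rewrite -subr_eq0; apply/negPn/negP => nz.
pose r := [seq (i%:R : R) | i <- iota 0 (size (P - Q))].
have ur : uniq r.
  rewrite map_inj_uniq ?iota_uniq // => i j /eqP; rewrite eqr_nat; exact/eqP.
have ar : all (root (P - Q)) r.
  by apply/allP => t _; rewrite /root !hornerE PQ subrr.
by have := max_poly_roots nz ar ur; rewrite /r size_map size_iota ltnn.
Qed.

(** * Polynomial functions *)

Section PolyFun.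
Context {R : realType} {N : nat}.
Local Notation vec := 'rV[R]_N.
Implicit Types (f g p q : vec -> R) (x y v w : vec).

(** Generated by coordinates rather than given by a list of monomials as [poly_fun], so that product
    rules, difference quotients, bounds and continuity follow by induction on the construction. The
    two notions agree by [polyf_poly_fun] and [poly_fun_polyf]. *)
Inductive polyf : (vec -> R) -> Prop :=
| polyf_cst c : polyf (fun=> c)
| polyf_coord i : polyf (fun x => x ord0 i)
| polyfD f g : polyf f -> polyf g -> polyf (fun x => f x + g x)
| polyfM f g : polyf f -> polyf g -> polyf (fun x => f x * g x).

Lemma eq_polyf f g : f =1 g -> polyf f -> polyf g.
Proof. by move=> /funext ->. Qed.

Lemma polyfZ c f : polyf f -> polyf (fun x => c * f x).
Proof. by move=> pf; apply: polyfM pf; exact: polyf_cst. Qed.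

Lemma polyfN f : polyf f -> polyf (fun x => - f x).
Proof. by move/(polyfZ (-1)); apply: eq_polyf => x; rewrite mulN1r. Qed.

Lemma polyfB f g : polyf f -> polyf g -> polyf (fun x => f x - g x).
Proof. by move=> pf pg; apply: polyfD => //; exact: polyfN. Qed.

Lemma polyf_exp f n : polyf f -> polyf (fun x => f x ^+ n).
Proof.
move=> pf; elim: n => [|n IH]; first exact: (@polyf_cst 1).
by apply: eq_polyf (polyfM pf IH) => x; rewrite exprS.
Qed.

Lemma polyf_sum I (r : seq I) (P : pred I) (F : I -> vec -> R) : (forall i, P i -> polyf (F i)) ->
  polyf (fun x => \sum_(i <- r | P i) F i x).
Proof.
move=> pF; elim: r => [|i r IH].
  by apply: eq_polyf (polyf_cst 0) => x; rewrite big_nil.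
case Pi : (P i).
  by apply: eq_polyf (polyfD (pF _ Pi) IH) => x; rewrite big_cons Pi.
by apply: eq_polyf IH => x; rewrite big_cons Pi.
Qed.

Lemma polyf_prod I (r : seq I) (P : pred I) (F : I -> vec -> R) : (forall i, P i -> polyf (F i)) ->
  polyf (fun x => \prod_(i <- r | P i) F i x).
Proof.
move=> pF; elim: r => [|i r IH].
  by apply: eq_polyf (polyf_cst 1) => x; rewrite big_nil.
case Pi : (P i).
  by apply: eq_polyf (polyfM (pF _ Pi) IH) => x; rewrite big_cons Pi.
by apply: eq_polyf IH => x; rewrite big_cons Pi.
Qed.

Lemma polyf_dotp a : polyf (dotp a).
Proof. by apply: polyf_sum => i _; apply: polyfZ; exact: polyf_coord. Qed.

Lemma polyf_dotpp : polyf (fun x => dotp x x).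
Proof. by apply: polyf_sum => i _; apply: polyfM; exact: polyf_coord. Qed.

Lemma polyf_comp f (A : vec -> vec) : polyf f ->
  (forall i, polyf (fun x => A x ord0 i)) -> polyf (fun x => f (A x)).
Proof.
move=> pf pA; elim: pf => [c|i|g h _ IHg _ IHh|g h _ IHg _ IHh].
- exact: polyf_cst.
- exact: pA.
- exact: polyfD.
- exact: polyfM.
Qed.

Lemma polyf_refl a f : polyf f -> polyf (fun x => f (refl a x)).
Proof.
move=> pf; apply: (polyf_comp pf) => i.
apply: (@eq_polyf (fun x => x ord0 i - 2 / dotp a a * a ord0 i * dotp a x)).
  by move=> x; rewrite /refl !mxE; ring.
by apply: polyfB; [exact: polyf_coord | apply: polyfZ; exact: polyf_dotp].
Qed.

Lemma polyf_scale s f : polyf f -> polyf (fun x => f (s *: x)).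
Proof.
move=> pf; apply: (polyf_comp pf) => i.
apply: (@eq_polyf (fun x => s * x ord0 i)); first by move=> x; rewrite mxE.
by apply: polyfZ; exact: polyf_coord.
Qed.

Lemma polyf_shift (z : vec) f : polyf f -> polyf (fun x => f (z + x)).
Proof.
move=> pf; apply: (polyf_comp pf) => i.
apply: (@eq_polyf (fun x => z ord0 i + x ord0 i)); first by move=> x; rewrite mxE.
by apply: polyfD; [exact: polyf_cst | exact: polyf_coord].
Qed.

Lemma is_derive_coord x v i : is_derive x v (fun z : vec => z ord0 i) (v ord0 i).
Proof.
have E : (fun h : R => h^-1 *: (((fun z : vec => z ord0 i) \o shift x) (h *: v) - x ord0 i))
    @ 0^' --> (v ord0 i : R).
  apply: cvg_near_cst.
  near=> h; rewrite /= !mxE addrK /GRing.scale /= mulKf //.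
  near: h; exact: nbhs_dnbhs_neq.
by apply: DeriveDef; [apply/cvg_ex; exists (v ord0 i) | exact/cvg_lim].
Unshelve. all: by end_near. Qed.

Lemma derivable_polyf f x v : polyf f -> derivable f x v.
Proof.
elim=> [c|i|g h _ Hg _ Hh|g h _ Hg _ Hh].
- exact: derivable_cst.
- by have [] := is_derive_coord x v i.
- exact: (derivableD Hg Hh).
- exact: (@derivableM R vec g h x v Hg Hh).
Qed.

Fact dd_key : unit. Proof. by []. Qed.
(** Locked, so that the directional derivative behaves as an abstract operator governed by the rules
    below and is never unfolded to a limit. *)
Definition dd := locked_with dd_key (fun v f x => 'D_v f x).

Lemma ddE v f x : dd v f x = 'D_v f x.
Proof. by rewrite /dd unlock. Qed.

Lemma dd_cst c v x : dd v (fun=> c : R) x = 0.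
Proof. by rewrite ddE derive_cst. Qed.

Lemma dd_coord i v x : dd v (fun x => x ord0 i) x = v ord0 i.
Proof. by rewrite ddE; have [] := is_derive_coord x v i. Qed.

Lemma ddD f g v x : polyf f -> polyf g ->
  dd v (fun x => f x + g x) x = dd v f x + dd v g x.
Proof. by move=> pf pg; rewrite !ddE -deriveD //; exact: derivable_polyf.
Qed.

Lemma ddM f g v x : polyf f -> polyf g ->
  dd v (fun x => f x * g x) x = dd v f x * g x + f x * dd v g x.
Proof.
move=> pf pg; rewrite !ddE -(_ : f * g = fun x => f x * g x); last exact/funext.
have := @deriveM R vec f g x v (derivable_polyf (x:=x) (v:=v) pf) (derivable_polyf (x:=x) (v:=v) pg).
by rewrite /GRing.scale /= addrC (mulrC (g x)) => ->.
Qed.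

Lemma ddZ c f v x : polyf f -> dd v (fun x => c * f x) x = c * dd v f x.
Proof.
by move=> pf; rewrite ddM //; [rewrite dd_cst mul0r add0r | exact: polyf_cst].
Qed.

Lemma dd_sum I (r : seq I) (P : pred I) (F : I -> vec -> R) v x : (forall i, P i -> polyf (F i)) ->
  dd v (fun x => \sum_(i <- r | P i) F i x) x = \sum_(i <- r | P i) dd v (F i) x.
Proof.
move=> pF; elim: r => [|i r IH].
  rewrite big_nil (_ : (fun x => _) = fun=> 0) ?dd_cst //.
  by apply/funext => y; rewrite big_nil.
rewrite big_cons (_ : (fun x => _) = fun x => if P i then F i x + \sum_(i <- r | P i) F i x
  else \sum_(i <- r | P i) F i x); last by apply/funext => y; rewrite big_cons.
case Pi : (P i) => //; rewrite ddD ?IH //; [exact: pF | exact: polyf_sum].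
Qed.

Lemma polyf_dd v f : polyf f -> polyf (dd v f).
Proof.
elim=> [c|i|g h pg Hg ph Hh|g h pg Hg ph Hh].
- by apply: eq_polyf (polyf_cst 0) => x; rewrite dd_cst.
- by apply: eq_polyf (polyf_cst (v ord0 i)) => x; rewrite dd_coord.
- by apply: eq_polyf (polyfD Hg Hh) => x; rewrite ddD.
- by apply: eq_polyf (polyfD (polyfM Hg ph) (polyfM pg Hh)) => x; rewrite ddM.
Qed.

Lemma dd_lin c v w f x : polyf f ->
  dd (c *: v + w) f x = c * dd v f x + dd w f x.
Proof.
elim=> [d|i|g h pg Hg ph Hh|g h pg Hg ph Hh].
- by rewrite !dd_cst mulr0 addr0.
- by rewrite !dd_coord !mxE.
- by rewrite !ddD // Hg Hh; ring.
- by rewrite !ddM // Hg Hh; ring.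
Qed.

Lemma dd0 f x : polyf f -> dd 0 f x = 0.
Proof.
move=> pf; have := dd_lin 1 0 0 x pf; rewrite scaler0 addr0 mul1r => /eqP.
by rewrite -subr_eq0 opprD addNKr oppr_eq0 => /eqP.
Qed.

Lemma dd_basis f v x : polyf f ->
  dd v f x = \sum_i v ord0 i * dd (delta_mx 0 i) f x.
Proof.
move=> pf; rewrite {1}(row_sum_delta v).
elim/big_rec2: _ => [|i z u _ IH]; first exact: dd0.
by rewrite dd_lin // IH.
Qed.

Lemma dd_comp f (A : vec -> vec) v (B : vec) x : polyf f ->
  (forall i, polyf (fun x => A x ord0 i)) ->
  (forall i, dd v (fun x => A x ord0 i) x = B ord0 i) ->
  dd v (fun x => f (A x)) x = dd B f (A x).
Proof.
move=> pf pA HB; elim: pf => [c|i|g h pg IHg ph IHh|g h pg IHg ph IHh].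
- by rewrite !dd_cst.
- by rewrite HB dd_coord.
- by rewrite (@ddD (fun x => g (A x)) (fun x => h (A x))) ?IHg ?IHh ?ddD //;
    exact: polyf_comp.
- by rewrite (@ddM (fun x => g (A x)) (fun x => h (A x))) ?IHg ?IHh ?ddM //;
    exact: polyf_comp.
Qed.

Lemma dd_refl a f v x : polyf f ->
  dd v (fun x => f (refl a x)) x = dd (refl a v) f (refl a x).
Proof.
move=> pf; apply: dd_comp => // i.
  exact: (polyf_refl a (polyf_coord i)).
rewrite (_ : (fun x => _) = (fun x => x ord0 i + - (2 / dotp a a * a ord0 i) * dotp a x));
  last by apply/funext => z; rewrite /refl !mxE; ring.
have pa := polyf_dotp a; have pi := polyf_coord i.
rewrite ddD ?ddZ //; last exact: polyfZ.
rewrite dd_coord dd_sum; last by move=> j _; apply: polyfZ; exact: polyf_coord.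
rewrite (_ : \sum_(i0 < N) _ = dotp a v); first by rewrite /refl !mxE; ring.
by apply: eq_bigr => j _; rewrite ddZ ?dd_coord //; exact: polyf_coord.
Qed.

Lemma dd_scale s f v x : polyf f ->
  dd v (fun x => f (s *: x)) x = s * dd v f (s *: x).
Proof.
move=> pf; have -> : s * dd v f (s *: x) = dd (s *: v) f (s *: x).
  by rewrite -[s *: v]addr0 dd_lin // dd0 // addr0.
apply: dd_comp => // i; first exact: (polyf_scale s (polyf_coord i)).
rewrite (_ : (fun x => _) = (fun x => s * x ord0 i)); last by apply/funext => z; rewrite mxE.
by rewrite ddZ ?dd_coord ?mxE //; exact: polyf_coord.
Qed.

Lemma dd_shift (z : vec) f v x : polyf f -> dd v (fun x => f (z + x)) x = dd v f (z + x).
Proof.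
move=> pf; apply: dd_comp => // i; first exact: (polyf_shift z (polyf_coord i)).
rewrite (_ : (fun x => _) = (fun x => z ord0 i + x ord0 i)); last by apply/funext => u; rewrite mxE.
rewrite ddD ?dd_cst ?dd_coord ?add0r //; [exact: polyf_cst | exact: polyf_coord].
Qed.

Lemma dd_comm v w f x : polyf f -> dd v (dd w f) x = dd w (dd v f) x.
Proof.
move=> pf; elim: pf x => [c|i|g h pg IHg ph IHh|g h pg IHg ph IHh] x.
- have E u : dd u (fun=> c) = fun=> 0 by apply/funext => z; rewrite dd_cst.
  by rewrite !E !dd_cst.
- have E u : dd u (fun x : vec => x ord0 i) = fun=> u ord0 i.
    by apply/funext => z; rewrite dd_coord.
  by rewrite !E !dd_cst.
- have E u : dd u (fun x : vec => g x + h x) = fun x => dd u g x + dd u h x.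
    by apply/funext => z; rewrite ddD.
  by rewrite !E !ddD ?IHg ?IHh //; exact: polyf_dd.
- have E u : dd u (fun x : vec => g x * h x) = fun x => dd u g x * h x + g x * dd u h x.
    by apply/funext => z; rewrite ddM.
  rewrite !E !ddD; try (by apply: polyfM => //; exact: polyf_dd).
  rewrite !ddM ?IHg ?IHh //; try exact: polyf_dd.
  by ring.
Qed.

(** Restriction to a line turns questions on polynomial functions into questions on [{poly R}]:
    absence of zero divisors, homogeneity after cancelling a power, Euler's identity. *)
Lemma polyf_line f x v : polyf f ->
  exists P : {poly R}, [/\ forall t, f (x + t *: v) = P.[t] & P`_1 = dd v f x].
Proof.
elim=> [c|i|g h pg [P [HP P1]] ph [Q [HQ Q1]]|g h pg [P [HP P1]] ph [Q [HQ Q1]]].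
- exists c%:P; split=> [t|]; first by rewrite hornerC.
  by rewrite coefC dd_cst.
- exists ((x ord0 i)%:P + (v ord0 i) *: 'X); split=> [t|].
    by rewrite !hornerE !mxE; ring.
  by rewrite dd_coord !coefE /=; ring.
- exists (P + Q); split=> [t|]; first by rewrite hornerD HP HQ.
  by rewrite coefD P1 Q1 ddD.
- exists (P * Q); split=> [t|]; first by rewrite hornerM HP HQ.
  have E S u : (forall t, u (x + t *: v) = S.[t]) -> S`_0 = u x.
    by move=> H; rewrite -horner_coef0 -H scale0r addr0.
  rewrite coefM big_ord_recl big_ord1 /= (E _ _ HP) P1 (E _ _ HQ) Q1 ddM //; ring.
Qed.

(** On the line from x to z both restrictions are univariate polynomials with product zero, and that
    of g is nonzero because its value at parameter 1 is [g z]. *)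
Lemma polyf_integral f g z : polyf f -> polyf g -> g z != 0 ->
  (forall x, f x * g x = 0) -> forall x, f x = 0.
Proof.
move=> pf pg gz fg0 x.
have [P [HP _]] := polyf_line x (z - x) pf.
have [Q [HQ _]] := polyf_line x (z - x) pg.
have PQ : P * Q = 0.
  by apply: poly_horner_inj => t; rewrite hornerM -HP -HQ fg0 horner0.
have Q0 : Q != 0.
  apply/eqP => Q0; move: gz; have := HQ 1; rewrite scale1r addrC subrK => ->.
  by rewrite Q0 horner0 eqxx.
move/eqP: PQ; rewrite mulf_eq0 (negPf Q0) orbF => /eqP P0.
by have := HP 0; rewrite scale0r addr0 P0 horner0.
Qed.

(** All real s are allowed: s = 0 makes functions of degree 0 constant, and s = -1 gives parity. *)
Definition hom m f := forall s x, f (s *: x) = s ^+ m * f x.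

Lemma homM m n f g : hom m f -> hom n g -> hom (m + n) (fun x => f x * g x).
Proof. by move=> hf hg s x; rewrite hf hg exprD; ring. Qed.

Lemma homD m f g : hom m f -> hom m g -> hom m (fun x => f x + g x).
Proof. by move=> hf hg s x; rewrite hf hg; ring. Qed.

Lemma homZ c m f : hom m f -> hom m (fun x => c * f x).
Proof. by move=> hf s x; rewrite hf; ring. Qed.

Lemma hom_cst c : hom 0 (fun=> c).
Proof. by move=> s x; rewrite mul1r. Qed.

Lemma hom_coord i : hom 1 (fun x => x ord0 i).
Proof. by move=> s x; rewrite mxE. Qed.

Lemma hom0E m : hom m (fun=> 0).
Proof. by move=> s x; rewrite mulr0. Qed.

Lemma hom_sum m I (r : seq I) (P : pred I) (F : I -> vec -> R) : (forall i, P i -> hom m (F i)) ->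
  hom m (fun x => \sum_(i <- r | P i) F i x).
Proof. by move=> hF s x; rewrite mulr_sumr; apply: eq_bigr => i Pi; rewrite hF. Qed.

Lemma dotpZr a s x : dotp a (s *: x) = s * dotp a x.
Proof. by rewrite /dotp mulr_sumr; apply: eq_bigr => i _; rewrite mxE; ring. Qed.

Lemma hom_exp n m f : hom m f -> hom (n * m) (fun x => f x ^+ n).
Proof. by move=> hf s x; rewrite hf exprMn -exprM mulnC. Qed.

Lemma hom_dotpp : hom 2 (fun x => dotp x x).
Proof. by move=> s x; rewrite /dotp mulr_sumr; apply: eq_bigr => i _; rewrite !mxE; ring. Qed.

Lemma hom0_cst f : hom 0 f -> f = fun=> f 0.
Proof. by move=> hf; apply/funext => x; rewrite -[in RHS](scale0r x) hf mul1r. Qed.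

Lemma reflZ a s x : refl a (s *: x) = s *: refl a x.
Proof. by rewrite /refl dotpZr scalerBr scalerA; congr (_ - _ *: _); ring. Qed.

Lemma hom_refl m a f : hom m f -> hom m (fun x => f (refl a x)).
Proof. by move=> hf s x; rewrite reflZ hf. Qed.

End PolyFun.

(** * Homogeneous polynomials and difference quotients *)

Section Hom.
Context {R : realType} {N : nat}.
Local Notation vec := 'rV[R]_N.
Implicit Types (f g p q : vec -> R) (x y v w a : vec).

Lemma polyf_scalel f x : polyf f -> exists P : {poly R}, forall s, f (s *: x) = P.[s].
Proof.
by move=> pf; have [P [HP _]] := polyf_line 0 x pf; exists P => s; rewrite -HP add0r.
Qed.

(** Derivatives and difference quotients lose a degree, and their homogeneity is obtained by
    cancelling a factor s. Both sides being polynomial in s, the case s = 0 follows from the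
    others. *)
Lemma hom_of_ne0 m f : polyf f ->
  (forall (s : R) x, s != 0 -> f (s *: x) = s ^+ m * f x) -> hom m f.
Proof.
move=> pf H s x; have [P HP] := polyf_scalel x pf.
suff EP : P = f x *: 'X^m by rewrite HP EP !hornerE mulrC.
apply: (@mulfI _ 'X); first by rewrite polyX_eq0.
apply: poly_horner_inj => t; rewrite !hornerM hornerX.
have [->|t0] := eqVneq t 0; first by rewrite !mul0r.
rewrite -HP H // hornerZ hornerXn; ring.
Qed.

Lemma hom_dd v m f : polyf f -> hom m.+1 f -> hom m (dd v f).
Proof.
move=> pf hf; apply: hom_of_ne0; first exact: polyf_dd.
move=> s x s0; apply: (mulfI s0); rewrite -dd_scale //.
rewrite (_ : (fun x => f (s *: x)) = fun x => s ^+ m.+1 * f x); last by apply/funext => z; rewrite hf.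
by rewrite ddZ // exprS mulrA.
Qed.

Lemma hom0_dd v f x : hom 0 f -> dd v f x = 0.
Proof. by move/hom0_cst => ->; rewrite dd_cst. Qed.

(** Homogeneity gives f(x + t x) = (1 + t)^m f(x); the coefficients of t are compared. *)
Lemma euler m f x : polyf f -> hom m f -> dd x f x = m%:R * f x.
Proof.
move=> pf hf; have [P [HP <-]] := polyf_line x x pf.
have -> : P = f x *: ('X + 1) ^+ m.
  apply: poly_horner_inj => t; rewrite -HP hornerZ horner_exp hornerD hornerX hornerC -{1}[x]scale1r -scalerDl hf.
  by rewrite mulrC addrC.
rewrite coefZ mulrC; congr (_ * _).
rewrite -[LHS]mulr1n -(coef_deriv _ 0) deriv_exp derivD derivX derivC addr0 mul1r coefMn.
by rewrite -horner_coef0 horner_exp hornerD hornerX hornerC add0r expr1n.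
Qed.

Lemma euler_sum m f x : polyf f -> hom m f ->
  \sum_i x ord0 i * dd (delta_mx 0 i) f x = m%:R * f x.
Proof. by move=> pf hf; rewrite -(euler x pf hf) dd_basis. Qed.

(** Degrees may repeat in the family: all that matters later is a finite sum of homogeneous
    polynomials, so terms of equal degree are not collected. *)
Lemma polyf_graded f : polyf f -> exists (I : finType) (e : I -> nat) (F : I -> vec -> R),
  (forall i, polyf (F i) /\ hom (e i) (F i)) /\ forall x, f x = \sum_i F i x.
Proof.
elim=> [c|i|g h pg [I [e [F [HF gE]]]] ph [J [d [G [HG hE]]]]
  |g h pg [I [e [F [HF gE]]]] ph [J [d [G [HG hE]]]]].
- exists unit, (fun=> 0%N), (fun=> fun=> c); split=> [_|x].
    by split; [exact: polyf_cst | exact: hom_cst].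
  by rewrite big_const card_unit /= addr0.
- exists unit, (fun=> 1%N), (fun=> fun x => x ord0 i); split=> [_|x].
    by split; [exact: polyf_coord | exact: hom_coord].
  by rewrite big_const card_unit /= addr0.
- exists (I + J)%type, (fun k => match k with inl i => e i | inr j => d j end),
    (fun k => match k with inl i => F i | inr j => G j end); split; first by case.
  by move=> x; rewrite gE hE big_sumType.
- exists (I * J)%type, (fun k => e k.1 + d k.2)%N, (fun k x => F k.1 x * G k.2 x); split.
    case=> i j /=; have [? ?] := HF i; have [? ?] := HG j.
    by split; [exact: polyfM | exact: homM].
  by move=> x; rewrite gE hE mulr_suml -(pair_bigA _ (fun i j => F i x * G j x)) /=;
    apply: eq_bigr => i _; rewrite mulr_sumr.
Qed.

Lemma polyf_hom_ind (Q : (vec -> R) -> Prop) :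
  (forall f g, f =1 g -> Q f -> Q g) -> Q (fun=> 0) ->
  (forall f g, polyf f -> polyf g -> Q f -> Q g -> Q (fun x => f x + g x)) ->
  (forall m f, polyf f -> hom m f -> Q f) -> forall f, polyf f -> Q f.
Proof.
move=> Qe Q0 QD Qh f /polyf_graded [I [e [F [HF fE]]]].
apply: (Qe (fun x => \sum_i F i x)) => [x|]; first by rewrite fE.
elim: (index_enum I) => [|i r IH]; first by apply: Qe Q0 => x; rewrite big_nil.
have [pi hi] := HF i.
apply: (Qe (fun x => F i x + \sum_(j <- r) F j x)) => [x|]; first by rewrite big_cons.
by apply: QD (IH) => //; [apply: polyf_sum => j _; have [] := HF j | exact: Qh hi].
Qed.

Lemma polyf_monom (a : {ffun 'I_N -> nat}) : polyf (@monom R N a).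
Proof. by apply: polyf_prod => i _; apply: polyf_exp; exact: polyf_coord. Qed.

Lemma hom_monom (a : {ffun 'I_N -> nat}) : hom (\sum_i a i) (@monom R N a).
Proof.
move=> s x; rewrite /monom -prodrXr -big_split /=.
by apply: eq_bigr => i _; rewrite mxE exprMn.
Qed.

Lemma polyf_poly_fun f : poly_fun f -> polyf f.
Proof.
case=> s fE; apply: (@eq_polyf _ _ (fun x => \sum_(c <- s) c.1 * monom c.2 x)) => [x|].
  by rewrite fE.
by apply: polyf_sum => c _; apply: polyfZ; exact: polyf_monom.
Qed.

Lemma poly_fun_polyf f : polyf f -> poly_fun f.
Proof.
elim=> [c|i|g h pg [s sE] ph [t tE]|g h pg [s sE] ph [t tE]].
- exists [:: (c, [ffun=> 0%N])] => x; rewrite big_seq1 /monom big1 ?mulr1 // => i _.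
  by rewrite ffunE.
- exists [:: (1, [ffun j => (j == i : nat)])] => x; rewrite big_seq1 mul1r /monom (bigD1 i) //=.
  rewrite ffunE eqxx expr1 big1 ?mulr1 // => j /negPf ji; by rewrite ffunE ji.
- by exists (s ++ t) => x; rewrite big_cat /= -sE -tE.
- pose mk (c d : R * {ffun 'I_N -> nat}) := (c.1 * d.1, [ffun i => (c.2 i + d.2 i)%N]).
  exists [seq mk c d | c <- s, d <- t] => x.
  rewrite big_allpairs_dep sE tE mulr_suml; apply: eq_bigr => c _.
  rewrite mulr_sumr; apply: eq_bigr => d _ /=.
  rewrite [X in _ = _ * X](_ : _ = monom c.2 x * monom d.2 x); first by ring.
  by rewrite /monom -big_split; apply: eq_bigr => i _; rewrite ffunE exprD.
Qed.

Lemma homog_poly_polyf m f : homog_poly m f -> polyf f /\ hom m f.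
Proof.
case=> s [/allP sm fE]; split; first by apply: polyf_poly_fun; exists s.
move=> t x; rewrite !fE mulr_sumr big_seq [RHS]big_seq; apply: eq_bigr => c cs.
by rewrite hom_monom (eqP (sm _ cs)); ring.
Qed.

(** Monomials of degree other than m can be discarded: at t x the whole sum equals f(x) t^m as a
    polynomial in t, and only the monomials of degree m contribute to the m-th coefficient. *)
Lemma hom_homog_poly m f : polyf f -> hom m f -> homog_poly m f.
Proof.
move=> /poly_fun_polyf [s fE] hf.
exists [seq c : R * {ffun 'I_N -> nat} <- s | \sum_(i < N) c.2 i == m]%N; split.
  by apply/allP => c; rewrite mem_filter => /andP[].
move=> x; rewrite big_filter.
pose P := \sum_(c <- s) (c.1 * monom c.2 x) *: 'X^(\sum_(i < N) c.2 i) : {poly R}.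
have EP : P = f x *: 'X^m.
  apply: poly_horner_inj => t; rewrite !hornerE mulrC -hf fE /P horner_sum.
  by apply: eq_bigr => c _; rewrite !hornerE hom_monom; ring.
have := congr1 (fun P : {poly R} => P`_m) EP.
rewrite /P coefZ coefXn eqxx mulr1 => <-; rewrite coef_sum [RHS]big_mkcond /=.
apply: eq_bigr => c _; rewrite coefZ coefXn eq_sym; case: eqP => _; by rewrite ?mulr1 ?mulr0.
Qed.

Definition linquot_spec a f : set (vec -> R) :=
  [set g | polyf g /\ forall x, dotp a x * g x = f x - f (refl a x)].

Definition linquot a f : vec -> R := xget (fun=> 0) (linquot_spec a f).

(** Twisted Leibniz rule: if G and H are the quotients of g and h, then G h + (g o s_a) H is that of
    g h. For a coordinate the quotient is the constant a_i, because <a, a> = 2. *)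
Lemma linquot_ex a f : dotp a a = 2 -> polyf f ->
  exists g, polyf g /\ forall x, dotp a x * g x = f x - f (refl a x).
Proof.
move=> aa; elim=> [c|i|g h pg [G [pG GE]] ph [H [pH HE]]|g h pg [G [pG GE]] ph [H [pH HE]]].
- by exists (fun=> 0); split=> [|x]; [exact: polyf_cst | rewrite mulr0 subrr].
- exists (fun=> a ord0 i); split=> [|x]; first exact: polyf_cst.
  by rewrite /refl !mxE aa; field.
- exists (fun x => G x + H x); split=> [|x]; first exact: polyfD.
  by rewrite mulrDr GE HE; ring.
- exists (fun x => G x * h x + g (refl a x) * H x); split=> [|x].
    by apply: polyfD; apply: polyfM => //; exact: polyf_refl.
  by rewrite mulrDr mulrA GE (mulrCA (dotp a x)) HE; ring.
Qed.

Lemma linquotP a f : dotp a a = 2 -> polyf f ->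
  polyf (linquot a f) /\ forall x, dotp a x * linquot a f x = f x - f (refl a x).
Proof. by move=> aa pf; have [g Hg] := linquot_ex aa pf; exact: (@xgetI _ (fun=> 0) (linquot_spec a f) g Hg). Qed.

Lemma dotp_cancel a f g : dotp a a = 2 -> polyf f -> polyf g ->
  (forall x, dotp a x * f x = dotp a x * g x) -> f =1 g.
Proof.
move=> aa pf pg E x; apply/eqP; rewrite -subr_eq0; apply/eqP.
apply: (polyf_integral (z := a) (polyfB pf pg) (polyf_dotp a)) => [|y].
  by rewrite aa pnatr_eq0.
by rewrite mulrC mulrBr E subrr.
Qed.

Lemma linquot_eq a f g : dotp a a = 2 -> polyf f -> polyf g ->
  (forall x, dotp a x * g x = f x - f (refl a x)) -> linquot a f =1 g.
Proof.
move=> aa pf pg E; have [pq qE] := linquotP aa pf.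
by apply: (dotp_cancel aa) => // x; rewrite qE E.
Qed.

Lemma hom_linquot a m f : dotp a a = 2 -> polyf f -> hom m.+1 f -> hom m (linquot a f).
Proof.
move=> aa pf hf; have [pq qE] := linquotP aa pf.
apply: hom_of_ne0 => // s x s0.
have := @dotp_cancel a (fun x => linquot a f (s *: x)) (fun x => s ^+ m * linquot a f x) aa.
apply; [exact: polyf_scale | exact: polyfZ |] => {}x.
have := qE (s *: x); rewrite dotpZr reflZ !hf => E.
apply: (mulfI s0); rewrite [LHS]mulrA E [RHS](_ : _ = s ^+ m.+1 * (dotp a x * linquot a f x)).
  by rewrite qE mulrBr.
by rewrite exprS; ring.
Qed.

Lemma hom0_linquot a f x : dotp a a = 2 -> polyf f -> hom 0 f -> linquot a f x = 0.
Proof.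
move=> aa pf hf; apply: (linquot_eq aa pf (polyf_cst 0)) => y.
by rewrite (hom0_cst hf) subrr mulr0.
Qed.

End Hom.

(** * Dunkl operators *)

Section Reflections.
Context {R : realType} {N : nat}.
Local Notation vec := 'rV[R]_N.
Implicit Types (x y a b : vec) (s : R).

Lemma dotpC x y : dotp x y = dotp y x.
Proof. by apply: eq_bigr => i _; rewrite mulrC. Qed.

Lemma dotpDr a x y : dotp a (x + y) = dotp a x + dotp a y.
Proof. by rewrite /dotp -big_split; apply: eq_bigr => i _; rewrite mxE mulrDr. Qed.

Lemma dotpNr a x : dotp a (- x) = - dotp a x.
Proof. by rewrite -scaleN1r dotpZr mulN1r. Qed.

Lemma dotpBr a x y : dotp a (x - y) = dotp a x - dotp a y.
Proof. by rewrite dotpDr dotpNr. Qed.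

Lemma dotpZl s a x : dotp (s *: a) x = s * dotp a x.
Proof. by rewrite dotpC dotpZr dotpC. Qed.

Lemma dotpDl a b x : dotp (a + b) x = dotp a x + dotp b x.
Proof. by rewrite dotpC dotpDr !(dotpC x). Qed.

Lemma dotpNl a x : dotp (- a) x = - dotp a x.
Proof. by rewrite dotpC dotpNr dotpC. Qed.

Lemma dotpBl a b x : dotp (a - b) x = dotp a x - dotp b x.
Proof. by rewrite dotpDl dotpNl. Qed.

Lemma dotp0r a : dotp a 0 = 0.
Proof. by rewrite -(scale0r 0) dotpZr mul0r. Qed.

Lemma dotp_ge0 x : 0 <= dotp x x.
Proof. by apply: sumr_ge0 => i _; rewrite -expr2 sqr_ge0. Qed.

Lemma dotp_eq0 x : (dotp x x == 0) = (x == 0).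
Proof.
apply/idP/eqP => [|->]; last by rewrite dotp0r.
rewrite psumr_eq0 => [/allP H|i _]; last by rewrite -expr2 sqr_ge0.
by apply/rowP => i; have := H i (mem_index_enum _); rewrite mxE -expr2 sqrf_eq0 => /eqP.
Qed.

Lemma dotp_delta x i : dotp x (delta_mx 0 i) = x ord0 i.
Proof.
rewrite /dotp (bigD1 i) //= big1 => [|j /negPf ji]; rewrite !mxE ?eqxx ?mulr1 ?addr0 //=.
by rewrite ji mulr0.
Qed.

Lemma refl2 a x : dotp a a = 2 -> refl a x = x - dotp a x *: a.
Proof. by rewrite /refl => ->; congr (_ - _ *: _); field. Qed.

Lemma dotp_refl a x : dotp a a = 2 -> dotp a (refl a x) = - dotp a x.
Proof. by move=> aa; rewrite refl2 // dotpBr dotpZr aa; ring. Qed.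

Lemma reflK a x : dotp a a = 2 -> refl a (refl a x) = x.
Proof. by move=> aa; rewrite refl2 // dotp_refl // refl2 // scaleNr opprK subrK. Qed.

Lemma refl_self a : dotp a a = 2 -> refl a a = - a.
Proof. by move=> aa; rewrite refl2 // aa scaler_nat mulr2n opprD addrA subrr sub0r. Qed.

Lemma dotp_reflC a x y : dotp a a = 2 -> dotp (refl a x) y = dotp x (refl a y).
Proof.
move=> aa; rewrite !refl2 // dotpBl dotpBr dotpZl dotpZr (dotpC x a); ring.
Qed.

Lemma dotp_refl_refl a x y : dotp a a = 2 -> dotp (refl a x) (refl a y) = dotp x y.
Proof. by move=> aa; rewrite dotp_reflC // reflK. Qed.

Lemma reflNl a x : refl (- a) x = refl a x.
Proof. by rewrite /refl !dotpNl dotpNr opprK mulrN mulNr scaleNr scalerN opprK. Qed.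

Lemma reflB a x y : refl a (x - y) = refl a x - refl a y.
Proof.
by rewrite /refl dotpBr mulrBr mulrBl scalerBl; apply/rowP => i; rewrite !mxE; ring.
Qed.

Lemma reflN a x : refl a (- x) = - refl a x.
Proof. by rewrite -[- x]scaleN1r reflZ scaleN1r. Qed.

Lemma refl_conj a b x : dotp a a = 2 -> dotp b b = 2 ->
  refl (refl b a) (refl b x) = refl b (refl a x).
Proof.
move=> aa bb; rewrite (refl2 (a := refl b a)) ?dotp_refl_refl //.
by rewrite (refl2 x aa) reflB reflZ.
Qed.

End Reflections.

(** * Dunkl operators and the Dunkl Laplacian of a root system *)

Section Roots.
Context {R : realType} {N : nat}.
Local Notation vec := 'rV[R]_N.
Variables (Rs Rp : seq vec) (k : vec -> R).
Hypotheses (Hrs : reduced_root_system Rs) (Hps : positive_subsystem Rs Rp)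
  (Hk : multiplicity Rs k).
Implicit Types (x y a b xi v : vec) (f g q : vec -> R).
Local Notation e i := (delta_mx 0 i : vec).

Lemma root2 a : a \in Rs -> dotp a a = 2.
Proof. by case: Hrs => _ H _ _ /H. Qed.

Lemma rootN a : a \in Rs -> - a \in Rs.
Proof. by move=> aR; rewrite -(refl_self (root2 aR)); case: Hrs => _ _ H _; exact: H. Qed.

Lemma root_refl a b : a \in Rs -> b \in Rs -> refl a b \in Rs.
Proof. by case: Hrs => _ _ H _; exact: H. Qed.

Lemma pos_root a : a \in Rp -> a \in Rs.
Proof. by case: Hps => b [_ ->]; rewrite mem_filter => /andP[]. Qed.

Lemma pos_root2 a : a \in Rp -> dotp a a = 2.
Proof. by move/pos_root/root2. Qed.

Lemma pos_uniq : uniq Rp.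
Proof. by case: Hps => b [_ ->]; rewrite filter_uniq //; case: Hrs. Qed.

Lemma pos_rootN a : a \in Rs -> (- a \in Rp) = (a \notin Rp).
Proof.
case: Hps => b [b0 ->] aR; rewrite !mem_filter rootN // aR !andbT dotpNl.
by rewrite oppr_gt0 -leNgt le_eqVlt (negPf (b0 _ aR)).
Qed.

Lemma multN a : a \in Rs -> k (- a) = k a.
Proof. by move=> aR; rewrite -(refl_self (root2 aR)); case: Hk => _ ->. Qed.

Lemma mult_refl a b : a \in Rs -> b \in Rs -> k (refl b a) = k a.
Proof. by case: Hk => _; exact. Qed.

Lemma mult_ge0 a : a \in Rp -> 0 <= k a.
Proof. by move/pos_root => aR; case: Hk => H _; exact: H. Qed.

Lemma generic_point : exists b, forall a, a \in Rp -> dotp a b != 0.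
Proof. by case: Hps => b [b0 _]; exists b => a /pos_root /b0. Qed.

(* Reflections permute the positive roots up to sign. *)
Lemma pos_reindex (U : Type) (idx : U) (op : Monoid.com_law idx) (phi : vec -> U) b :
  b \in Rs -> (forall a, a \in Rs -> phi (- a) = phi a) ->
  \big[op/idx]_(a <- Rp) phi (refl b a) = \big[op/idx]_(a <- Rp) phi a.
Proof.
move=> bR phiN; pose rho a := if refl b a \in Rp then refl b a else - refl b a.
have bb := root2 bR.
have rhoP a : a \in Rp -> rho a \in Rp.
  move=> /pos_root aR; rewrite /rho; case: ifP => // /negbT H.
  by rewrite pos_rootN // root_refl.
have rhoK a : a \in Rp -> rho (rho a) = a.
  move=> aP; have aR := pos_root aP; rewrite /rho.
  case: (boolP (refl b a \in Rp)) => H; first by rewrite reflK // aP.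
  by rewrite reflN reflK // pos_rootN // aP /= opprK.
have prho : perm_eq [seq rho a | a <- Rp] Rp.
  apply: uniq_perm; last 1 first.
  - move=> a; apply/mapP/idP => [[c cP ->]|aP]; first exact: rhoP.
    by exists (rho a); rewrite ?rhoK //; exact: rhoP.
  - rewrite map_inj_in_uniq ?pos_uniq // => c d cP dP E.
    by rewrite -(rhoK _ cP) E rhoK.
  - exact: pos_uniq.
rewrite -[RHS](perm_big _ prho) big_map big_seq [RHS]big_seq; apply: eq_bigr => a aP.
rewrite /rho; case: ifP => // _; rewrite phiN //; exact: root_refl (pos_root aP).
Qed.

(* The difference quotient is replaced by its polynomial extension [linquot], so that the
   operator is defined on the hyperplanes <a, x> = 0 as well; see [dunklE]. *)
Definition T_def xi f x : R :=
  dd xi f x + \sum_(a <- Rp) k a * dotp a xi * linquot a f x.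

Fact T_key : unit. Proof. by []. Qed.
Definition dunklT := locked_with T_key T_def.

Lemma TfunE : dunklT = T_def.
Proof. by rewrite /dunklT unlock. Qed.

Lemma linquotN a f x : dotp a a = 2 -> polyf f -> linquot (- a) f x = - linquot a f x.
Proof.
move=> aa pf; have Na : dotp (- a) (- a) = 2 by rewrite dotpNl dotpNr opprK.
have [pq qE] := linquotP aa pf.
apply: (linquot_eq (g := fun x => - linquot a f x) Na pf) => [|y]; first exact: polyfN.
by rewrite dotpNl mulrNN qE reflNl.
Qed.

Lemma polyf_linquot a f : a \in Rp -> polyf f -> polyf (linquot a f).
Proof. by move=> aP pf; have [] := linquotP (pos_root2 aP) pf. Qed.

Lemma linquotE a f x : a \in Rp -> polyf f -> dotp a x * linquot a f x = f x - f (refl a x).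
Proof. by move=> aP pf; have [_ ->] := linquotP (pos_root2 aP) pf. Qed.

Lemma polyf_T xi f : polyf f -> polyf (dunklT xi f).
Proof.
move=> pf; rewrite TfunE; apply: polyfD; first exact: polyf_dd.
rewrite (_ : (fun x => _) = fun x => \sum_(a <- Rp | a \in Rp) k a * dotp a xi * linquot a f x).
  by apply: polyf_sum => a aP; apply: polyfZ; exact: polyf_linquot.
by apply/funext => x; rewrite big_seq.
Qed.

Lemma hom_T xi m f : polyf f -> hom m.+1 f -> hom m (dunklT xi f).
Proof.
move=> pf hf; rewrite TfunE; apply: homD; first exact: hom_dd.
rewrite (_ : (fun x => _) = fun x => \sum_(a <- Rp | a \in Rp) k a * dotp a xi * linquot a f x).
  by apply: hom_sum => a aP; apply: homZ; exact: hom_linquot (pos_root2 aP) pf hf.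
by apply/funext => x; rewrite big_seq.
Qed.

Lemma hom0_T xi f x : polyf f -> hom 0 f -> dunklT xi f x = 0.
Proof.
move=> pf hf; rewrite TfunE /T_def hom0_dd // add0r big_seq big1 // => a aP.
by rewrite hom0_linquot ?mulr0 // pos_root2.
Qed.

Lemma T_D xi f g x : polyf f -> polyf g ->
  dunklT xi (fun x => f x + g x) x = dunklT xi f x + dunklT xi g x.
Proof.
move=> pf pg; rewrite TfunE /T_def ddD // addrACA -big_split /=; congr (_ + _).
rewrite big_seq [RHS]big_seq; apply: eq_bigr => a aP; rewrite -mulrDr; congr (_ * _).
apply: (linquot_eq (g := fun x => linquot a f x + linquot a g x) (pos_root2 aP) (polyfD pf pg)) => [|y].
  by apply: polyfD; exact: polyf_linquot.
by rewrite mulrDr !linquotE //; ring.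
Qed.

Lemma T_Z c xi f x : polyf f -> dunklT xi (fun x => c * f x) x = c * dunklT xi f x.
Proof.
move=> pf; rewrite TfunE /T_def ddZ // mulrDr mulr_sumr; congr (_ + _).
rewrite big_seq [RHS]big_seq; apply: eq_bigr => a aP; rewrite [RHS]mulrCA; congr (_ * _).
apply: (linquot_eq (g := fun x => c * linquot a f x) (pos_root2 aP) (polyfZ c pf)) => [|y].
  by apply: polyfZ; exact: polyf_linquot.
by rewrite mulrCA linquotE //; ring.
Qed.

Lemma T_sum I (r : seq I) (F : I -> vec -> R) xi x : (forall i, polyf (F i)) ->
  dunklT xi (fun x => \sum_(i <- r) F i x) x = \sum_(i <- r) dunklT xi (F i) x.
Proof.
move=> pF; elim: r => [|i r IH].
  rewrite big_nil (_ : (fun x => _) = fun=> 0); last by apply/funext => y; rewrite big_nil.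
  by apply: hom0_T (polyf_cst 0) (hom0E 0).
rewrite big_cons -IH -T_D //; last exact: polyf_sum.
by congr (dunklT _ _ _); apply/funext => y; rewrite big_cons.
Qed.

Lemma T_basis xi f x : polyf f -> dunklT xi f x = \sum_i xi ord0 i * dunklT (e i) f x.
Proof.
move=> pf; rewrite TfunE /T_def dd_basis //.
under [RHS]eq_bigr do rewrite mulrDr mulr_sumr.
rewrite big_split /= exchange_big /=; congr (_ + _); apply: eq_bigr => a _.
rewrite {1}/dotp mulr_sumr mulr_suml; apply: eq_bigr => i _.
by rewrite dotp_delta; ring.
Qed.

Lemma dunklE xi f x : polyf f -> (forall a, a \in Rp -> dotp a x != 0) ->
  dunkl Rp k xi f x = dunklT xi f x.
Proof.
move=> pf H; rewrite /dunkl TfunE /T_def ddE; congr (_ + _).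
rewrite big_seq [RHS]big_seq; apply: eq_bigr => a aP.
by rewrite -linquotE //; field; exact: H.
Qed.

Lemma T_coordM xi j f x : polyf f ->
  dunklT xi (fun y => y ord0 j * f y) x =
  xi ord0 j * f x + x ord0 j * dunklT xi f x
  + \sum_(a <- Rp) k a * dotp a xi * a ord0 j * f (refl a x).
Proof.
move=> pf; have pj := @polyf_coord R N j; rewrite TfunE /T_def ddM // dd_coord mulrDr -!addrA; congr (_ + (_ + _)).
rewrite mulr_sumr -big_split big_seq [RHS]big_seq; apply: eq_bigr => a aP /=.
rewrite [X in _ * X](_ : _ = x ord0 j * linquot a f x + a ord0 j * f (refl a x)); first by ring.
have aa := pos_root2 aP.
apply: (linquot_eq (g := fun x => x ord0 j * linquot a f x + a ord0 j * f (refl a x)) aa (polyfM pj pf)) => [|y].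
  by apply: polyfD; apply: polyfM => //; [exact: polyf_linquot | exact: polyf_cst | exact: polyf_refl].
by rewrite mulrDr mulrCA linquotE // refl2 // !mxE; ring.
Qed.

(** Equivariance under a reflection, in the direction of its own root, which the reflection negates.
    This is what makes the reflection terms cancel in [Dk_coordM]. *)
Lemma T_refl b f x : b \in Rs -> polyf f ->
  dunklT b (fun x => f (refl b x)) x = - dunklT b f (refl b x).
Proof.
move=> bR pf; have bb := root2 bR; have pfb := polyf_refl b pf.
rewrite TfunE /T_def dd_refl // refl_self // -scaleN1r -[-1 *: b]addr0 dd_lin // dd0 // addr0 mulN1r opprD.
congr (_ + _).
pose phi a := k a * dotp a b * linquot a f (refl b x).
rewrite -[X in - X](@pos_reindex _ _ _ phi b bR); last first.
  move=> a aR; have aa := root2 aR; rewrite /phi multN // dotpNl linquotN //; ring.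
rewrite -sumrN big_seq [RHS]big_seq; apply: eq_bigr => a aP.
have aa := pos_root2 aP; have aR := pos_root aP.
rewrite /phi mult_refl // dotp_reflC // refl_self // dotpNr mulrN mulNr opprK; congr (_ * _).
have rr : dotp (refl b a) (refl b a) = 2 by rewrite dotp_refl_refl.
have [pq qE] := linquotP rr pf.
apply: (linquot_eq (g := fun x => linquot (refl b a) f (refl b x)) aa pfb) => [|y].
  exact: polyf_refl.
by rewrite -(dotp_refl_refl a y bb) qE refl_conj.
Qed.

(** The defect of the Leibniz rule is written with the two quotients because the summand of a is
    then odd under the reflection in a, hence has mean zero for every reflection-invariant
    functional. *)
Lemma T_mul xi f g x : polyf f -> polyf g ->
  dunklT xi (fun y => f y * g y) x = dunklT xi f x * g x + f x * dunklT xi g x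
  - \sum_(a <- Rp) k a * dotp a xi * (dotp a x * (linquot a f x * linquot a g x)).
Proof.
move=> pf pg; rewrite TfunE /T_def ddM // mulrDl mulrDr addrACA -!addrA; congr (_ + (_ + _)).
rewrite mulr_sumr mulr_suml -sumrN -!big_split big_seq [RHS]big_seq; apply: eq_bigr => a aP /=.
have aa := pos_root2 aP.
have [pF pG] := (polyf_linquot aP pf, polyf_linquot aP pg).
rewrite [X in _ * X](_ : _ = linquot a f x * g x + f x * linquot a g x
  - dotp a x * (linquot a f x * linquot a g x)); first by ring.
apply: (linquot_eq (g := fun x => linquot a f x * g x + f x * linquot a g x
  - dotp a x * (linquot a f x * linquot a g x)) aa (polyfM pf pg)) => [|y].
  apply: polyfB; first by apply: polyfD; exact: polyfM.
  by apply: polyfM; [exact: polyf_dotp | exact: polyfM].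
rewrite (_ : dotp a y * _ = (dotp a y * linquot a f y) * g y + f y * (dotp a y * linquot a g y)
  - (dotp a y * linquot a f y) * (dotp a y * linquot a g y)); last by ring.
by rewrite !linquotE //; ring.
Qed.

Lemma linquot_even a f x : a \in Rp -> polyf f -> linquot a f (refl a x) = linquot a f x.
Proof.
move=> aP pf; have aa := pos_root2 aP; have pq := polyf_linquot aP pf.
apply: (dotp_cancel aa (polyf_refl a pq) pq) => y.
have := linquotE (refl a y) aP pf; rewrite dotp_refl // reflK // => E.
by rewrite [RHS]linquotE // -[LHS]opprK -mulNr E opprB.
Qed.

Lemma euler_T m f x : polyf f -> hom m f ->
  \sum_i x ord0 i * dunklT (e i) f x = m%:R * f x + \sum_(a <- Rp) k a * (f x - f (refl a x)).
Proof.
move=> pf hf; rewrite -T_basis // TfunE /T_def (euler x pf hf); congr (_ + _).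
by rewrite big_seq [RHS]big_seq; apply: eq_bigr => a aP; rewrite -linquotE // mulrA.
Qed.

Definition gam_sum : R := \sum_(a <- Rp) k a.

(** Homogeneous dimension of the measure w_k(y) dy, since w_k has degree 2 [gam_sum]. *)
Definition dunkl_dim : R := N%:R + 2 * gam_sum.

Lemma T_coord_sum f x : polyf f ->
  \sum_i dunklT (e i) (fun y => y ord0 i * f y) x =
  N%:R * f x + \sum_i x ord0 i * dunklT (e i) f x + 2 * \sum_(a <- Rp) k a * f (refl a x).
Proof.
move=> pf; under eq_bigr do rewrite T_coordM // mxE !eqxx mul1r.
rewrite !big_split /= big_const cardE size_enum_ord iter_addr_0 -mulr_natl; congr (_ + _ + _); first by ring.
rewrite exchange_big mulr_sumr big_seq [RHS]big_seq; apply: eq_bigr => a aP /=.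
rewrite -(pos_root2 aP) {2}/dotp mulr_suml; apply: eq_bigr => i _.
by rewrite dotp_delta; ring.
Qed.

Definition dunkl_lap f x : R := \sum_i dunklT (e i) (dunklT (e i) f) x.

Lemma polyf_Dk f : polyf f -> polyf (dunkl_lap f).
Proof. by move=> pf; apply: polyf_sum => i _; do 2 apply: polyf_T. Qed.

(** The commutator of the Dunkl Laplacian with a coordinate. Applying T_i twice leaves two sums over
    reflections; summed over i they become T_a f at the reflected point and T_a of the reflected f,
    which cancel by [T_refl]. *)
Lemma Dk_coordM j f x : polyf f ->
  dunkl_lap (fun y => y ord0 j * f y) x = x ord0 j * dunkl_lap f x + 2 * dunklT (e j) f x.
Proof.
move=> pf; rewrite /dunkl_lap.
pose G i y := \sum_(a <- Rp) (k a * dotp a (e i) * a ord0 j) * f (refl a y).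
have pG i : polyf (G i) by apply: polyf_sum => a _; apply: polyfZ; exact: polyf_refl.
have pT i : polyf (dunklT (e i) f) by exact: polyf_T.
have pj := @polyf_coord R N j.
have E i : dunklT (e i) (dunklT (e i) (fun y => y ord0 j * f y)) x =
    (e i) ord0 j * dunklT (e i) f x + ((e i) ord0 j * dunklT (e i) f x + x ord0 j * dunklT (e i) (dunklT (e i) f) x)
    + \sum_(a <- Rp) k a * dotp a (e i) * a ord0 j * (dunklT (e i) f (refl a x)
       + dunklT (e i) (fun y => f (refl a y)) x).
  have -> : dunklT (e i) (fun y => y ord0 j * f y) =
      fun y => (e i) ord0 j * f y + y ord0 j * dunklT (e i) f y + G i y.
    by apply/funext => y; rewrite T_coordM.
  have p1 : polyf (fun y => (e i) ord0 j * f y) by exact: polyfZ.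
  have p2 : polyf (fun y => y ord0 j * dunklT (e i) f y) by exact: polyfM.
  rewrite T_D ?T_D ?T_Z ?T_coordM //; last exact: polyfD.
  rewrite /G T_sum; last by move=> a; apply: polyfZ; exact: polyf_refl.
  rewrite -!addrA; congr (_ + (_ + (_ + _))); rewrite -big_split /=; apply: eq_bigr => a _ /=.
  by rewrite T_Z ?mulrDr //; exact: polyf_refl.
under eq_bigr do rewrite E.
have S h : \sum_i (e i : vec) ord0 j * h i = h j :> R.
  rewrite (bigD1 j) //= big1 => [|i /negPf ij]; rewrite !mxE ?eqxx ?mul1r ?addr0 //=.
  by rewrite eq_sym ij mul0r.
rewrite !big_split /= !(S (fun i => dunklT (e i) f x)) /= -mulr_sumr exchange_big /= [X in _ + X = _](_ : _ = 0).
  by ring.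
rewrite big_seq big1 // => a aP; have aR := pos_root aP.
rewrite (eq_bigr (fun i => k a * a ord0 j * (a ord0 i * dunklT (e i) f (refl a x)
  + a ord0 i * dunklT (e i) (fun y => f (refl a y)) x))); last by move=> i _; rewrite dotp_delta; ring.
rewrite -mulr_sumr big_split /= -!T_basis //; last exact: polyf_refl.
by rewrite T_refl // subrr mulr0.
Qed.

End Roots.

(* The functional f |-> d_k^-1 \int f w_k over the unit sphere, in the form in which the algebra uses it. *)
Record dunkl_mean (R : realType) (N : nat) (Rp : seq 'rV[R]_N) (k : 'rV[R]_N -> R)
    (Lam : ('rV[R]_N -> R) -> R) : Prop := DunklMean {
  meanD : forall f g, polyf f -> polyf g -> Lam (fun x => f x + g x) = Lam f + Lam g;
  meanZ : forall c f, polyf f -> Lam (fun x => c * f x) = c * Lam f;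
  mean1 : Lam (fun=> 1) = 1;
  mean_refl : forall a f, a \in Rp -> polyf f -> Lam (fun x => f (refl a x)) = Lam f;
  mean_T : forall m i f, polyf f -> hom m f ->
    Lam (dunklT Rp k (delta_mx 0 i) f) = (m%:R - 1 + dunkl_dim Rp k) * Lam (fun x => x ord0 i * f x);
  mean_odd : forall m f, polyf f -> hom m f -> odd m -> Lam f = 0;
  mean_sq : forall f, polyf f -> Lam (fun x => dotp x x * f x) = Lam f;
  mean_ge0 : forall f, polyf f -> (forall x, 0 <= f x) -> 0 <= Lam f }.

(** * The Gaussian pairing *)

Section GaussianPairing.
Context {R : realType} {N : nat}.
Local Notation vec := 'rV[R]_N.
Variables (Rs Rp : seq vec) (k : vec -> R).
Hypotheses (Hrs : reduced_root_system Rs) (Hps : positive_subsystem Rs Rp)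
  (Hk : multiplicity Rs k).
Implicit Types (x y a b xi v : vec) (f g q : vec -> R).
Local Notation e i := (delta_mx 0 i : vec).
Local Notation T := (dunklT Rp k).
Local Notation Dk := (dunkl_lap Rp k).
Local Notation N2 := (dunkl_dim Rp k).
Local Notation pT := (polyf_T k Hrs Hps).
Local Notation pDk := (polyf_Dk k Hrs Hps).

(** Assumed in this section and derived in [T_comm] from the intertwining operator. *)
Hypothesis Tcomm : forall xi eta f x, polyf f -> T xi (T eta f) x = T eta (T xi f) x.

Lemma T0 xi x : T xi (fun=> 0) x = 0.
Proof. by apply: (hom0_T k Hrs Hps) (polyf_cst 0) (hom0E 0). Qed.

Lemma Dk_D f g : polyf f -> polyf g -> Dk (fun x => f x + g x) = fun x => Dk f x + Dk g x.
Proof.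
move=> pf pg; apply/funext => x; rewrite -big_split; apply: eq_bigr => i _ /=.
have -> : T (e i) (fun x => f x + g x) = fun x => T (e i) f x + T (e i) g x.
  by apply/funext => y; rewrite (T_D k Hrs Hps).
by rewrite (T_D k Hrs Hps) //; exact: pT.
Qed.

Lemma Dk_Z c f : polyf f -> Dk (fun x => c * f x) = fun x => c * Dk f x.
Proof.
move=> pf; apply/funext => x; rewrite mulr_sumr; apply: eq_bigr => i _ /=.
have -> : T (e i) (fun x => c * f x) = fun x => c * T (e i) f x.
  by apply/funext => y; rewrite (T_Z k Hrs Hps).
by rewrite (T_Z k Hrs Hps) //; exact: pT.
Qed.

Lemma Dk_T xi f : polyf f -> Dk (T xi f) = T xi (Dk f).
Proof.
move=> pf; apply/funext => x; rewrite /Dk (T_sum k Hrs Hps); last by move=> i; do 2 apply: pT.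
apply: eq_bigr => i _; rewrite -Tcomm; last exact: pT.
by congr (T _ _ _); apply/funext => y; rewrite Tcomm.
Qed.

Definition dunkl_lapn n f := iter n Dk f.

Lemma polyf_Dkn n f : polyf f -> polyf (dunkl_lapn n f).
Proof. by move=> pf; elim: n => //= n IH; exact: pDk. Qed.

Lemma Dkn_D n f g : polyf f -> polyf g ->
  dunkl_lapn n (fun x => f x + g x) = fun x => dunkl_lapn n f x + dunkl_lapn n g x.
Proof. by move=> pf pg; elim: n => //= n ->; rewrite Dk_D //; exact: polyf_Dkn. Qed.

Lemma Dkn_Z n c f : polyf f -> dunkl_lapn n (fun x => c * f x) = fun x => c * dunkl_lapn n f x.
Proof. by move=> pf; elim: n => //= n ->; rewrite Dk_Z //; exact: polyf_Dkn. Qed.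

Lemma Dkn_sum n I (r : seq I) (F : I -> vec -> R) x : (forall i, polyf (F i)) ->
  dunkl_lapn n (fun x => \sum_(i <- r) F i x) x = \sum_(i <- r) dunkl_lapn n (F i) x.
Proof.
move=> pF; elim: r => [|i r IH].
  rewrite big_nil (_ : (fun x => _) = fun=> 0 * 0).
    by rewrite (Dkn_Z n 0 (polyf_cst 0)) mul0r.
  by apply/funext => y; rewrite big_nil mul0r.
rewrite big_cons -IH -[RHS]/((fun x => dunkl_lapn n (F i) x + dunkl_lapn n (fun y => \sum_(i <- r) F i y) x) x).
rewrite -Dkn_D //; last exact: polyf_sum.
by congr (dunkl_lapn n _ x); apply/funext => y; rewrite big_cons.
Qed.

Lemma Dkn_T n xi f : polyf f -> dunkl_lapn n (T xi f) = T xi (dunkl_lapn n f).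
Proof. by move=> pf; elim: n => //= n ->; rewrite Dk_T //; exact: polyf_Dkn. Qed.

(** The commutator of [Dk_coordM], iterated; T_j commutes with the Laplacian, so the n commutators
    are equal. For n = 0 the predecessor is a dummy, multiplied by 0. *)
Lemma Dkn_coordM n j f x : polyf f -> dunkl_lapn n (fun y => y ord0 j * f y) x =
  x ord0 j * dunkl_lapn n f x + 2 * n%:R * T (e j) (dunkl_lapn n.-1 f) x.
Proof.
move=> pf; elim: n x => [|n IH] x; first by rewrite /= mulr0 mul0r addr0.
rewrite -[LHS]/(Dk (dunkl_lapn n (fun y => y ord0 j * f y)) x).
have -> : dunkl_lapn n (fun y => y ord0 j * f y) =
    fun x => x ord0 j * dunkl_lapn n f x + 2 * n%:R * T (e j) (dunkl_lapn n.-1 f) x by apply/funext => y.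
have p1 := polyf_Dkn n pf; have p2 := polyf_Dkn n.-1 pf.
have pj := @polyf_coord R N j.
rewrite Dk_D; [|exact: polyfM|by apply: polyfZ; exact: pT].
rewrite (Dk_coordM Hrs Hps Hk) // Dk_Z; last exact: pT.
rewrite Dk_T // -/(dunkl_lapn n.+1 f) /=.
case: n {IH p1} p2 => [|n] p2 /=; first by ring.
by rewrite -/(dunkl_lapn n f) (_ : n.+2%:R = n.+1%:R + 1) ?natr1 //; ring.
Qed.

Lemma hom_Dk m f : polyf f -> hom m.+2 f -> hom m (Dk f).
Proof.
move=> pf hf; apply: hom_sum => i _.
by apply: (hom_T k Hrs Hps _ (pT _ pf)); exact: (hom_T k Hrs Hps).
Qed.

Lemma hom_Dk0 m f x : polyf f -> hom m f -> (m < 2)%N -> Dk f x = 0.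
Proof.
move=> pf; case: m => [|[|//]] hf _; rewrite /Dk big1 // => i _.
  by rewrite (_ : T (e i) f = fun=> 0) ?T0 //; apply/funext => y; exact: (hom0_T k Hrs Hps).
by apply: (hom0_T k Hrs Hps _ _ (pT _ pf)); exact: (hom_T k Hrs Hps).
Qed.

Lemma Dkn_0 n x : dunkl_lapn n (fun=> 0) x = 0.
Proof.
rewrite (_ : (fun=> 0) = fun=> 0 * 0); last by apply/funext => y; rewrite mul0r.
by rewrite (Dkn_Z n 0 (polyf_cst 0)) mul0r.
Qed.

Lemma hom_Dkn n m f : polyf f -> hom (m + n.*2) f -> hom m (dunkl_lapn n f).
Proof.
move=> pf; elim: n f pf m => [|n IH] f pf m; first by rewrite addn0.
rewrite doubleS !addnS => hf; rewrite /dunkl_lapn iterSr; apply: IH; first exact: pDk.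
exact: hom_Dk.
Qed.

Lemma Dkn_deg n m f x : polyf f -> hom m f -> (m < n.*2)%N -> dunkl_lapn n f x = 0.
Proof.
elim: n f m => [|n IH] f m pf hf //; rewrite doubleS => mn.
rewrite /dunkl_lapn iterSr -/(dunkl_lapn n _).
case: m hf mn => [|[|m]] hf mn.
- by rewrite (_ : Dk f = fun=> 0) ?Dkn_0 //; apply/funext => y; exact: hom_Dk0 hf _.
- by rewrite (_ : Dk f = fun=> 0) ?Dkn_0 //; apply/funext => y; exact: hom_Dk0 hf _.
by apply: IH (pDk pf) (hom_Dk pf hf) _.
Qed.

(* For even m, [gauss_moment m * Lam f] is the w_k-Gaussian mean of a homogeneous f of degree m. *)
Definition gauss_moment m : R := \prod_(i < m./2) (N2 + 2 * i%:R).

Lemma gam0 : gauss_moment 0 = 1.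
Proof. by rewrite /gauss_moment big_ord0. Qed.

Lemma gamSS m : ~~ odd m -> gauss_moment m.+2 = (N2 + m%:R) * gauss_moment m.
Proof.
move=> om; rewrite /gauss_moment [m.+2./2]/= big_ord_recr /= mulrC; congr ((_ + _) * _).
by rewrite -natrM mul2n -[in RHS](odd_double_half m) (negPf om).
Qed.

Variable Lam : (vec -> R) -> R.
Hypothesis HL : dunkl_mean Rp k Lam.
Local Notation LamD := (meanD HL).
Local Notation LamZ := (meanZ HL).
Local Notation Lam1 := (mean1 HL).
Local Notation Lam_refl := (mean_refl HL).
Local Notation Lam_T := (mean_T HL).
Local Notation Lam_odd := (mean_odd HL).
Local Notation Lam_sq := (mean_sq HL).

Lemma Lam0 : Lam (fun=> 0) = 0.
Proof.
rewrite -[RHS](mul0r (Lam (fun=> 0))) -LamZ; last exact: polyf_cst.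
by congr Lam; apply/funext => x; rewrite mul0r.
Qed.

Lemma Lam_sum I (r : seq I) (F : I -> vec -> R) : (forall i, polyf (F i)) ->
  Lam (fun x => \sum_(i <- r) F i x) = \sum_(i <- r) Lam (F i).
Proof.
move=> pF; elim: r => [|i r IH].
  by rewrite big_nil -[RHS]Lam0; congr Lam; apply/funext => x; rewrite big_nil.
rewrite big_cons -IH -LamD //; last exact: polyf_sum.
by congr Lam; apply/funext => x; rewrite big_cons.
Qed.

Lemma Lam_anti a f : a \in Rp -> polyf f -> (forall x, f (refl a x) = - f x) -> Lam f = 0.
Proof.
move=> aP pf fa; have := Lam_refl aP pf.
have -> : (fun x => f (refl a x)) = fun x => -1 * f x by apply/funext => x; rewrite fa mulN1r.
by rewrite LamZ // mulN1r; lra.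
Qed.

(** Gaussian integration by parts: T_i f and y_i f have the same Gaussian mean. For odd m the factor
    in [mean_T] is the ratio of consecutive moments; for even m both sides vanish by parity. *)
Lemma gam_T m i f : polyf f -> hom m f ->
  gauss_moment m.-1 * Lam (T (e i) f) = gauss_moment m.+1 * Lam (fun x => x ord0 i * f x).
Proof.
move=> pf hf; have pif : polyf (fun x => x ord0 i * f x) by apply: polyfM => //; exact: polyf_coord.
have hif : hom m.+1 (fun x => x ord0 i * f x) := homM (@hom_coord _ _ i) hf.
case om : (odd m); last first.
  rewrite (Lam_odd pif hif) /= ?om // mulr0.
  case: m om hf {hif} => [|m] om hf.
    rewrite (_ : T (e i) f = fun=> 0) ?Lam0 ?mulr0 //.
    by apply/funext => x; exact: (hom0_T k Hrs Hps).
  rewrite (Lam_odd (pT _ pf) (hom_T k Hrs Hps _ pf hf)) ?mulr0 //.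
  by move: om => /= /negbFE.
case: m om hf {hif} => // m /= om hf.
by rewrite gamSS // (Lam_T _ pf hf) -natr1; ring.
Qed.

Lemma Lam_T_mul i f g : polyf f -> polyf g ->
  Lam (T (e i) (fun x => f x * g x)) =
  Lam (fun x => T (e i) f x * g x) + Lam (fun x => f x * T (e i) g x).
Proof.
move=> pf pg.
have p1 : polyf (fun x => T (e i) f x * g x) by apply: polyfM => //; exact: pT.
have p2 : polyf (fun x => f x * T (e i) g x) by apply: polyfM => //; exact: pT.
pose G a x := k a * dotp a (e i) * (dotp a x * (linquot a f x * linquot a g x)).
have -> : T (e i) (fun x => f x * g x) = fun x => (T (e i) f x * g x + f x * T (e i) g x)
    + \sum_(a <- Rp) -1 * (if a \in Rp then G a x else 0).
  apply/funext => x; rewrite (T_mul k Hrs Hps) //; congr (_ + _); rewrite -sumrN.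
  by rewrite big_seq [RHS]big_seq; apply: eq_bigr => a ->; rewrite mulN1r.
have pG a : polyf (fun x => if a \in Rp then G a x else 0).
  case: (boolP (a \in Rp)) => [aP|_]; last exact: polyf_cst.
  apply: polyfZ; apply: polyfM; first exact: polyf_dotp.
  by apply: polyfM; exact: (polyf_linquot Hrs Hps).
rewrite LamD; [|exact: polyfD|by apply: polyf_sum => a _; exact: polyfZ].
rewrite LamD // Lam_sum; last by move=> a; exact: polyfZ.
rewrite [X in _ + X]big1_seq ?addr0 // => a /= aP; rewrite LamZ // (Lam_anti aP) ?mulr0 // => x.
rewrite aP /G dotp_refl ?(pos_root2 Hrs Hps aP) // !(linquot_even Hrs Hps) //.
by ring.
Qed.

Lemma gam_adj m n i f g : polyf f -> hom m f -> polyf g -> hom n g ->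
  gauss_moment (m + n).+1 * Lam (fun x => x ord0 i * (f x * g x)) =
  gauss_moment (m + n).-1 * Lam (fun x => T (e i) f x * g x)
  + gauss_moment (m + n).-1 * Lam (fun x => f x * T (e i) g x).
Proof.
by move=> pf hf pg hg; rewrite -mulrDr -Lam_T_mul // gam_T //; [exact: polyfM | exact: homM].
Qed.

Variables (x0 : vec) (K : nat -> vec -> R).
Hypotheses (pK : forall j, polyf (K j)) (hK : forall j, hom j (K j))
  (K0 : K 0 = fun=> 1)
  (TK : forall i j y, T (e i) (K j.+1) y = x0 ord0 i * K j y).

Let h := dotp x0 x0 / 2.

(* The Gaussian pairing of q with the degree j part K j of the Dunkl kernel at x0. *)
Definition cc d q j := gauss_moment (d + j) * Lam (fun y => q y * K j y).

Lemma cc_rec d i q j : polyf q -> hom d q ->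
  cc d.+1 (fun y => y ord0 i * q y) j.+1 =
  gauss_moment (d + j) * Lam (fun y => T (e i) q y * K j.+1 y) + x0 ord0 i * cc d q j.
Proof.
move=> pq hq; rewrite /cc.
have := gam_adj i pq hq (pK j.+1) (hK j.+1); rewrite addnS /= addSn => E.
rewrite (_ : (fun y => _) = fun y => y ord0 i * (q y * K j.+1 y)); last first.
  by apply/funext => y; rewrite mulrA.
rewrite addnS E; congr (_ + _); rewrite [RHS]mulrCA; congr (_ * _).
rewrite -LamZ; last exact: polyfM.
by congr Lam; apply/funext => y; rewrite TK; ring.
Qed.

Lemma cc_rec0 d i q : polyf q -> hom d q ->
  cc d.+1 (fun y => y ord0 i * q y) 0 = gauss_moment d.-1 * Lam (fun y => T (e i) q y * K 0 y).
Proof.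
move=> pq hq; rewrite /cc addn0.
have := gam_adj i pq hq (pK 0) (hK 0); rewrite addn0 => E.
rewrite (_ : (fun y => _) = fun y => y ord0 i * (q y * K 0 y)); last first.
  by apply/funext => y; rewrite mulrA.
rewrite E (_ : (fun x => q x * _) = fun=> 0) ?Lam0 ?mulr0 ?addr0 //.
by apply/funext => y; rewrite (hom0_T k Hrs Hps) ?mulr0.
Qed.

(** The part of exp(|x0|^2 / 2) of degree s - d in x0, hence zero unless s - d is even and
    nonnegative. *)
Definition ec s d : R :=
  if (d <= s)%N && ~~ odd (s - d) then h ^+ (s - d)./2 / ((s - d)./2)`!%:R else 0.

Lemma ecSS s d : ec s.+1 d.+1 = ec s d.
Proof. by rewrite /ec ltnS subSS. Qed.

Lemma T_coord i y : T (e i) (fun z => z ord0 i) y = 1 + \sum_(a <- Rp) k a * a ord0 i ^+ 2.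
Proof.
rewrite (_ : (fun z => _) = fun z : vec => z ord0 i * (fun=> 1) z); last by apply/funext => z; rewrite mulr1.
rewrite (T_coordM k Hrs Hps) ?(hom0_T k Hrs Hps) //; try exact: polyf_cst; try exact: hom_cst.
rewrite mxE !eqxx mulr1 mulr0 addr0; congr (_ + _); apply: eq_bigr => a _.
by rewrite dotp_delta; ring.
Qed.

Lemma sum_T_coord y : \sum_i T (e i) (fun z => z ord0 i) y = N2.
Proof.
under eq_bigr do rewrite T_coord.
rewrite big_split /= big_const cardE size_enum_ord iter_addr_0; congr (_ + _).
rewrite exchange_big /= mulr_sumr big_seq [RHS]big_seq; apply: eq_bigr => a aP.
by rewrite -mulr_sumr -(pos_root2 Hrs Hps aP) mulrC; congr (_ * _).
Qed.

(** The Gaussian mean of the Dunkl kernel at x0 is exp(|x0|^2 / 2), degree by degree. The mean of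
    |y|^2 K_(j+2) is computed twice: integrating by parts, and dropping |y|^2 on the sphere at the
    price of a moment ratio. The terms in [N2] cancel, leaving (j + 2) times the mean of K_(j+2)
    equal to |x0|^2 times that of K_j. *)
Lemma cc_K j : gauss_moment j * Lam (K j) = ec j 0.
Proof.
have Kodd n : odd n -> Lam (K n) = 0 by exact: Lam_odd.
rewrite /ec leq0n subn0; case oj : (odd j); first by rewrite Kodd ?mulr0.
rewrite -[in LHS](odd_double_half j) oj add0n.
move: (j./2) => n {oj j}; elim: n => [|n IH].
  by rewrite gam0 K0 Lam1 expr0 fact0 invr1 mulr1.
rewrite doubleS; set j := n.*2 in IH *.
have oj : ~~ odd j by rewrite odd_double.
have E : gauss_moment j.+4 * Lam (fun y => dotp y y * K j.+2 y) =
    N2 * (gauss_moment j.+2 * Lam (K j.+2)) + dotp x0 x0 * (gauss_moment j * Lam (K j)).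
  rewrite (_ : (fun y => _) = fun y => \sum_i y ord0 i * (y ord0 i * K j.+2 y)); last first.
    by apply/funext => y; rewrite /dotp mulr_suml; apply: eq_bigr => i _; rewrite mulrA.
  have pi i := @polyf_coord R N i.
  rewrite Lam_sum; last by move=> i; apply: polyfM => //; exact: polyfM.
  rewrite mulr_sumr.
  have E1 i : gauss_moment j.+4 * Lam (fun x => x ord0 i * (x ord0 i * K j.+2 x)) =
      T (e i) (fun z => z ord0 i) 0 * (gauss_moment j.+2 * Lam (K j.+2))
      + x0 ord0 i * x0 ord0 i * (gauss_moment j * Lam (K j)).
    have := gam_adj i (pi i) (@hom_coord _ _ i) (pK j.+2) (hK j.+2); rewrite add1n /= => ->.
    congr (_ + _).
      rewrite [RHS]mulrCA -[X in _ = _ * X]LamZ //; congr (_ * Lam _).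
      by apply/funext => y; rewrite !T_coord.
    rewrite (_ : (fun x => _) = fun x => x0 ord0 i * (x ord0 i * K j.+1 x)); last first.
      by apply/funext => y; rewrite TK; ring.
    rewrite LamZ; last exact: polyfM.
    have := gam_T i (pK j.+1) (hK j.+1); rewrite /= => E1.
    rewrite mulrCA -E1 (_ : T (e i) _ = fun y => x0 ord0 i * K j y); last by apply/funext => y; rewrite TK.
    by rewrite LamZ //; ring.
  by rewrite (eq_bigr _ (fun i _ => E1 i)) big_split /= -!mulr_suml sum_T_coord.
have oj2 : ~~ odd j.+2 by rewrite /= negbK.
move: E; rewrite IH Lam_sq // (gamSS oj2) => E.
have {}E : j.+2%:R * (gauss_moment j.+2 * Lam (K j.+2)) = dotp x0 x0 * (h ^+ n / n`!%:R).
  by apply: (addrI (N2 * (gauss_moment j.+2 * Lam (K j.+2)))); rewrite -E; ring.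
have j2 : (j.+2%:R : R) != 0 by rewrite pnatr_eq0.
apply: (mulfI j2); rewrite E.
have -> : (j.+2 = n.+1 * 2)%N by rewrite muln2.
rewrite natrM exprS factS natrM /h; field.
by rewrite !pnatr_eq0 -lt0n fact_gt0 /= addrC natr1 pnatr_eq0.
Qed.

(* The terms of exp(Dk / 2) q at x0. *)
Definition heat_coef n q : R := dunkl_lapn n q x0 / (2 ^+ n * n`!%:R).

Lemma hom_euler_rep d q : polyf q -> hom d.+1 q ->
  q = fun y => \sum_i y ord0 i * (d.+1%:R^-1 * dd (e i) q y).
Proof.
move=> pq hq; apply/funext => y; under eq_bigr do rewrite mulrCA.
by rewrite -mulr_sumr (euler_sum y pq hq) mulKf // pnatr_eq0.
Qed.

Lemma bn_Z n c q : polyf q -> heat_coef n (fun y => c * q y) = c * heat_coef n q.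
Proof. by move=> pq; rewrite /heat_coef Dkn_Z // mulrA. Qed.

Lemma bn_deg n d q : polyf q -> hom d q -> (d < n.*2)%N -> heat_coef n q = 0.
Proof. by move=> pq hq dn; rewrite /heat_coef (Dkn_deg _ pq hq) ?mul0r. Qed.

Lemma bn_coordM n i q : polyf q -> heat_coef n (fun y => y ord0 i * q y) =
  x0 ord0 i * heat_coef n q + (if n is n'.+1 then heat_coef n' (T (e i) q) else 0).
Proof.
move=> pq; rewrite /heat_coef Dkn_coordM // mulrDl mulrA; congr (_ + _).
case: n => [|n] /=; first by rewrite mulr0 !mul0r.
rewrite Dkn_T // factS exprS natrM; field.
by rewrite !pnatr_eq0 -lt0n fact_gt0 /= addrC natr1 pnatr_eq0 expf_neq0 ?pnatr_eq0.
Qed.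

(** Pairing q with the Dunkl kernel gives exp(|x0|^2 / 2) times exp(Delta_k / 2) q at x0; this is
    its part of degree j in the kernel. As [heat_coef n q] has degree d - 2n in x0, the exponential
    supplies degree j + 2n - d. Euler's identity writes q as a sum of y_i g_i, and multiplication by
    y_i acts on both sides as x0_i plus T_i. *)
Lemma cc_formula d q j M : polyf q -> hom d q -> (d < M)%N ->
  cc d q j = \sum_(n < M) ec (j + n.*2) d * heat_coef n q.
Proof.
elim/ltn_ind: d q j M => -[|d] IH q j M pq hq dM.
  case: M dM => // M _; rewrite big_ord_recl big1 => [|n _]; last first.
    by rewrite (bn_deg (d := 0)) ?mulr0.
  rewrite /cc add0n addn0 addr0 /heat_coef expr0 fact0 mulr1 divr1 /= (hom0_cst hq).
  by rewrite LamZ // mulrCA cc_K mulrC.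
pose g i y := d.+1%:R^-1 * dd (e i) q y.
have pg i : polyf (g i) by apply: polyfZ; exact: polyf_dd.
have hg i : hom d (g i) by apply: homZ; exact: hom_dd.
have pyg i : polyf (fun y => y ord0 i * g i y) by apply: polyfM => //; exact: polyf_coord.
rewrite (hom_euler_rep pq hq) -/(g _).
have Ebn n : heat_coef n (fun y => \sum_i y ord0 i * g i y) = \sum_i heat_coef n (fun y => y ord0 i * g i y).
  by rewrite /heat_coef Dkn_sum // mulr_suml.
transitivity (\sum_i cc d.+1 (fun y => y ord0 i * g i y) j).
  rewrite /cc -mulr_sumr -Lam_sum; last by move=> i; exact: polyfM.
  by congr (_ * Lam _); apply/funext => y; rewrite mulr_suml.
under [RHS]eq_bigr do rewrite Ebn mulr_sumr.
rewrite [RHS]exchange_big /=; apply: eq_bigr => i _.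
under [RHS]eq_bigr do rewrite bn_coordM // mulrDr.
rewrite big_split /=.
have S1 : \sum_(n < M) ec (j + n.*2) d.+1 * (x0 ord0 i * heat_coef n (g i)) =
    if j is j'.+1 then x0 ord0 i * cc d (g i) j' else 0.
  case: j => [|j].
    rewrite big1 // => n _; have [dn|dn] := ltnP d n.*2; first by rewrite (bn_deg _ (hg i)) ?mulr0.
    by rewrite /ec add0n ltnNge dn mul0r.
  rewrite (IH d _ (g i) j M) //; last exact: ltnW.
  by rewrite mulr_sumr; apply: eq_bigr => n _; rewrite addSn ecSS mulrCA.
(* T_i g_i has degree two less than q, hence the strong induction; the shift of n by one is absorbed
   by applying [ecSS] twice. *)
have S2 : \sum_(n < M) ec (j + n.*2) d.+1 * (if (n : nat) is n'.+1 then heat_coef n' (T (e i) (g i)) else 0)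
    = gauss_moment (d + j).-1 * Lam (fun y => T (e i) (g i) y * K j y).
  clear S1; case: M dM => // M dM; rewrite big_ord_recl mulr0 add0r.
  case: d => [|d] in IH q pq hq g pg hg pyg Ebn dM *.
    have Tg0 : T (e i) (g i) = fun=> 0 by apply/funext => y; exact: (hom0_T k Hrs Hps).
    rewrite Tg0 (_ : (fun y => 0 * _) = fun=> 0) ?Lam0 ?mulr0.
      by rewrite big1 // => n _; rewrite /= /bump /= /heat_coef Dkn_0 mul0r mulr0.
    by apply/funext => y; rewrite mul0r.
  have hT : hom d (T (e i) (g i)) by exact: (hom_T k Hrs Hps).
  rewrite -[RHS]/(cc d (T (e i) (g i)) j) (IH d _ _ j M) //; last first.
  - exact: ltnW.
  - exact: pT.
  by apply: eq_bigr => n _; rewrite lift0 doubleS !addnS !ecSS.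
rewrite S1 S2; case: j {S1 S2} => [|j].
  by rewrite add0r cc_rec0 // addn0.
by rewrite cc_rec // addnS addrC.
Qed.

End GaussianPairing.

(** * Power series and Pochhammer sums *)

Section EulerResolvent.
Context {R : realType}.
Implicit Types (p g h : {poly R}).

Lemma continuous_poly p : continuous (fun x : R => p.[x]).
Proof.
move=> x; apply: differentiable_continuous; apply/derivable1_diffP.
exact: derivable_horner.
Qed.

(* At a negative minimum m > 0 of g on [0, s] the inequality would force g'(m) > 0. *)
Lemma first_order_ge0 (c : R) (rho : R -> R) g : 0 < c ->
  (forall u, 0 < u -> 0 < rho u) -> 0 <= g.[0] ->
  (forall u : R, 0 <= u -> 0 <= c * g.[u] + rho u * g^`().[u]) ->
  forall s : R, 0 <= s -> 0 <= g.[s].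
Proof.
move=> c0 r0 g0 Hg s s0; rewrite leNgt; apply/negP => gs.
have cg : {within `[0, s], continuous (fun x : R => g.[x])}.
  by apply: continuous_subspaceT => x; exact: continuous_poly.
have [m m0s mmin] := EVT_min s0 cg.
have gm : g.[m] < 0 by apply: le_lt_trans gs; apply: mmin; rewrite in_itv /= s0 lexx.
have /andP[m0 ms] : 0 <= m <= s by move: m0s; rewrite in_itv.
have m_gt0 : 0 < m.
  rewrite lt_neqAle m0 andbT; apply/eqP => m00.
  by move: gm; rewrite -m00 ltNge g0.
have dm : 0 < g^`().[m].
  have cgm : c * g.[m] < 0 by rewrite pmulr_rlt0.
  have : 0 < rho m * g^`().[m] by have := Hg m m0; lra.
  by rewrite pmulr_rgt0 // r0.
have [h Eh] : exists h, g - g.[m]%:P = h * ('X - m%:P).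
  by apply/factor_theorem; rewrite /root !hornerE subrr.
have hm : h.[m] = g^`().[m].
  have := congr1 (fun q : {poly R} => q^`().[m]) Eh.
  by rewrite derivB derivC derivM derivXsubC !hornerE subrr !mulr0 ?subr0 ?add0r => <-.
have [d /= d0 Hd] : exists2 d : R, 0 < d & forall u, `|m - u| < d -> 0 < h.[u].
  have /cvgrPdist_lt/(_ (h.[m])) := @continuous_poly h m.
  rewrite hm => /(_ dm) /nbhs_ballP [d /= d0 Hd]; exists d => // u mu.
  have /= := Hd u; rewrite -ball_normE /= => /(_ mu).
  by rewrite ltr_norml => /andP[_]; rewrite ltrBlDr -ltrBlDl subrr.
(* A point to the left of m, still inside [0, s] and within the radius where h is positive, so that
   g(u) < g(m). *)
pose u := m - Num.min (d / 2) (m / 2).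
have w0 : 0 < Num.min (d / 2) (m / 2) by rewrite lt_min !divr_gt0.
have wm : Num.min (d / 2) (m / 2) <= m / 2 by rewrite ge_min lexx orbT.
have wd : Num.min (d / 2) (m / 2) <= d / 2 by rewrite ge_min lexx.
have hu : 0 < h.[u].
  by apply: Hd; rewrite /u opprB addrC subrK gtr0_norm //; lra.
have um : g.[m] <= g.[u] by apply: mmin; rewrite in_itv /= /u; apply/andP; split; lra.
have := congr1 (fun q : {poly R} => q.[u]) Eh; rewrite !hornerE => Eu.
have : h.[u] * (u - m) < 0 by rewrite pmulr_rlt0 // /u; lra.
by rewrite -Eu; lra.
Qed.

(** Multiplying degree e by c / (c + e) is a resolvent of the Euler operator: the result g solves c
    g + s g' = c p, so g(s) is a weighted average of the values p(u s) with 0 < u < 1. Nonnegativity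
    is read off from the differential equation instead of that integral. *)
Lemma resolvent_pos (I : finType) (c : R) (e : I -> nat) (a : I -> R) : 0 < c ->
  (forall s : R, 0 <= s -> 0 <= \sum_i a i * s ^+ e i) ->
  forall s : R, 0 <= s -> 0 <= \sum_i c / (c + (e i)%:R) * a i * s ^+ e i.
Proof.
move=> c0 Ha s s0.
pose p := \sum_i a i *: 'X^(e i) : {poly R}.
pose g := \sum_i (c / (c + (e i)%:R) * a i) *: 'X^(e i) : {poly R}.
have -> : \sum_i c / (c + (e i)%:R) * a i * s ^+ e i = g.[s].
  by rewrite horner_sum; apply: eq_bigr => i _; rewrite !hornerE.
have pE u : p.[u] = \sum_i a i * u ^+ e i.
  by rewrite horner_sum; apply: eq_bigr => i _; rewrite !hornerE.
have E : c *: g + 'X * g^`() = c *: p.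
rewrite /g /p (raddf_sum (@deriv R)) mulr_sumr !scaler_sumr -big_split; apply: eq_bigr => i _ /=.
rewrite derivZ derivXn -scalerAr.
have -> : 'X * ('X^((e i).-1) *+ e i) = (e i)%:R *: 'X^(e i) :> {poly R}.
  rewrite mulrnAr; case: (e i) => [|n]; first by rewrite mulr0n scale0r.
  by rewrite -exprS scaler_nat.
rewrite !scalerA -scalerDl; congr (_ *: _); field.
by rewrite gt_eqF // ltr_wpDr.
have Ev u : c * g.[u] + u * g^`().[u] = c * p.[u].
  by rewrite -[RHS]hornerZ -E !hornerE.
apply: (@first_order_ge0 c id) => // [|u u0]; last by rewrite Ev mulr_ge0 ?pE ?Ha // ltW.
have := Ev 0; rewrite mul0r addr0 => /(mulfI (lt0r_neq0 c0)) ->.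
by rewrite pE Ha.
Qed.

(** The exponential series cut after n terms; thus [exp_trunc n.*2.+1] has even degree 2n. *)
Definition exp_trunc n : {poly R} := \poly_(j < n) (j`!%:R)^-1.

(* With P(v) = exp_trunc(-v) one has P + P' = v^(2n) / (2n)!. *)
Lemma exp_trunc_ge0 n (u : R) : 0 <= (exp_trunc n.*2.+1).[u].
Proof.
have E m v : (exp_trunc m).[v] = \sum_(j < m) v ^+ j / j`!%:R.
  by rewrite horner_poly; apply: eq_bigr => j _; rewrite mulrC.
have [u0|u0] := leP 0 u.
  by rewrite E; apply: sumr_ge0 => j _; rewrite divr_ge0 ?exprn_ge0.
pose P := exp_trunc n.*2.+1 \Po (- 'X).
have PE v : P.[v] = (exp_trunc n.*2.+1).[- v] by rewrite horner_comp !hornerE.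
have dE m : (exp_trunc m.+1)^`() = exp_trunc m.
  apply/polyP => j; rewrite coef_deriv !coef_poly ltnS; case: ifP => _; last by rewrite mul0rn.
  by rewrite factS natrM invfM -mulrnAl -[_ *+ _]mulr_natr mulVf ?mul1r // pnatr_eq0.
have dP v : P^`().[v] = - (exp_trunc n.*2).[- v].
  by rewrite deriv_comp dE derivN derivX hornerM horner_comp !hornerE mulrN1.
rewrite -[u]opprK -PE; apply: (@first_order_ge0 1 (fun=> 1)) => //.
- rewrite PE oppr0 E big_ord_recl big1 ?addr0 ?divr_ge0 ?exprn_ge0 // => j _.
  by rewrite exprS !mul0r.
- move=> v v0; rewrite !mul1r PE dP !E big_ord_recr /= [X in 0 <= X]addrAC subrr add0r.
  by rewrite -mul2n exprM sqrrN divr_ge0 // exprn_ge0 // sqr_ge0.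
- by rewrite oppr_ge0 ltW.
Qed.

End EulerResolvent.

(** * Weighted exponential series *)

Section PoissonSeries.
Context {R : realType}.
Variable h : R.
Implicit Types (phi psi : nat -> R) (u v : R).

Lemma cvgn_ge0 (u : nat -> R) (l : R) : u @ \oo --> l -> (forall n, 0 <= u n) -> 0 <= l.
Proof.
move=> ul u0; rewrite -(cvg_lim (@Rhausdorff R) ul); apply: limr_ge.
  by apply/cvg_ex; exists l.
by apply: nearW.
Qed.

Lemma cvgn_sum (I : Type) (r : seq I) (u : I -> nat -> R) (l : I -> R) :
  (forall i, u i @ \oo --> l i) -> (fun n => \sum_(i <- r) u i n) @ \oo --> \sum_(i <- r) l i.
Proof.
move=> ul; elim: r => [|i r IH].
  rewrite big_nil (_ : (fun n => _) = fun=> 0); first exact: cvg_cst.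
  by apply/funext => n; rewrite big_nil.
rewrite big_cons (_ : (fun n => _) = fun n => u i n + \sum_(j <- r) u j n).
  exact: (cvgD (ul i) IH).
by apply/funext => n; rewrite big_cons.
Qed.

Definition pser phi v := (fun n => \sum_(i < n) h ^+ i / i`!%:R * phi i) @ \oo --> v.

Lemma pser_uniq phi u v : pser phi u -> pser phi v -> u = v.
Proof. by move=> pu pv; rewrite -(cvg_lim (@Rhausdorff R) pu) -(cvg_lim (@Rhausdorff R) pv). Qed.

Lemma eq_pser phi psi v : phi =1 psi -> pser phi v -> pser psi v.
Proof. by move=> /funext ->. Qed.

Lemma pserD phi psi u v : pser phi u -> pser psi v -> pser (fun i => phi i + psi i) (u + v).
Proof.
move=> pu pv; rewrite /pser.
rewrite (_ : (fun n => _) = fun n => \sum_(i < n) h ^+ i / i`!%:R * phi i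
   + \sum_(i < n) h ^+ i / i`!%:R * psi i); first exact: (cvgD pu pv).
by apply/funext => n; rewrite -big_split; apply: eq_bigr => i _; rewrite mulrDr.
Qed.

Lemma pserZ c phi u : pser phi u -> pser (fun i => c * phi i) (c * u).
Proof.
move=> pu; rewrite /pser.
rewrite (_ : (fun n => _) = fun n => c * \sum_(i < n) h ^+ i / i`!%:R * phi i).
  exact: (cvgMr _ pu) || exact: (cvgM (cvg_cst c) pu).
by apply/funext => n; rewrite mulr_sumr; apply: eq_bigr => i _; ring.
Qed.

Lemma pser0 : pser (fun=> 0) 0.
Proof.
rewrite /pser (_ : (fun n => _) = fun=> 0); first exact: cvg_cst.
by apply/funext => n; rewrite big1 // => i _; rewrite mulr0.
Qed.

Lemma pser_sum (I : Type) (r : seq I) (phi : I -> nat -> R) (v : I -> R) :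
  (forall i, pser (phi i) (v i)) ->
  pser (fun n => \sum_(i <- r) phi i n) (\sum_(i <- r) v i).
Proof.
move=> pv; elim: r => [|i r IH].
  by rewrite big_nil; apply: eq_pser pser0 => n; rewrite big_nil.
by rewrite big_cons; apply: eq_pser (pserD (pv i) IH) => n; rewrite big_cons.
Qed.

Lemma pser1 : pser (fun=> 1) (expR h).
Proof.
rewrite /pser (_ : (fun n => _) = series (exp_coeff h)); first exact: is_cvg_series_exp_coeff.
by apply/funext => n; rewrite /series /= big_mkord; apply: eq_bigr => i _; rewrite mulr1.
Qed.

Lemma pser_shift1 phi v : pser phi v -> pser (fun i => i%:R * phi i.-1) (h * v).
Proof.
move=> pv; rewrite /pser -(cvg_shiftS (fun n => \sum_(i < n) _)) /=.
rewrite (_ : (fun n => _) = fun n => h * \sum_(i < n) h ^+ i / i`!%:R * phi i).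
  exact: (cvgM (cvg_cst h) pv).
apply/funext => n; rewrite big_ord_recl mul0r mulr0 add0r mulr_sumr.
apply: eq_bigr => i _; rewrite lift0 /= exprS factS natrM; field.
by rewrite !pnatr_eq0 -lt0n fact_gt0 /= addrC natr1 pnatr_eq0.
Qed.

Lemma pser_shift a phi v : pser phi v ->
  pser (fun i => (i ^_ a)%:R * phi (i - a)%N) (h ^+ a * v).
Proof.
elim: a => [|a IH] pv; first by rewrite mul1r; apply: eq_pser pv => i; rewrite mul1r subn0.
rewrite exprS -mulrA; apply: eq_pser (pser_shift1 (IH pv)) => i.
by rewrite ffactnS natrM mulrA; congr (_ * phi _); case: i.
Qed.

(** All shifts are required because multiplication of the coefficients by i trades phi for its
    shift. *)
Definition pcls phi := forall s, exists v, pser (fun i => phi (i + s)%N) v.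

Lemma pcls1 : pcls (fun=> 1).
Proof. by move=> s; exists (expR h); exact: pser1. Qed.

Lemma eq_pcls phi psi : phi =1 psi -> pcls phi -> pcls psi.
Proof. by move=> /funext ->. Qed.

Lemma pcls_affine a b phi : pcls phi -> pcls (fun i => (a + b * i%:R) * phi i).
Proof.
move=> pc s; have [u pu] := pc s; have [v pv] := pc s.+1.
exists ((a + b * s%:R) * u + b * (h * v)).
have H := pserD (pserZ (c := a + b * s%:R) pu) (pserZ (c := b) (pser_shift1 pv)).
apply: eq_pser H => i /=.
case: i => [|i] /=; first by rewrite mul0r mulr0 addr0.
by rewrite natrD addnS -addSn; ring.
Qed.

(* [rise c y] is 2^c times the Pochhammer symbol (y / 2)_c. *)
Definition rise c (y : R) := \prod_(r < c) (y + 2 * r%:R).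

Lemma rise0 y : rise 0 y = 1. Proof. by rewrite /rise big_ord0. Qed.

Lemma riseSr c y : rise c.+1 y = rise c y * (y + 2 * c%:R).
Proof. by rewrite /rise big_ord_recr. Qed.

Lemma riseSl c y : rise c.+1 y = y * rise c (y + 2).
Proof.
rewrite /rise big_ord_recl mulr0 addr0; congr (_ * _); apply: eq_bigr => i _.
by rewrite lift0 -natr1; ring.
Qed.

(** Both products are built from factors affine in i, and [pcls_affine] allows one more such factor
    at a time. *)
Lemma pcls_term D l c y :
  pcls (fun i => ((D + i.*2) ^_ l)%:R * rise c (y + 2 * i%:R)).
Proof.
have H1 : pcls (fun i => rise c (y + 2 * i%:R)).
  elim: c => [|c IH]; first by apply: eq_pcls pcls1 => i; rewrite rise0.
  apply: eq_pcls (pcls_affine (y + 2 * c%:R) 2 IH) => i.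
  by rewrite riseSr; ring.
elim: l => [|l IH]; first by apply: eq_pcls H1 => i; rewrite ffactn0 mul1r.
apply: eq_pcls (pcls_affine (D%:R - l%:R) 2 IH) => i.
rewrite ffactnSr natrM.
have [Dl|Dl] := ltnP (D + i.*2) l; first by rewrite ffact_small // !mul0r mulr0.
by rewrite natrB // natrD -mul2n natrM; ring.
Qed.

End PoissonSeries.

(** * Chu-Vandermonde identities with step 2 *)

Section Vandermonde.
Context {R : realType}.
Implicit Types (A Y : R).

Lemma rise_shift m (Y : R) : rise m (Y - 2) + 2 * m%:R * rise m.-1 Y = rise m Y.
Proof.
case: m => [|m]; first by rewrite !rise0 mulr0 mul0r addr0.
by rewrite /= riseSl subrK riseSr -natr1; ring.
Qed.

Lemma ffact_rec1 n l : ((n.+1 ^_ l)%:R = (n ^_ l)%:R + l%:R * (n ^_ l.-1)%:R :> R).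
Proof.
case: l => [|l]; first by rewrite !ffactn0 mul0r addr0.
rewrite ffactSS ffactnSr !natrM /=.
have [nl|nl] := ltnP n l; first by rewrite ffact_small // !mulr0 mul0r addr0.
by rewrite natrB // -!natr1; ring.
Qed.

Lemma sum_bin_absorb M (G : nat -> R) :
  \sum_(l < M.+1) 'C(M, l)%:R * (l%:R * G l) =
  M%:R * \sum_(l < M) 'C(M.-1, l)%:R * G l.+1.
Proof.
rewrite big_ord_recl mul0r mulr0 add0r mulr_sumr; apply: eq_bigr => l _.
rewrite lift0; case: M l => [[]|M l] //=.
have E := congr1 (fun n => n%:R : R) (mul_bin_diag M.+1 l); rewrite !natrM /= in E.
by rewrite mulrCA mulrA -E; ring.
Qed.

(** Chu-Vandermonde, by induction on B: one unit of B is split off the falling factorial and the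
    resulting factor l is absorbed in the binomial coefficient. Together with [vandermonde2] it
    collapses the double sum coming from the expansion of the kernel. *)
Lemma vandermonde1 M A B :
  \sum_(l < M.+1) 'C(M, l)%:R * ((- 2) ^+ l * ((B ^_ l)%:R * rise (M - l) A)) =
  rise M (A - 2 * B%:R).
Proof.
elim: B A M => [|B IH] A M.
  rewrite big_ord_recl big1 => [|l _]; last by rewrite lift0 ffact0n mul0r !mulr0.
  by rewrite bin0 ffactn0 expr0 !mul1r subn0 mulr0 subr0 addr0.
under eq_bigr do rewrite ffact_rec1 mulrDl mulrDr mulrDr.
rewrite big_split /= IH.
rewrite (eq_bigr (fun l : 'I_M.+1 => 'C(M, l)%:R * (l%:R * ((- 2) ^+ l * ((B ^_ l.-1)%:R * rise (M - l) A)))));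
  last by move=> l _; ring.
rewrite (sum_bin_absorb M (fun l => (- 2) ^+ l * ((B ^_ l.-1)%:R * rise (M - l) A))).
have -> : M%:R * \sum_(l < M) 'C(M.-1, l)%:R * ((- 2) ^+ l.+1 * ((B ^_ l)%:R * rise (M - l.+1) A))
    = - (2 * M%:R * rise M.-1 (A - 2 * B%:R)) :> R.
  case: M => [|M]; first by rewrite mulr0 !mul0r oppr0.
  rewrite -(IH A M) /= !mulr_sumr -sumrN; apply: eq_bigr => l _.
  by rewrite subSS exprS; ring.
rewrite -(rise_shift M (A - 2 * B%:R)).
have -> : A - 2 * B.+1%:R = A - 2 * B%:R - 2 by rewrite -[B.+1%:R]natr1; ring.
by rewrite addrK.
Qed.

Lemma vandermonde2 M i Y :
  \sum_(a < M.+1) 'C(M, a)%:R * (2 ^+ a * ((i ^_ a)%:R * rise (M - a) (Y - 2 * i%:R + 2 * a%:R)))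
  = rise M Y.
Proof.
elim: i Y M => [|i IH] Y M.
  rewrite big_ord_recl big1 => [|l _]; last by rewrite lift0 ffact0n mul0r !mulr0.
  by rewrite bin0 ffactn0 expr0 !mul1r subn0 addr0 /= mulr0 subr0 addr0.
under eq_bigr do rewrite ffact_rec1 mulrDl mulrDr mulrDr.
rewrite big_split /=.
rewrite (eq_bigr (fun a : 'I_M.+1 => 'C(M, a)%:R * (2 ^+ a * ((i ^_ a)%:R *
  rise (M - a) (Y - 2 - 2 * i%:R + 2 * a%:R))))); last first.
  by move=> a _; rewrite (_ : Y - 2 * i.+1%:R = Y - 2 - 2 * i%:R) // -[i.+1%:R]natr1; ring.
rewrite IH.
rewrite (eq_bigr (fun a : 'I_M.+1 => 'C(M, a)%:R * (a%:R * (2 ^+ a * ((i ^_ a.-1)%:R *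
  rise (M - a) (Y - 2 * i.+1%:R + 2 * a%:R)))))); last by move=> a _; ring.
rewrite (sum_bin_absorb M (fun a => 2 ^+ a * ((i ^_ a.-1)%:R *
  rise (M - a) (Y - 2 * i.+1%:R + 2 * a%:R)))).
rewrite -[RHS](rise_shift M Y); congr (_ + _).
case: M => [|M]; first by rewrite mulr0 !mul0r.
rewrite -(IH Y M) /= !mulr_sumr; apply: eq_bigr => l _.
rewrite subSS exprS (_ : Y - 2 * i.+1%:R + 2 * l.+1%:R = Y - 2 * i%:R + 2 * l%:R); first by ring.
by rewrite -!natr1; ring.
Qed.

End Vandermonde.

(** The surplus binomial coefficients vanish; the range up to m makes nested expansions run over
    independent index sets. *)
Lemma exprDn_widen (R : realType) (x y : R) M m : (M <= m)%N ->
  (x + y) ^+ M = \sum_(l < m.+1) 'C(M, l)%:R * y ^+ l * x ^+ (M - l).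
Proof.
move=> Mm; rewrite exprDn (big_ord_widen m.+1 (fun l => x ^+ (M - l) * y ^+ l *+ 'C(M, l))) ?ltnS //.
rewrite big_mkcond; apply: eq_bigr => l _; case: ifP => [_|/negbT]; first by rewrite -mulr_natl; ring.
by rewrite ltnS -ltnNge => /bin_small ->; rewrite !mul0r.
Qed.

(** * Positivity of the heat moments *)

Section KernelPositivity.
Context {R : realType} {N : nat}.
Local Notation vec := 'rV[R]_N.
Variables (Rs Rp : seq vec) (k : vec -> R).
Hypotheses (N0 : (0 < N)%N)
  (Hrs : reduced_root_system Rs) (Hps : positive_subsystem Rs Rp)
  (Hk : multiplicity Rs k).
Implicit Types (x y a b xi v : vec) (f g q : vec -> R).
Local Notation T := (dunklT Rp k).
Local Notation N2 := (dunkl_dim Rp k).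
Local Notation gam := (gauss_moment Rp k).

Hypothesis Tcomm : forall xi eta f x, polyf f -> T xi (T eta f) x = T eta (T xi f) x.

Variable Lam : (vec -> R) -> R.
Hypothesis HL : dunkl_mean Rp k Lam.
Local Notation LamZ := (meanZ HL).
Local Notation Lam_odd := (mean_odd HL).
Local Notation Lam_pos := (mean_ge0 HL).

Lemma N2_gt0 : 0 < N2.
Proof.
rewrite /dunkl_dim ltr_wpDr ?ltr0n // mulr_ge0 // /gam_sum big_seq.
by apply: sumr_ge0 => a aP; exact: (mult_ge0 Hps Hk aP).
Qed.

Lemma N2_gt0n n : 0 < N2 + 2 * n%:R.
Proof. by rewrite ltr_wpDr ?N2_gt0 // mulr_ge0. Qed.

Lemma rise_gt0 n m : 0 < rise n (N2 + 2 * m%:R).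
Proof. by apply: prodr_gt0 => r _; rewrite -addrA -mulrDr -natrD N2_gt0n. Qed.

(** On the ray through y a sum of homogeneous terms is a polynomial in s, to which one resolvent
    after another is applied. *)
Lemma resolvent_family (I : finType) (d : I -> nat) (F : I -> vec -> R) M :
  (forall i, hom (d i) (F i)) ->
  (forall y, 0 <= \sum_i F i y) ->
  forall y, 0 <= \sum_i (\prod_(l < M) ((N2 + 2 * l%:R) / (N2 + 2 * l%:R + (d i)%:R))) * F i y.
Proof.
move=> hF F0; elim: M => [|M IH] y.
  by under eq_bigr do rewrite big_ord0 mul1r; exact: F0.
have := @resolvent_pos R I (N2 + 2 * M%:R) d
  (fun i => (\prod_(l < M) ((N2 + 2 * l%:R) / (N2 + 2 * l%:R + (d i)%:R))) * F i y) (N2_gt0n M).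
move=> /(_ _ 1 ler01); rewrite (eq_bigr (fun i => (\prod_(l < M.+1)
   ((N2 + 2 * l%:R) / (N2 + 2 * l%:R + (d i)%:R))) * F i y)) => [|i _]; last first.
  by rewrite expr1n mulr1 big_ord_recr /=; ring.
apply=> s s0; have := IH (s *: y); congr (_ <= _); apply: eq_bigr => i _.
by rewrite hF; ring.
Qed.

(** Exchanges the roles of M and n: M factors become n factors, each of which has a visible limit as
    M grows. *)
Lemma prod_telescope n M :
  \prod_(l < M) ((N2 + 2 * l%:R) / (N2 + 2 * l%:R + n.*2%:R)) =
  \prod_(i < n) ((N2 + 2 * i%:R) / (N2 + 2 * M%:R + 2 * i%:R)).
Proof.
have nz m : N2 + 2 * m%:R != 0 by rewrite gt_eqF ?N2_gt0n.
have nz2 m m' : N2 + 2 * m%:R + 2 * m'%:R != 0.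
  by rewrite -addrA -mulrDr -natrD.
elim: n => [|n IH].
  by rewrite big_ord0 big1 // => l _; rewrite addr0 divff.
rewrite big_ord_recr /= -IH.
have -> : (N2 + 2 * n%:R) / (N2 + 2 * M%:R + 2 * n%:R) =
    \prod_(l < M) ((N2 + 2 * l%:R + n.*2%:R) / (N2 + 2 * l%:R + n.+1.*2%:R)).
  elim: M {IH} => [|M IH]; first by rewrite big_ord0 mulr0 addr0 divff.
  rewrite big_ord_recr /= -IH -muln2 -muln2 !natrM; field.
  have := nz2 M n; have := nz2 M n.+1; rewrite -natr1 => H1 H2.
  by rewrite -!natr1; apply/andP; split; [move: H1 | move: H2]; congr (_ != _); ring.
rewrite -big_split; apply: eq_bigr => l _ /=; field.
rewrite -!muln2 !natrM; have := nz2 l n; have := nz2 l n.+1 => H1 H2.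
by apply/andP; split; [move: H1 | move: H2]; congr (_ != _); ring.
Qed.

Lemma cvg_ratio (y : R) : (forall M : nat, y + 2 * M%:R != 0) ->
  (fun M : nat => 2 * M.+1%:R / (y + 2 * M.+1%:R)) @ \oo --> (1 : R).
Proof.
move=> y0.
have H : (fun M : nat => (1 + y / 2 * harmonic M)^-1) @ \oo --> ((1 + y / 2 * 0)^-1 : R).
  apply: cvgV; first by rewrite mulr0 addr0 oner_neq0.
  by apply: cvgD; [exact: cvg_cst | apply: cvgM; [exact: cvg_cst | exact: cvg_harmonic]].
rewrite mulr0 addr0 invr1 in H; apply: cvg_trans H; apply: near_eq_cvg; apply: nearW => M /=.
have m0 : (M.+1%:R : R) != 0 by rewrite pnatr_eq0.
have := y0 M.+1; move: (M.+1%:R : R) m0 => c c0 yc.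
by field; rewrite c0 yc.
Qed.

Lemma cvgn_prod (n : nat) (u : nat -> nat -> R) (l : nat -> R) :
  (forall i, u i @ \oo --> l i) ->
  (fun M => \prod_(i < n) u i M) @ \oo --> \prod_(i < n) l i.
Proof.
move=> ul; elim: n => [|n IH].
  rewrite big_ord0 (_ : (fun M => _) = fun=> 1); first exact: cvg_cst.
  by apply/funext => M; rewrite big_ord0.
rewrite big_ord_recr (_ : (fun M => _) = fun M => (\prod_(i < n) u i M) * u n M).
  exact: (cvgM IH (ul n)).
by apply/funext => M; rewrite big_ord_recr.
Qed.

Lemma gam_double n : gam n.*2 = \prod_(i < n) (N2 + 2 * i%:R).
Proof. by rewrite /gauss_moment doubleK. Qed.

(** Nonnegativity of the Gaussian mean. The resolvents with constants N2, N2 + 2, ..., N2 + 2M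
    followed by the dilation by sqrt(2 (M + 1)) multiply an even degree d by a factor tending to
    [gauss_moment d]; odd degrees have mean zero. This is the Gaussian as the limit of the densities
    (1 - r^2 / (2 M))^M, with integrals replaced by multipliers. *)
Lemma gam_pos_family (I : finType) (d : I -> nat) (F : I -> vec -> R) :
  (forall i, polyf (F i)) -> (forall i, hom (d i) (F i)) ->
  (forall y, 0 <= \sum_i F i y) -> 0 <= \sum_i gam (d i) * Lam (F i).
Proof.
move=> pF hF F0.
pose s M : R := Num.sqrt (2 * M.+1%:R).
pose w M i := (\prod_(l < M.+1) ((N2 + 2 * l%:R) / (N2 + 2 * l%:R + (d i)%:R))) * s M ^+ d i.
pose u M := \sum_i w M i * Lam (F i).
apply: (@cvgn_ge0 _ u).
  apply: cvgn_sum => i; case oi : (odd (d i)).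
    rewrite (Lam_odd (pF i) (hF i) oi) mulr0 (_ : (fun M => _) = fun=> 0); first exact: cvg_cst.
    by apply/funext => M; rewrite mulr0.
  apply: cvgM; last exact: cvg_cst.
  have dE : d i = (d i)./2.*2 by rewrite -[LHS]odd_double_half oi.
  rewrite /w dE; move: ((d i)./2) => n {oi dE}; rewrite gam_double.
  rewrite (_ : (fun M => _) = fun M => \prod_(i0 < n) ((N2 + 2 * i0%:R) *
     (2 * M.+1%:R / (N2 + 2 * i0%:R + 2 * M.+1%:R)))).
    have -> : \prod_(i0 < n) (N2 + 2 * i0%:R) = \prod_(i0 < n) ((N2 + 2 * i0%:R) * 1).
      by apply: eq_bigr => j _; rewrite mulr1.
    apply: (@cvgn_prod n (fun j M => (N2 + 2 * j%:R) * (2 * M.+1%:R / (N2 + 2 * j%:R + 2 * M.+1%:R)))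
      (fun j => (N2 + 2 * j%:R) * 1)) => j.
    apply: cvgM; first exact: cvg_cst.
    by apply: cvg_ratio => M; rewrite -addrA -mulrDr -natrD gt_eqF ?N2_gt0n.
  apply/funext => M; rewrite prod_telescope -mul2n exprM sqr_sqrtr ?mulr_ge0 //.
  have -> : (2 * M.+1%:R) ^+ n = \prod_(i0 < n) (2 * M.+1%:R) :> R.
    by rewrite big_const cardE size_enum_ord; elim: n => //= n <-; rewrite exprS.
  rewrite -big_split; apply: eq_bigr => j _ /=; field.
  have := lt0r_neq0 (N2_gt0n (j + M.+1)); rewrite natrD => H.
  by move: H; congr (_ != _); ring.
move=> M.
have -> : u M = Lam (fun y => \sum_i w M i * F i y).
  rewrite (Lam_sum HL) => [|i]; last exact: polyfZ.
  by apply: eq_bigr => i _; rewrite LamZ.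
apply: Lam_pos; first by apply: polyf_sum => i _; exact: polyfZ.
move=> y; have := resolvent_family M.+1 hF F0 (s M *: y); congr (_ <= _).
by apply: eq_bigr => i _; rewrite hF mulrA.
Qed.

End KernelPositivity.

(** What the algebra uses of V_k. Positivity is tested on the ball |z| <= |y|, which contains the
    convex hull of the orbit of y. *)
Record intertwining (R : realType) (N : nat) (Rp : seq 'rV[R]_N) (k : 'rV[R]_N -> R)
    (V : ('rV[R]_N -> R) -> 'rV[R]_N -> R) : Prop := Intertwining {
  VD : forall f g x, polyf f -> polyf g -> V (fun z => f z + g z) x = V f x + V g x;
  VZ : forall c f x, polyf f -> V (fun z => c * f z) x = c * V f x;
  V1 : V (fun=> 1) = fun=> 1;
  polyf_V : forall f, polyf f -> polyf (V f);
  hom_V : forall m f, polyf f -> hom m f -> hom m (V f);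
  V_ge0 : forall f y, polyf f -> (forall z, dotp z z <= dotp y y -> 0 <= f z) -> 0 <= V f y;
  V_T : forall xi f x, polyf f -> dunklT Rp k xi (V f) x = V (dd xi f) x }.

(** * The Dunkl kernel and the limit of the truncated kernels *)

Section IntertwinerKernel.
Context {R : realType} {N : nat}.
Local Notation vec := 'rV[R]_N.
Variables (Rs Rp : seq vec) (k : vec -> R).
Hypotheses (N0 : (0 < N)%N)
  (Hrs : reduced_root_system Rs) (Hps : positive_subsystem Rs Rp)
  (Hk : multiplicity Rs k).
Implicit Types (x y a b xi v : vec) (f g q : vec -> R).
Local Notation e i := (delta_mx 0 i : vec).
Local Notation T := (dunklT Rp k).
Local Notation N2 := (dunkl_dim Rp k).

Hypothesis Tcomm : forall xi eta f x, polyf f -> T xi (T eta f) x = T eta (T xi f) x.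

Variable Lam : (vec -> R) -> R.
Hypothesis HL : dunkl_mean Rp k Lam.
Variable V : (vec -> R) -> vec -> R.
Hypothesis HV : intertwining Rp k V.

Lemma V_sum I (r : seq I) (F : I -> vec -> R) y : (forall i, polyf (F i)) ->
  V (fun x => \sum_(i <- r) F i x) y = \sum_(i <- r) V (F i) y.
Proof.
move=> pF; elim: r => [|i r IH].
  rewrite big_nil (_ : (fun x => _) = fun=> 0 * 1).
    by rewrite (VZ HV) ?mul0r //; exact: polyf_cst.
  by apply/funext => x; rewrite big_nil mul0r.
rewrite big_cons -IH -(VD HV) //; last exact: polyf_sum.
by congr (V _ y); apply/funext => x; rewrite big_cons.
Qed.

Section AtPoint.
Variable x0 : vec.
Local Notation h := (dotp x0 x0 / 2).

(** The part of degree j of the Dunkl kernel, which is V applied to z -> exp(<x0, z>). *)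
Definition Kj j y := V (fun z => dotp x0 z ^+ j) y / j`!%:R.

Lemma polyf_dotp_exp j : polyf (fun z => dotp x0 z ^+ j).
Proof. by apply: polyf_exp; exact: polyf_dotp. Qed.

Lemma polyf_Kj j : polyf (Kj j).
Proof.
apply: polyfM; last exact: polyf_cst.
by apply: (polyf_V HV); exact: polyf_dotp_exp.
Qed.

Lemma hom_dotp_exp j : hom j (fun z => dotp x0 z ^+ j).
Proof. by move=> s x; rewrite dotpZr exprMn. Qed.

Lemma hom_Kj j : hom j (Kj j).
Proof.
move=> s x; rewrite /Kj (hom_V HV (polyf_dotp_exp j) (hom_dotp_exp j)).
by rewrite mulrA.
Qed.

Lemma Kj0 : Kj 0 = fun=> 1.
Proof.
apply/funext => y; rewrite /Kj fact0 divr1 (_ : (fun z => _) = fun=> 1) ?(V1 HV) //.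
Qed.

Lemma dd_dotp_exp xi j z : dd xi (fun z => dotp x0 z ^+ j.+1) z =
  j.+1%:R * dotp x0 xi * dotp x0 z ^+ j.
Proof.
have dd1 : dd xi (dotp x0) z = dotp x0 xi.
  rewrite /dotp dd_sum => [|i _]; last by apply: polyfZ; exact: polyf_coord.
  by apply: eq_bigr => i _; rewrite ddZ ?dd_coord //; exact: polyf_coord.
elim: j => [|j IH]; first by rewrite /= mul1r mulr1.
rewrite (_ : (fun z => _) = fun z => dotp x0 z * dotp x0 z ^+ j.+1); last first.
  by apply/funext => y; rewrite exprS.
rewrite ddM; [|exact: polyf_dotp|exact: polyf_dotp_exp].
by rewrite IH dd1 -[j.+2%:R]natr1 exprS; ring.
Qed.

Lemma T_Kj i j y : T (e i) (Kj j.+1) y = x0 ord0 i * Kj j y.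
Proof.
rewrite (_ : Kj j.+1 = fun y => (j.+1)`!%:R^-1 * V (fun z => dotp x0 z ^+ j.+1) y); last first.
  by apply/funext => z; rewrite mulrC.
have pV := polyf_V HV (polyf_dotp_exp j.+1).
rewrite (T_Z k Hrs Hps) // (V_T HV); last exact: polyf_dotp_exp.
rewrite (_ : dd _ _ = fun z => (j.+1%:R * x0 ord0 i) * dotp x0 z ^+ j); last first.
  by apply/funext => z; rewrite dd_dotp_exp dotp_delta.
rewrite (VZ HV); last exact: polyf_dotp_exp.
rewrite /Kj factS natrM; field.
by rewrite !pnatr_eq0 -lt0n fact_gt0 /= addrC natr1 pnatr_eq0.
Qed.

Lemma sum_parity (G : nat -> R) D K :
  \sum_(J < K) (if (D <= J)%N && ~~ odd (J - D) then G J else 0) =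
  \sum_(i < uphalf (K - D)) G (D + i.*2)%N.
Proof.
elim: K => [|K IH]; first by rewrite big_ord0 sub0n big_ord0.
rewrite big_ord_recr /= IH; have [DK|KD] := leqP D K; last first.
  have E1 : (K - D = 0)%N by apply/eqP; rewrite subn_eq0 ltnW.
  have E2 : (K.+1 - D = 0)%N by apply/eqP; rewrite subn_eq0.
  by rewrite addr0 E1 E2.
rewrite subSn // /=; move: (subnKC DK); set t := (K - D)%N => Kt.
rewrite uphalf_half; case ot : (odd t) => /=; first by rewrite addr0 add1n.
have tE : t./2.*2 = t by rewrite -[RHS]odd_double_half ot.
by rewrite add0n big_ord_recr /= tE Kt.
Qed.

Lemma uphalf_cvg l D : (fun n => uphalf (n.*2.+1 + l - D)%N) @ \oo --> \oo.
Proof.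
apply/cvgnyPge => M; near=> n.
apply: (@leq_trans (uphalf (n.*2.+1 - D))); last first.
  by apply: uphalf_leq; rewrite leq_sub2r // leq_addr.
apply: (@leq_trans (uphalf (M.*2))); first by rewrite uphalf_double.
apply: uphalf_leq.
have Hn : (M + D <= n)%N by near: n; exact: nbhs_infty_ge.
lia.
Unshelve. all: by end_near. Qed.

(** With l + j = D + 2i the inner sum becomes a series of terms h^i / i! times phi(i). The power
    (2h)^a is absorbed by shifting i by a; then for each i the sums over l and a collapse, by the
    two Vandermonde identities, to a value independent of i, and the series is this value times
    exp(h). *)
Lemma lim_inner d n' m : (n'.*2 <= d)%N ->
  (fun n => \sum_(a < m.+1) \sum_(l < m.+1)
     'C(m, a)%:R * (2 * h) ^+ a * ('C(m - a, l)%:R * (- 2) ^+ l) *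
     \sum_(j < n.*2.+1) ((l + j)`!%:R / j`!%:R * rise (m - a - l) (N2 + (d + (l + j))%:R)
        * ec x0 (l + j + n'.*2) d)) @ \oo --> expR h * rise m (N2 + 2 * n'%:R).
Proof.
move=> nd; pose D := (d - n'.*2)%N.
have dE : (d = D + n'.*2)%N by rewrite subnK.
pose phi (a l i : nat) : R := ((D + i.*2) ^_ l)%:R * rise (m - a - l) (N2 + (d + D)%:R + 2 * i%:R).
have H (a l : nat) : {v : R | pser h (phi a l) v}.
  apply: cid; have [v Hv] := pcls_term h D l (m - a - l) (N2 + (d + D)%:R) 0.
  by exists v; apply: eq_pser Hv => i; rewrite addn0.
pose v (a l : nat) := sval (H a l); have Hv (a l : nat) : pser h (phi a l) (v a l) := svalP (H a l).
have -> : expR h * rise m (N2 + 2 * n'%:R) = \sum_(a < m.+1) \sum_(l < m.+1)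
     'C(m, a)%:R * (2 * h) ^+ a * ('C(m - a, l)%:R * (- 2) ^+ l) * v a l.
  (* [P1] sums the constant coefficients, [P2] the shifted double sum; [E] below identifies the
     coefficients, and uniqueness of the limit identifies the two values. *)
  have P1 := pserZ (c := rise m (N2 + 2 * n'%:R)) (@pser1 R h).
  have P2 : pser h (fun i => \sum_(a < m.+1) ('C(m, a)%:R * 2 ^+ a) * ((i ^_ a)%:R *
      \sum_(l < m.+1) ('C(m - a, l)%:R * (- 2) ^+ l) * phi a l (i - a)%N))
    (\sum_(a < m.+1) ('C(m, a)%:R * 2 ^+ a) * (h ^+ a * \sum_(l < m.+1)
       ('C(m - a, l)%:R * (- 2) ^+ l) * v a l)).
    apply: pser_sum => a; apply: pserZ.
    apply: (pser_shift (phi := fun i => \sum_(l < m.+1) ('C(m - a, l)%:R * (- 2) ^+ l) * phi a l i)).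
    by apply: pser_sum => l; apply: pserZ.
  have E : (fun i => \sum_(a < m.+1) ('C(m, a)%:R * 2 ^+ a) * ((i ^_ a)%:R *
      \sum_(l < m.+1) ('C(m - a, l)%:R * (- 2) ^+ l) * phi a l (i - a)%N)) =
      fun=> rise m (N2 + 2 * n'%:R) * 1.
    apply/funext => i; rewrite mulr1 -(vandermonde2 m i); apply: eq_bigr => a _.
    rewrite -mulrA; do 2 congr (_ * _).
    have [ia|ai] := ltnP i a; first by rewrite ffact_small // !mul0r.
    congr (_ * _); set i' := (i - a)%N.
    transitivity (\sum_(l < (m - a).+1) 'C(m - a, l)%:R * ((- 2) ^+ l *
        (((D + i'.*2) ^_ l)%:R * rise (m - a - l) (N2 + (d + D)%:R + 2 * i'%:R))) : R).
      rewrite [RHS](big_ord_widen m.+1 (fun l => 'C(m - a, l)%:R * ((- 2) ^+ l *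
        (((D + i'.*2) ^_ l)%:R * rise (m - a - l) (N2 + (d + D)%:R + 2 * i'%:R))))); last by rewrite ltnS leq_subr.
      rewrite [RHS]big_mkcond; apply: eq_bigr => l _; case: ifP => [_|/negbT].
        by rewrite /phi mulrA.
      by rewrite ltnS -ltnNge => /bin_small ->; rewrite !mul0r.
    rewrite vandermonde1; congr (rise _ _).
    have -> : (i%:R : R) = i'%:R + a%:R by rewrite -natrD subnK.
    by rewrite dE -!mul2n; ring.
  rewrite E in P2; rewrite mulrC (pser_uniq P1 P2); apply: eq_bigr => a _.
  move: h => h'; rewrite exprMn mulr_sumr mulr_sumr; apply: eq_bigr => l _; ring.
apply: cvgn_sum => a; apply: cvgn_sum => l; apply: cvgM; first exact: cvg_cst.
have := cvg_comp _ _ (@uphalf_cvg l D) (Hv a l); apply: cvg_trans; apply: near_eq_cvg; apply: nearW => n /=.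
(* In the variable J = l + j the falling factorial vanishes for J < l, so the sum may start at 0 and
   be reduced to the indices J = D + 2i. *)
pose G J := (J ^_ l)%:R * rise (m - a - l) (N2 + (d + J)%:R) * (h ^+ (J - D)./2 / ((J - D)./2)`!%:R) : R.
transitivity (\sum_(J < n.*2.+1 + l) (if (D <= J)%N && ~~ odd (J - D) then G J else 0)).
  rewrite sum_parity; apply: eq_bigr => i _.
  rewrite /G /phi addKn doubleK mulrC; congr (_ * rise _ _ * _).
  by move: (nat_of_ord i) => i'; rewrite addnA [in RHS]natrD -addrA -mul2n natrM.
rewrite addnC big_split_ord /= big1 => [|j _]; last first.
  by rewrite /G ffact_small ?mul0r //; case: ifP.
rewrite add0r; apply: eq_bigr => j _; rewrite /G /ec.
have -> : (l + j + n'.*2 - d = l + j - D)%N by rewrite /D; lia.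
have -> : (d <= l + j + n'.*2)%N = (D <= l + j)%N by rewrite /D; lia.
case: ifP => _; last by rewrite mulr0.
rewrite -[(l + j)`!](ffact_fact (leq_addr j l)) addKn natrM -!mulrA; congr (_ * _).
by rewrite mulVKf // pnatr_eq0 -lt0n fact_gt0.
Qed.

End AtPoint.
End IntertwinerKernel.

Lemma big_quad (R : realType) (I A B C : finType) (G : I -> A -> B -> C -> R) :
  \sum_(p : I * (A * (B * C))) G p.1 p.2.1 p.2.2.1 p.2.2.2 =
  \sum_i \sum_a \sum_b \sum_c G i a b c.
Proof.
rewrite -(pair_bigA _ (fun i p => G i p.1 p.2.1 p.2.2)); apply: eq_bigr => i _ /=.
rewrite -(pair_bigA _ (fun a p => G i a p.1 p.2)); apply: eq_bigr => a _ /=.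
by rewrite -(pair_bigA _ (fun b c => G i a b c)).
Qed.

(** * Pairing a nonnegative polynomial with the truncated kernel *)

Section RadialTranslation.
Context {R : realType} {N : nat}.
Local Notation vec := 'rV[R]_N.
Variables (Rs Rp : seq vec) (k : vec -> R).
Hypotheses (N0 : (0 < N)%N)
  (Hrs : reduced_root_system Rs) (Hps : positive_subsystem Rs Rp)
  (Hk : multiplicity Rs k).
Implicit Types (x y xi v : vec) (f g : vec -> R).
Local Notation T := (dunklT Rp k).
Local Notation N2 := (dunkl_dim Rp k).
Local Notation gam := (gauss_moment Rp k).
Local Notation bn := (heat_coef Rp k).

Hypothesis Tcomm : forall xi eta f x, polyf f -> T xi (T eta f) x = T eta (T xi f) x.

Variable Lam : (vec -> R) -> R.
Hypothesis HL : dunkl_mean Rp k Lam.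
Variable V : (vec -> R) -> vec -> R.
Hypothesis HV : intertwining Rp k V.

Lemma Lam_sqn c f : polyf f -> Lam (fun x => dotp x x ^+ c * f x) = Lam f.
Proof.
move=> pf; elim: c => [|c IH]; first by congr Lam; apply/funext => x; rewrite mul1r.
rewrite -IH -[RHS](mean_sq HL); last first.
  by apply: polyfM => //; apply: polyf_exp; exact: polyf_dotpp.
by congr Lam; apply/funext => x; rewrite exprS mulrA.
Qed.

Lemma gam_rise c D : ~~ odd D -> gam (c.*2 + D) = rise c (N2 + D%:R) * gam D.
Proof.
move=> oD; elim: c => [|c IH]; first by rewrite rise0 mul1r.
rewrite doubleS !addSn gamSS ?oddD ?odd_double // IH riseSr natrD -mul2n natrM; ring.
Qed.

Section Family.
Variables (I : finType) (d : I -> nat) (q : I -> vec -> R).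
Hypotheses (pq : forall i, polyf (q i)) (hq : forall i, hom (d i) (q i))
  (q0 : forall y, 0 <= \sum_i q i y).
Variable M : nat.
Hypothesis dM : forall i, (d i < M)%N.

Section AtPoint.
Variables (x0 : vec) (m : nat).
Local Notation h := (dotp x0 x0 / 2).

(* The coefficients of (|x0|^2 + |y|^2 - 2 u)^m u^j / j!, where u = <x0, z>. *)
Definition kcoef (a l j : nat) : R :=
  'C(m, a)%:R * (2 * h) ^+ a * ('C(m - a, l)%:R * (- 2) ^+ l) / j`!%:R.

Definition kterm (i : I) (a l j : nat) y : R :=
  kcoef a l j * (q i y * (dotp y y ^+ (m - a - l) * V (fun z => dotp x0 z ^+ (l + j)) y)).

Lemma polyf_kV J : polyf (V (fun z => dotp x0 z ^+ J)).
Proof. by apply: (polyf_V HV); exact: polyf_dotp_exp. Qed.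

Lemma polyf_kterm i a l j : polyf (kterm i a l j).
Proof.
apply: polyfZ; apply: polyfM => //; apply: polyfM; last exact: polyf_kV.
by apply: polyf_exp; exact: polyf_dotpp.
Qed.

Lemma hom_kterm i a l j :
  hom (d i + ((m - a - l) * 2 + (l + j))) (kterm i a l j).
Proof.
apply: homZ; apply: homM => //; apply: homM; first exact: hom_exp hom_dotpp.
exact: (hom_V HV (polyf_dotp_exp x0 _) (hom_dotp_exp x0 (l + j))).
Qed.

(* z ranges over |z| <= |y|, where |x0|^2 + |y|^2 - 2 <x0, z> >= |x0 - z|^2. *)
Lemma kernel_ge0 n y :
  0 <= \sum_(p : I * ('I_m.+1 * ('I_m.+1 * 'I_(n.*2.+1))))
         kterm p.1 p.2.1 p.2.2.1 p.2.2.2 y.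
Proof.
rewrite (big_quad (fun i (a l : 'I_m.+1) (j : 'I_(n.*2.+1)) => kterm i a l j y)).
pose s := dotp y y.
pose Psi z := \sum_(a < m.+1) \sum_(l < m.+1) \sum_(j < n.*2.+1)
   (kcoef a l j * s ^+ (m - a - l)) * dotp x0 z ^+ (l + j).
have pz a l j : polyf (fun z => (kcoef a l j * s ^+ (m - a - l)) * dotp x0 z ^+ (l + j)).
  by apply: polyfZ; exact: polyf_dotp_exp.
have pPsi : polyf Psi.
  by apply: polyf_sum => a _; apply: polyf_sum => l _; apply: polyf_sum => j _.
have -> : \sum_i \sum_(a < m.+1) \sum_(l < m.+1) \sum_(j < n.*2.+1) kterm i a l j y =
    (\sum_i q i y) * V Psi y.
  rewrite mulr_suml; apply: eq_bigr => i _.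
  rewrite /Psi (V_sum HV); last first.
    by move=> a; apply: polyf_sum => l _; apply: polyf_sum => j _.
  rewrite mulr_sumr; apply: eq_bigr => a _.
  rewrite (V_sum HV); last by move=> l; apply: polyf_sum => j _.
  rewrite mulr_sumr; apply: eq_bigr => l _.
  rewrite (V_sum HV) // mulr_sumr; apply: eq_bigr => j _.
  by rewrite (VZ HV) ?/kterm -/s; [ring | exact: polyf_dotp_exp].
rewrite mulr_ge0 //; apply: (V_ge0 HV) => // z zy.
pose u := dotp x0 z.
have -> : Psi z = (s + (- 2) * u + 2 * h) ^+ m * (exp_trunc n.*2.+1).[u].
  rewrite (exprDn_widen _ _ (leqnn m)) mulr_suml; apply: eq_bigr => a _.
  rewrite (exprDn_widen _ _ (leq_subr a m)) mulr_sumr mulr_suml; apply: eq_bigr => l _.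
  rewrite horner_poly mulr_sumr; apply: eq_bigr => j _.
  by rewrite /kcoef -/u; move: (2 * h) => h'; rewrite exprMn exprD; ring.
rewrite mulr_ge0 ?exp_trunc_ge0 // exprn_ge0 //.
have := dotp_ge0 (x0 - z); rewrite dotpBl !dotpBr (dotpC z x0) -/u /s => H.
by move: zy; lra.
Qed.

(** Since |y| = 1 on the sphere, the power of |y|^2 affects only the Gaussian moment, where it
    contributes a [rise] factor; the rest is the pairing with the Dunkl kernel. *)
Lemma kterm_value i a l j :
  gam (d i + ((m - a - l) * 2 + (l + j))) * Lam (kterm i a l j) =
  'C(m, a)%:R * (2 * h) ^+ a * ('C(m - a, l)%:R * (- 2) ^+ l) *
  \sum_(n < M) ((l + j)`!%:R / j`!%:R * rise (m - a - l) (N2 + (d i + (l + j))%:R)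
        * ec x0 (l + j + n.*2) (d i)) * bn x0 n (q i).
Proof.
set c := (m - a - l)%N; set J := (l + j)%N.
have pqV : polyf (fun y => q i y * V (fun z => dotp x0 z ^+ J) y).
  by apply: polyfM => //; exact: polyf_kV.
have -> : Lam (kterm i a l j) = kcoef a l j * Lam (fun y => q i y * V (fun z => dotp x0 z ^+ J) y).
  rewrite -(meanZ HL) // -[RHS](Lam_sqn c); last exact: polyfZ.
  by congr Lam; apply/funext => y; rewrite /kterm -/c -/J; ring.
have Jn : (J`!%:R : R) != 0 by rewrite pnatr_eq0 -lt0n fact_gt0.
have EK : Lam (fun y => q i y * V (fun z => dotp x0 z ^+ J) y) =
    J`!%:R * Lam (fun y => q i y * Kj V x0 J y).
  rewrite -(meanZ HL); last by apply: polyfM => //; exact: polyf_Kj HV _ _.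
  by congr Lam; apply/funext => y; rewrite /Kj; field.
have EC : gam (d i + (c * 2 + J)) * Lam (fun y => q i y * Kj V x0 J y) =
    rise c (N2 + (d i + J)%:R) * cc Rp k Lam (Kj V x0) (d i) (q i) J.
  rewrite /cc; case oD : (odd (d i + J)).
    rewrite (mean_odd HL _ (homM (hq i) (hom_Kj HV x0 J))) ?mulr0 //.
    by apply: polyfM => //; exact: polyf_Kj HV _ _.
  by rewrite muln2 addnCA gam_rise ?oD // mulrA.
rewrite (cc_formula Hrs Hps Hk Tcomm HL (polyf_Kj HV x0) (hom_Kj HV x0) (Kj0 HV x0)
   (T_Kj Hrs Hps HV x0) J (pq i) (hq i) (dM i)) in EC.
transitivity (kcoef a l j * J`!%:R * (gam (d i + (c * 2 + J)) * Lam (fun y => q i y * Kj V x0 J y))).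
  by rewrite ?EK; ring.
rewrite EC !mulr_sumr; apply: eq_bigr => n _; rewrite /kcoef; field.
by rewrite pnatr_eq0 -lt0n fact_gt0.
Qed.

Lemma heat_moment_ge0 :
  0 <= \sum_i \sum_(n < M) rise m (N2 + 2 * n%:R) * bn x0 n (q i).
Proof.
pose P n := \sum_i \sum_(n' < M) (\sum_(a < m.+1) \sum_(l < m.+1)
     'C(m, a)%:R * (2 * h) ^+ a * ('C(m - a, l)%:R * (- 2) ^+ l) *
     \sum_(j < n.*2.+1) ((l + j)`!%:R / j`!%:R * rise (m - a - l) (N2 + (d i + (l + j))%:R)
        * ec x0 (l + j + n'.*2) (d i))) * bn x0 n' (q i).
have P0 n : 0 <= P n.
  pose D (p : I * ('I_m.+1 * ('I_m.+1 * 'I_(n.*2.+1)))) :=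
    (d p.1 + ((m - p.2.1 - p.2.2.1) * 2 + (p.2.2.1 + p.2.2.2)))%N.
  have := @gam_pos_family _ _ _ _ _ N0 Hps Hk _ HL _ D
    (fun p => kterm p.1 p.2.1 p.2.2.1 p.2.2.2)
    (fun p => polyf_kterm _ _ _ _) (fun p => hom_kterm _ _ _ _) (kernel_ge0 n).
  rewrite (big_quad (fun i (a l : 'I_m.+1) (j : 'I_(n.*2.+1)) =>
    gam (d i + ((m - a - l) * 2 + (l + j))) * Lam (kterm i a l j))).
  congr (_ <= _); apply: eq_bigr => i _.
  under [RHS]eq_bigr do rewrite mulr_suml.
  rewrite [RHS]exchange_big /=; apply: eq_bigr => a _.
  under [RHS]eq_bigr do rewrite mulr_suml.
  rewrite [RHS]exchange_big /=; apply: eq_bigr => l _.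
  under eq_bigr do rewrite kterm_value.
  rewrite -mulr_sumr exchange_big mulr_sumr; apply: eq_bigr => n' _.
  by rewrite -mulr_suml mulrA.
have cP : P @ \oo --> expR h * \sum_i \sum_(n < M) rise m (N2 + 2 * n%:R) * bn x0 n (q i).
  rewrite mulr_sumr; apply: cvgn_sum => i; rewrite mulr_sumr; apply: cvgn_sum => n'.
  have [nd|nd] := leqP n'.*2 (d i); last first.
    rewrite (bn_deg k Hrs Hps x0 (pq i) (hq i) nd) !mulr0 (_ : (fun n => _) = fun=> 0).
      exact: cvg_cst.
    by apply/funext => n; rewrite mulr0.
  have -> : expR h * (rise m (N2 + 2 * n'%:R) * bn x0 n' (q i)) =
    expR h * rise m (N2 + 2 * n'%:R) * bn x0 n' (q i) by rewrite mulrA.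
  have H := @lim_inner _ _ Rp k N0 x0 _ _ m nd.
  exact: (cvgM H (cvg_cst (bn x0 n' (q i)))).
by have := cvgn_ge0 cP P0; rewrite pmulr_rge0 // expR_gt0.
Qed.

End AtPoint.
End Family.
End RadialTranslation.

Lemma cvgn_scale1 (R : realType) (u : nat -> R) (c : R) : u @ \oo --> (1 : R) ->
  (fun m => u m * c) @ \oo --> c.
Proof. by move=> H; have := cvgM H (cvg_cst c); rewrite mul1r; apply. Qed.

(** * The operator L: positivity and growth on powers of |y|^2 *)

Section SphericalOperator.
Context {R : realType} {N : nat}.
Local Notation vec := 'rV[R]_N.
Variables (Rs Rp : seq vec) (k : vec -> R).
Hypotheses (N0 : (0 < N)%N)
  (Hrs : reduced_root_system Rs) (Hps : positive_subsystem Rs Rp)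
  (Hk : multiplicity Rs k).
Implicit Types (x y xi v : vec) (f g q : vec -> R).
Local Notation e i := (delta_mx 0 i : vec).
Local Notation T := (dunklT Rp k).
Local Notation Dk := (dunkl_lap Rp k).
Local Notation Dkn := (dunkl_lapn Rp k).
Local Notation N2 := (dunkl_dim Rp k).
Local Notation bn := (heat_coef Rp k).
Local Notation rise_gt0 := (rise_gt0 N0 Hps Hk).

Hypothesis Tcomm : forall xi eta f x, polyf f -> T xi (T eta f) x = T eta (T xi f) x.

Variable Lam : (vec -> R) -> R.
Hypothesis HL : dunkl_mean Rp k Lam.
Variable V : (vec -> R) -> vec -> R.
Hypothesis HV : intertwining Rp k V.

Lemma rise_add m n (y : R) : rise (m + n) y = rise m y * rise n (y + 2 * m%:R).
Proof.
elim: n => [|n IH]; first by rewrite addn0 rise0 mulr1.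
by rewrite addnS !riseSr IH natrD; ring.
Qed.

Lemma rise_N2_gt0 n : 0 < rise n N2.
Proof. by have := rise_gt0 n 0; rewrite mulr0 addr0. Qed.

(** Both sides are [rise (m + n) N2] divided by the two separate factors. The right side has a
    number of factors independent of m, so that m can tend to infinity. *)
Lemma rise_swap m n : rise m (N2 + 2 * n%:R) / rise m N2 = rise n (N2 + 2 * m%:R) / rise n N2.
Proof.
have E := rise_add m n N2; rewrite addnC rise_add in E.
have [rm rn] := (lt0r_neq0 (rise_N2_gt0 m), lt0r_neq0 (rise_N2_gt0 n)).
by apply: (canLR (mulfK rm)); rewrite mulrAC; apply: (canRL (mulfK rn)); rewrite mulrC E mulrC.
Qed.

(* The operator L of the header on homogeneous polynomials of degree d, with rise n N2 = 2^n (N/2 + gamma)_n. *)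
Definition Lop x t d q : R := \sum_(n < d.+1) t ^+ n.*2 / rise n N2 * bn x n q.

Lemma Lop_widen x t d q M : polyf q -> hom d q -> (d < M)%N ->
  Lop x t d q = \sum_(n < M) t ^+ n.*2 / rise n N2 * bn x n q.
Proof.
move=> pq hq dM; rewrite /Lop (big_ord_widen M (fun n => t ^+ n.*2 / rise n N2 * bn x n q)) //.
rewrite big_mkcond; apply: eq_bigr => n _; case: ifP => // /negbT; rewrite -leqNgt => dn.
rewrite (bn_deg k Hrs Hps x pq hq) ?mulr0 //; move: dn; lia.
Qed.

Lemma Lop_Z x t d c q : polyf q -> Lop x t d (fun y => c * q y) = c * Lop x t d q.
Proof.
move=> pq; rewrite /Lop mulr_sumr; apply: eq_bigr => n _.
by rewrite (bn_Z k Hrs Hps) //; ring.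
Qed.

Lemma Lop_cst x t c : Lop x t 0 (fun=> c) = c.
Proof. by rewrite /Lop big_ord1 rise0 /heat_coef /= expr0 fact0 mulr1 !divr1 mul1r. Qed.

Section Family.
Variables (I : finType) (d : I -> nat) (q : I -> vec -> R).
Hypotheses (pq : forall i, polyf (q i)) (hq : forall i, hom (d i) (q i))
  (q0 : forall y, 0 <= \sum_i q i y).

Lemma bn_scale x (tau : R) i n : tau != 0 ->
  bn (tau^-1 *: x) n (fun y => tau ^+ d i * q i y) = tau ^+ n.*2 * bn x n (q i).
Proof.
move=> t0; rewrite (bn_Z k Hrs Hps) //.
have [nd|nd] := leqP n.*2 (d i); last first.
  by rewrite !(bn_deg k Hrs Hps _ (pq i) (hq i) nd) !mulr0.
have hD : hom (d i - n.*2) (Dkn n (q i)) by apply: (hom_Dkn k Hrs Hps); rewrite ?subnK.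
rewrite /heat_coef hD -[in tau ^+ d i](subnKC nd) exprD exprVn.
rewrite -!mulrA; congr (_ * _); rewrite !mulrA divff ?mul1r // expf_neq0 //.
Qed.

Lemma Lop_family_ge0 x t : 0 <= t -> 0 <= \sum_i Lop x t (d i) (q i).
Proof.
move=> t0; pose M := (\max_i d i).+1.
have dM i : (d i < M)%N by rewrite ltnS; exact: leq_bigmax.
have -> : \sum_i Lop x t (d i) (q i) =
    \sum_i \sum_(n < M) t ^+ n.*2 / rise n N2 * bn x n (q i).
  by apply: eq_bigr => i _; rewrite (Lop_widen x t (pq i) (hq i) (dM i)).
(* For t = 0 the operator is evaluation at x, whereas the dilation used for t > 0 would
   degenerate. *)
move: t0; rewrite le_eqVlt => /predU1P[<-|t0].
  rewrite (eq_bigr (fun i => q i x)) ?q0 // => i _.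
  rewrite /M big_ord_recl [X in _ + X]big1 => [|n _]; last by rewrite lift0 doubleS exprS !mul0r.
  by rewrite rise0 /heat_coef /= !expr0 fact0 mulr1 !divr1 !mul1r addr0.
(* The weight [rise m.+1] selects the radius sqrt(2 (m + 1)), which this dilation brings to t; the
   power 2n of [tau] offsets the growth of [rise n (N2 + 2 * m.+1%:R)]. *)
pose tau (m : nat) : R := t / Num.sqrt (2 * m.+1%:R).
have tau0 m : tau m != 0.
  by rewrite mulf_neq0 ?gt_eqF // invr_gt0 sqrtr_gt0 mulr_gt0 // ltr0n.
have tau2 m n : tau m ^+ n.*2 = t ^+ n.*2 / (2 * m.+1%:R) ^+ n.
  have t2 : tau m ^+ 2 = t ^+ 2 / (2 * m.+1%:R).
    by rewrite /tau expr_div_n sqr_sqrtr // mulr_ge0.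
  by rewrite -mul2n !exprM t2 expr_div_n.
pose u m := \sum_i \sum_(n < M) (rise m.+1 (N2 + 2 * n%:R) / rise m.+1 N2) *
   (tau m ^+ n.*2 * bn x n (q i)).
apply: (@cvgn_ge0 _ u); last first.
  move=> m; have := heat_moment_ge0 N0 Hrs Hps Hk Tcomm HL HV
    (q := fun i y => tau m ^+ d i * q i y) (d := d) (fun i => polyfZ _ (pq i))
    (fun i => homZ _ (hq i)) _ dM ((tau m)^-1 *: x) m.+1.
  have q0' y : 0 <= \sum_i tau m ^+ d i * q i y.
    by have := q0 (tau m *: y); congr (_ <= _); apply: eq_bigr => i _; rewrite hq.
  move=> /(_ q0'); rewrite -(pmulr_rge0 _ (_ : 0 < (rise m.+1 N2)^-1)) ?invr_gt0 ?rise_N2_gt0 //.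
  congr (_ <= _); rewrite mulr_sumr; apply: eq_bigr => i _.
  rewrite mulr_sumr; apply: eq_bigr => n _; rewrite bn_scale //; ring.
apply: cvgn_sum => i; apply: cvgn_sum => n.
have -> : (fun m => rise m.+1 (N2 + 2 * n%:R) / rise m.+1 N2 * (tau m ^+ n.*2 * bn x n (q i))) =
  (fun m => (\prod_(r < n) (2 * m.+1%:R / (N2 + 2 * r%:R + 2 * m.+1%:R))^-1)
    * (t ^+ n.*2 / rise n N2 * bn x n (q i))).
  apply/funext => m; rewrite rise_swap tau2.
  have -> : \prod_(r < n) (2 * m.+1%:R / (N2 + 2 * r%:R + 2 * m.+1%:R))^-1 =
      rise n (N2 + 2 * m.+1%:R) / (2 * m.+1%:R) ^+ n.
    rewrite /rise; have -> : (2 * m.+1%:R) ^+ n = \prod_(i0 < n) (2 * m.+1%:R) :> R.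
      by rewrite big_const cardE size_enum_ord; elim: (n : nat) => //= n' <-; rewrite exprS.
    rewrite -prodf_div; apply: eq_bigr => r _; rewrite invf_div; congr (_ / _); ring.
  ring.
have H : (fun m => \prod_(r < n) (2 * m.+1%:R / (N2 + 2 * r%:R + 2 * m.+1%:R))^-1) @ \oo -->
    \prod_(r < n) (1 : R)^-1.
  apply: (@cvgn_prod R n (fun r m => (2 * m.+1%:R / (N2 + 2 * r%:R + 2 * m.+1%:R))^-1) (fun=> 1^-1)) => r.
  apply: cvgV; first exact: oner_neq0.
  by apply: cvg_ratio => m; rewrite -addrA -mulrDr -natrD gt_eqF ?(N2_gt0n N0 Hps Hk).
rewrite big1 in H => [|r _]; last by rewrite invr1.
exact: cvgn_scale1.
Qed.

End Family.

Lemma T_normsq i j y : T (e i) (fun z => dotp z z ^+ j.+1) y =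
  2 * j.+1%:R * (y ord0 i * dotp y y ^+ j).
Proof.
have pn n : polyf (fun z : vec => dotp z z ^+ n) by apply: polyf_exp; exact: polyf_dotpp.
have ddn m : dd (e i) (fun z => dotp z z ^+ m.+1) y = 2 * m.+1%:R * (y ord0 i * dotp y y ^+ m).
  have dd1 : dd (e i) (fun z => dotp z z) y = 2 * y ord0 i.
    rewrite /dotp dd_sum => [|l _]; last by apply: polyfM; exact: polyf_coord.
    rewrite (eq_bigr (fun l => 2 * ((e i) ord0 l * y ord0 l))); last first.
      by move=> l _; rewrite ddM ?dd_coord; [ring | exact: polyf_coord | exact: polyf_coord].
    rewrite -mulr_sumr; congr (_ * _).
    rewrite (bigD1 i) //= big1 => [|l /negPf li]; rewrite !mxE ?eqxx ?mul1r ?addr0 //=.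
    by rewrite li mul0r.
  elim: m => [|m IH]; first by rewrite dd1 !mulr1.
  rewrite (_ : (fun z => _) = fun z => dotp z z * dotp z z ^+ m.+1); last first.
    by apply/funext => z; rewrite exprS.
  by rewrite ddM //; [rewrite IH dd1 -[m.+2%:R]natr1 exprS; ring | exact: polyf_dotpp].
rewrite TfunE /T_def ddn [X in _ + X]big_seq [X in _ + X]big1 ?addr0 // => a aP.
have aa := pos_root2 Hrs Hps aP.
rewrite (linquot_eq (g := fun=> 0) aa (pn j.+1) (polyf_cst 0)) ?mulr0 // => z.
by rewrite dotp_refl_refl // subrr mulr0.
Qed.

Lemma Dk_normsq j y : Dk (fun z => dotp z z ^+ j.+1) y =
  2 * j.+1%:R * (N2 + 2 * j%:R) * dotp y y ^+ j.
Proof.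
have pn n : polyf (fun z : vec => dotp z z ^+ n) by apply: polyf_exp; exact: polyf_dotpp.
have hn n : hom n.*2 (fun z : vec => dotp z z ^+ n).
  by rewrite -muln2; exact: hom_exp hom_dotpp.
rewrite /dunkl_lap (eq_bigr (fun i => 2 * j.+1%:R * T (e i) (fun z => z ord0 i * dotp z z ^+ j) y)).
  rewrite -mulr_sumr (T_coord_sum k Hrs Hps) // (euler_T k Hrs Hps y (pn j) (hn j)).
  have E : \sum_(a <- Rp) k a * dotp (refl a y) (refl a y) ^+ j = gam_sum Rp k * dotp y y ^+ j.
    rewrite /gam_sum mulr_suml big_seq [RHS]big_seq; apply: eq_bigr => a aP.
    by rewrite dotp_refl_refl // (pos_root2 Hrs Hps aP).
  rewrite E.
  rewrite [\sum_(a <- Rp) _](_ : _ = 0); last first.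
    rewrite big_seq big1 // => a aP.
    by rewrite dotp_refl_refl ?(pos_root2 Hrs Hps aP) // subrr mulr0.
  by rewrite /dunkl_dim -muln2 natrM; ring.
move=> i _; have -> : T (e i) (fun z => dotp z z ^+ j.+1) =
    fun z => 2 * j.+1%:R * (z ord0 i * dotp z z ^+ j).
  by apply/funext => z; rewrite T_normsq.
by rewrite (T_Z k Hrs Hps) //; apply: polyfM => //; exact: polyf_coord.
Qed.

Lemma Dkn_normsq n j y : (n <= j)%N -> Dkn n (fun z => dotp z z ^+ j) y =
  \prod_(i < n) (2 * (j - i)%:R * (N2 + 2 * (j - i.+1)%:R)) * dotp y y ^+ (j - n).
Proof.
elim: n y => [|n IH] y nj; first by rewrite big_ord0 mul1r subn0.
have pn m : polyf (fun z : vec => dotp z z ^+ m) by apply: polyf_exp; exact: polyf_dotpp.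
have -> : Dkn n.+1 (fun z => dotp z z ^+ j) = Dk (Dkn n (fun z => dotp z z ^+ j)) by [].
have -> : Dkn n (fun z => dotp z z ^+ j) = fun y =>
    \prod_(i < n) (2 * (j - i)%:R * (N2 + 2 * (j - i.+1)%:R)) * dotp y y ^+ (j - n).+1.-1.
  by apply/funext => z; rewrite IH // ltnW.
have -> : (j - n).+1.-1 = (j - n.+1).+1 by rewrite subnSK.
rewrite (Dk_Z k Hrs Hps) // Dk_normsq big_ord_recr /= subnSK //; ring.
Qed.

(** As N2 >= 1, each factor is at most 2 (p + i + 1) / (i + 1). The product is then at most 2^n
    times the binomial coefficient of p + n over n, which is at most 2^(p + n). This is the origin
    of the constant 4. *)
Lemma ratio_bound (n p : nat) :
  \prod_(i < n) ((N2 + 2 * (p + i)%:R) / (N2 + 2 * i%:R)) <= 4 ^+ (n + p) :> R.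
Proof.
have N1 : 1 <= N2.
  rewrite /dunkl_dim ler_wpDr ?ler1n // mulr_ge0 // /gam_sum big_seq.
  by apply: sumr_ge0 => a aP; exact: (mult_ge0 Hps Hk aP).
apply: (@le_trans _ _ (\prod_(i < n) (2 * ((p + i).+1%:R / i.+1%:R)))).
  apply: ler_prod => i _; apply/andP; split.
    by rewrite divr_ge0 // ltW // (N2_gt0n N0 Hps Hk).
  have i0 : 0 <= (i%:R : R) by []; have p0 : 0 <= (p%:R : R) by [].
  rewrite ler_pdivrMr ?(N2_gt0n N0 Hps Hk) // mulrA mulrAC ler_pdivlMr ?ltr0n //.
  rewrite -[i.+1%:R]natr1 -[(p + i).+1%:R]natr1 natrD.
  have := mulr_ge0 p0 i0; have := mulr_ge0 i0 i0.
  have := ler_wpM2r p0 N1; have := ler_wpM2r i0 N1; lra.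
have E : \prod_(i < n) ((p + i).+1%:R / i.+1%:R) = 'C(p + n, n)%:R :> R.
  elim: n => [|n IH]; first by rewrite big_ord0 bin0.
  rewrite big_ord_recr /= IH addnS.
  have := congr1 (fun m => m%:R : R) (mul_bin_diag (p + n).+1 n); rewrite !natrM /= => E1.
  have n0 : (n.+1%:R : R) != 0 by rewrite pnatr_eq0.
  by apply: (mulfI n0); rewrite -E1; field; rewrite addrC natr1.
rewrite big_split /= E big_const cardE size_enum_ord.
have -> : iter n ( *%R 2) 1 = 2 ^+ n :> R by elim: (n) => //= m ->; rewrite exprS.
have -> : (4 : R) ^+ (n + p) = 2 ^+ (n + p) * 2 ^+ (p + n).
  by rewrite [(p + n)%N]addnC -exprMn; congr (_ ^+ _); ring.
apply: ler_pM; rewrite ?exprn_ge0 ?ler0n //; first by rewrite ler_weXn2l ?leq_addr // ler1n.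
rewrite -natrX ler_nat -[(2 ^ _)%N]/((1 + 1) ^ (p + n))%N expnDn.
have np : (n < (p + n).+1)%N by rewrite ltnS leq_addl.
rewrite (bigD1 (Ordinal np)) //= !exp1n !muln1; exact: leq_addr.
Qed.

(** The n-th term is the n-th binomial term of (|x|^2 + t^2)^j times the product in [ratio_bound]
    for p = j - n. *)
Lemma Lop_normsq_bound x t j :
  Lop x t j.*2 (fun z => dotp z z ^+ j) <= (4 * (t ^+ 2 + dotp x x)) ^+ j.
Proof.
have pn m : polyf (fun z : vec => dotp z z ^+ m) by apply: polyf_exp; exact: polyf_dotpp.
have hn m : hom m.*2 (fun z : vec => dotp z z ^+ m).
  by rewrite -muln2; exact: hom_exp hom_dotpp.
have -> : Lop x t j.*2 (fun z => dotp z z ^+ j) =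
    \sum_(n < j.+1) t ^+ n.*2 / rise n N2 * bn x n (fun z => dotp z z ^+ j).
  have jj : (j < j.*2.+1)%N by lia.
  rewrite /Lop [RHS](big_ord_widen j.*2.+1 (fun n => t ^+ n.*2 / rise n N2 * bn x n (fun z => dotp z z ^+ j))) //.
  rewrite [RHS]big_mkcond; apply: eq_bigr => n _; case: ifP => // /negbT; rewrite -leqNgt => dn.
  by rewrite (bn_deg k Hrs Hps x (pn j) (hn j)) ?mulr0 // ltn_double.
rewrite exprMn (addrC (t ^+ 2)) (exprDn_widen (dotp x x) (t ^+ 2) (leqnn j)) mulr_sumr.
apply: ler_sum => n _; have nj : (n <= j)%N by rewrite -ltnS.
have := ratio_bound n (j - n); rewrite addnC subnK // => H.
have -> : t ^+ n.*2 / rise n N2 * bn x n (fun z => dotp z z ^+ j) =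
    (\prod_(i < n) ((N2 + 2 * (j - n + i)%:R) / (N2 + 2 * i%:R))) *
    ('C(j, n)%:R * (t ^+ 2) ^+ n * dotp x x ^+ (j - n)).
  rewrite /heat_coef Dkn_normsq // prodf_div -/(rise n N2) big_split /=.
  have -> : \prod_(i < n) (2 * (j - i)%:R) = 2 ^+ n * (j ^_ n)%:R :> R.
    rewrite big_split /= big_const cardE size_enum_ord ffact_prod natr_prod; congr (_ * _).
    by elim: (nat_of_ord n) => //= m ->; rewrite exprS.
  rewrite -bin_ffact natrM (reindex_inj rev_ord_inj) /=.
  have -> : \prod_(i < n) (N2 + 2 * (j - (n - i.+1).+1)%:R) =
      \prod_(i < n) (N2 + 2 * (j - n + i)%:R).
    apply: eq_bigr => i _; congr (_ + 2 * _%:R); have := ltn_ord i; lia.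
  rewrite -exprM mul2n; field.
  by rewrite (lt0r_neq0 (rise_N2_gt0 n)) pnatr_eq0 -lt0n fact_gt0 expf_neq0.
apply: ler_wpM2r => //; rewrite !mulr_ge0 // exprn_ge0 ?sqr_ge0 ?dotp_ge0 //.
Qed.

End SphericalOperator.

Lemma polyf_bounded (R : realType) (N : nat) (f : 'rV[R]_N -> R) (r : R) : polyf f ->
  exists B, forall y, dotp y y <= r -> `|f y| <= B.
Proof.
elim=> [c|i|g h _ [B HB] _ [C HC]|g h _ [B HB] _ [C HC]].
- by exists `|c|.
- exists (Num.sqrt r) => y yr; rewrite -sqrtr_sqr ler_wsqrtr // (le_trans _ yr) //.
  rewrite /dotp (bigD1 i) //= expr2 lerDl; apply: sumr_ge0 => j _.
  by rewrite -expr2 sqr_ge0.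
- by exists (B + C) => y yr; rewrite (le_trans (ler_normD _ _)) // lerD ?HB ?HC.
- by exists (B * C) => y yr; rewrite normrM ler_pM ?HB ?HC.
Qed.

(** * Spherical means of polynomials *)

Section MeanOfPolynomials.
Context {R : realType} {N : nat}.
Local Notation vec := 'rV[R]_N.
Variables (Rs Rp : seq vec) (k : vec -> R).
Hypotheses (N0 : (0 < N)%N)
  (Hrs : reduced_root_system Rs) (Hps : positive_subsystem Rs Rp)
  (Hk : multiplicity Rs k).
Implicit Types (x y xi v : vec) (f g q p h : vec -> R).
Local Notation e i := (delta_mx 0 i : vec).
Local Notation T := (dunklT Rp k).
Local Notation Dk := (dunkl_lap Rp k).
Local Notation Dkn := (dunkl_lapn Rp k).
Local Notation N2 := (dunkl_dim Rp k).
Local Notation Lop := (Lop Rp k).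

Hypothesis Tcomm : forall xi eta f x, polyf f -> T xi (T eta f) x = T eta (T xi f) x.

Variable Lam : (vec -> R) -> R.
Hypothesis HL : dunkl_mean Rp k Lam.
Variable V : (vec -> R) -> vec -> R.
Hypothesis HV : intertwining Rp k V.

(* Outside the ball the polynomial is absorbed by a large power of |y|^2, on which Lop grows slower. *)
Lemma Lop_family_ge (I : finType) (d : I -> nat) (q : I -> vec -> R) x t rho eps :
  (forall i, polyf (q i)) -> (forall i, hom (d i) (q i)) ->
  0 <= t -> 4 * (t ^+ 2 + dotp x x) < rho ->
  (forall y, dotp y y <= rho -> - eps <= \sum_i q i y) ->
  - eps <= \sum_i Lop x t (d i) (q i).
Proof.
move=> pq hq t0 xr qe; set S := \sum_i _.
set th := 4 * (t ^+ 2 + dotp x x) in xr.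
have th0 : 0 <= th by rewrite mulr_ge0 // addr_ge0 ?sqr_ge0 ?dotp_ge0.
have rho0 : 0 < rho by apply: le_lt_trans xr.
have [B HB] : {B : I -> R | forall i y, dotp y y <= rho -> `|q i y| <= B i}.
  exists (fun i => sval (cid (polyf_bounded rho (pq i)))) => i.
  by case: (cid _).
pose C := \sum_i B i + `|eps|.
pose J0 := \max_i d i.
pose u n := S + eps + C * (th / rho) ^+ (n + J0).
have B0 i : 0 <= B i by rewrite (le_trans _ (HB i 0 _)) // dotp0r ltW.
have C0 : 0 <= C by rewrite addr_ge0 // sumr_ge0.
have u0 n : 0 <= u n.
  set j := (n + J0)%N.
  have dj i : (d i <= j.*2)%N.
    by rewrite (leq_trans (leq_bigmax i)) // -addnn /j -/J0; lia.
  pose c := C / rho ^+ j.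
  (* The family is enlarged by the constant eps and by C (|y|^2 / rho)^j. On the ball eps suffices;
     outside it the last term dominates, since 2j is at least every degree [d i]. *)
  pose d' (z : I + bool) := match z with inl i => d i | inr true => 0%N | inr false => j.*2 end.
  pose q' (z : I + bool) := match z with inl i => q i | inr true => (fun=> eps)
    | inr false => (fun y : vec => c * dotp y y ^+ j) end.
  have pn : polyf (fun y : vec => dotp y y ^+ j) by apply: polyf_exp; exact: polyf_dotpp.
  have pq' z : polyf (q' z).
    by case: z => [i|[]] //=; [exact: polyf_cst | exact: polyfZ].
  have hq' z : hom (d' z) (q' z).
    case: z => [i|[]] //=; first exact: hom_cst.
    by apply: homZ; rewrite -muln2; exact: hom_exp hom_dotpp.
  have q0 y : 0 <= \sum_z q' z y.
    rewrite big_sumType /= big_bool /=.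
    have c0 : 0 <= c by rewrite divr_ge0 // exprn_ge0 // ltW.
    have [yr|ry] := leP (dotp y y) rho.
      have : 0 <= c * dotp y y ^+ j by rewrite mulr_ge0 // exprn_ge0 // dotp_ge0.
      by have := qe y yr; lra.
    (* Scaling y back by s >= 1 reaches the boundary of the ball, where the bounds [B i] hold. *)
    pose s := Num.sqrt (dotp y y / rho).
    have s2 : s ^+ 2 = dotp y y / rho by rewrite sqr_sqrtr // divr_ge0 ?dotp_ge0 // ltW.
    have s1 : 1 <= s.
      by rewrite -[1]sqrtr1 ler_wsqrtr // ler_pdivlMr // mul1r ltW.
    have s0 : s != 0 by rewrite gt_eqF // (lt_le_trans ltr01).
    have cE : c * dotp y y ^+ j = C * s ^+ j.*2.
      by rewrite -mul2n exprM s2 /c expr_div_n; ring.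
    have qi i : `|q i y| <= B i * s ^+ j.*2.
      rewrite -[y](scalerKV s0) hq normrM mulrC ler_pM //.
        by apply: HB; rewrite hom_dotpp exprVn s2 invf_div divfK // gt_eqF // (lt_trans rho0).
      by rewrite ger0_norm ?exprn_ge0 ?(le_trans ler01) // ler_weXn2l.
    have qs : - (\sum_i B i * s ^+ j.*2) <= \sum_i q i y.
      by rewrite -sumrN; apply: ler_sum => i _; have := qi i; rewrite ler_norml => /andP[].
    have es : - (`|eps| * s ^+ j.*2) <= eps.
      have : `|eps| <= `|eps| * s ^+ j.*2 by rewrite ler_peMr // exprn_ege1.
      by have := ler_norm (- eps); rewrite normrN; lra.
    by rewrite cE /C mulrDl mulr_suml; lra.
  have := Lop_family_ge0 N0 Hrs Hps Hk Tcomm HL HV pq' hq' q0 x t0.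
  rewrite big_sumType /= big_bool /= -/S Lop_cst (Lop_Z k Hrs Hps) // => H.
  apply: (le_trans H); rewrite /u -addrA !lerD2l expr_div_n -/j /c -mulrA [X in C * X <= _]mulrC.
  apply: ler_wpM2l => //; apply: ler_wpM2r; first by rewrite invr_ge0 exprn_ge0 // ltW.
  exact: (Lop_normsq_bound N0 Hrs Hps Hk).
have cu : u @ \oo --> S + eps.
  rewrite -[S + eps]addr0; apply: cvgD; first exact: cvg_cst.
  rewrite -(mulr0 C); apply: cvgM; first exact: cvg_cst.
  rewrite (cvg_shiftn J0 (fun n => (th / rho) ^+ n) _).
  apply: cvg_expr; rewrite ger0_norm; last by rewrite divr_ge0 // ltW.
  by rewrite ltr_pdivrMr // mul1r.
by have := cvgn_ge0 cu u0; lra.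
Qed.

(** With no roots the Dunkl Laplacian is the ordinary one, so the lemmas on its iterates and degrees
    apply to it as well. *)
Local Notation Dl := (dunkl_lap [::] k).
Local Notation Dln := (dunkl_lapn [::] k).

Lemma reduced_nil : reduced_root_system ([::] : seq vec).
Proof. by split. Qed.

Lemma positive_nil : positive_subsystem ([::] : seq vec) [::].
Proof. by exists 0; split. Qed.

Lemma T_nil xi f x : dunklT [::] k xi f x = dd xi f x.
Proof. by rewrite TfunE /T_def big_nil addr0. Qed.

Lemma T_nilE xi f : dunklT [::] k xi f = dd xi f.
Proof. by apply/funext => x; rewrite T_nil. Qed.

Lemma Dk_V p : polyf p -> Dk (V p) = V (Dl p).
Proof.
move=> pp; apply/funext => x; rewrite [in RHS]/dunkl_lap (V_sum HV) => [|i]; last first.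
  by rewrite !T_nilE; do 2 apply: polyf_dd.
apply: eq_bigr => i _; rewrite !T_nilE -(V_T HV); last exact: polyf_dd.
by congr (T _ _ _); apply/funext => y; rewrite (V_T HV).
Qed.

Lemma polyf_Dln n p : polyf p -> polyf (Dln n p).
Proof. exact: (polyf_Dkn k reduced_nil positive_nil). Qed.

Lemma Dkn_V n p : polyf p -> Dkn n (V p) = V (Dln n p).
Proof. by move=> pp; elim: n => //= n ->; rewrite Dk_V //; exact: polyf_Dln. Qed.

(** [mean_T] replaces each outer T_i by y_i, and Euler's identity for Dunkl operators applies; its
    reflection differences have mean zero. *)
Lemma Lam_Dk m q : polyf q -> hom m.+2 q ->
  Lam (Dk q) = (N2 + m%:R) * m.+2%:R * Lam q.
Proof.
move=> pq hq; have pT i := polyf_T k Hrs Hps (e i) pq.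
have pc i := @polyf_coord R N i.
rewrite /dunkl_lap (Lam_sum HL) => [|i]; last exact: (polyf_T k Hrs Hps).
have hT i := hom_T k Hrs Hps (e i) pq hq.
rewrite (eq_bigr (fun i => (N2 + m%:R) * Lam (fun y => y ord0 i * T (e i) q y))); last first.
  by move=> i _; rewrite (mean_T HL _ (pT i) (hT i)) -natr1; congr (_ * _); ring.
rewrite -mulr_sumr -mulrA; congr (_ * _).
rewrite -(Lam_sum HL) => [|i]; last exact: polyfM.
have pk a : polyf (fun y => k a * (q y + -1 * q (refl a y))).
  by apply: polyfZ; apply: polyfD => //; apply: polyfZ; exact: polyf_refl.
have -> : (fun y => \sum_i y ord0 i * T (e i) q y) =
    fun y => m.+2%:R * q y + \sum_(a <- Rp) k a * (q y + -1 * q (refl a y)).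
  apply/funext => y; rewrite (euler_T k Hrs Hps y pq hq); congr (_ + _).
  by apply: eq_bigr => a _; rewrite mulN1r.
rewrite (meanD HL); [|exact: polyfZ|exact: polyf_sum].
rewrite (meanZ HL) // (Lam_sum HL) // big_seq big1 ?addr0 // => a aP.
have pr := polyf_refl a pq.
rewrite (meanZ HL); last by apply: polyfD => //; exact: polyfZ.
by rewrite (meanD HL) ?(meanZ HL) ?(mean_refl HL) //; [ring | exact: polyfZ].
Qed.

Lemma hom_Dln n m p : polyf p -> hom (m + n.*2) p -> hom m (Dln n p).
Proof. exact: (hom_Dkn k reduced_nil positive_nil). Qed.

(** Each Laplacian lowers the degree by two at the cost of the factor in [Lam_Dk]; after n of them a
    constant remains, on which V is the identity. *)
Lemma Lam_V_even n p : polyf p -> hom n.*2 p ->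
  Lam (V p) = Dln n p 0 / (rise n N2 * (2 ^+ n * n`!%:R)).
Proof.
elim: n p => [|n IH] p pp hp.
  have p1 : polyf (fun _ : vec => 1 : R) by exact: polyf_cst.
  have E1 : (fun _ : vec => p 0) = fun y => p 0 * (fun=> 1) y.
    by apply/funext => y; rewrite mulr1.
  have EV : V (fun=> p 0) = fun y => p 0 * (fun=> 1) y.
    by apply/funext => y; rewrite E1 (VZ HV) // (V1 HV).
  rewrite rise0 fact0 expr0 !mulr1 divr1 [in LHS](hom0_cst hp) EV (meanZ HL) //.
  by rewrite (mean1 HL) mulr1.
have hDl : hom n.*2 (Dl p) by exact: (hom_Dk k reduced_nil positive_nil).
have pDl : polyf (Dl p) by exact: (polyf_Dk k reduced_nil positive_nil).
have H := Lam_Dk (polyf_V HV pp) (hom_V HV pp hp).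
rewrite Dk_V // (IH _ pDl hDl) in H.
have n1 : N2 + n.*2%:R != 0 by rewrite -mul2n natrM gt_eqF // (N2_gt0n N0 Hps Hk).
have n2 : (n.*2.+2%:R : R) != 0 by rewrite pnatr_eq0.
apply: (mulfI n2); apply: (mulfI n1); rewrite mulrA -H.
rewrite -[Dln n.+1 p]/(iter n.+1 Dl p) iterSr -/(Dln n (Dl p)).
rewrite riseSr factS exprS natrM -doubleS -!mul2n !natrM; field.
rewrite (lt0r_neq0 (rise_N2_gt0 N0 Hps Hk n)) pnatr_eq0 -lt0n fact_gt0 expf_neq0 //=.
rewrite [1 + _]addrC natr1 pnatr_eq0 /= andbT.
by move: n1; rewrite -mul2n natrM.
Qed.

(** At the origin only the iterate n = m / 2 survives, and none if m is odd. Written as a sum over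
    all n, the formula no longer mentions the degree and can be added over homogeneous parts. *)
Lemma Lam_V_scale m p t M : polyf p -> hom m p -> (m < M)%N ->
  Lam (fun y => V p (t *: y)) =
  \sum_(n < M) t ^+ n.*2 * (Dln n p 0 / (rise n N2 * (2 ^+ n * n`!%:R))).
Proof.
move=> pp hp mM.
have -> : (fun y => V p (t *: y)) = fun y => t ^+ m * V p y.
  by apply/funext => y; rewrite (hom_V HV pp hp).
rewrite (meanZ HL); last exact: (polyf_V HV).
have Z n : n.*2 != m -> Dln n p 0 = 0.
  move=> nm; have [mn|mn] := ltnP m n.*2.
    exact: (Dkn_deg k reduced_nil positive_nil 0 pp hp mn).
  have h1 : hom (m - n.*2) (Dln n p) by apply: hom_Dln; rewrite ?subnK.
  rewrite -(scale0r 0) h1 expr0n subn_eq0 leqNgt ltn_neqAle nm mn /= mul0r //.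
case om : (odd m).
  rewrite (mean_odd HL (polyf_V HV pp) (hom_V HV pp hp) om) mulr0 big1 // => n _.
  by rewrite Z ?mul0r ?mulr0 //; apply: contraTneq om => <-; rewrite odd_double.
have mE : m = m./2.*2 by rewrite -[LHS]odd_double_half om.
have m2M : (m./2 < M)%N by lia.
rewrite (bigD1 (Ordinal m2M)) //= big1 ?addr0 => [|n nm].
  by rewrite -mE (@Lam_V_even (m./2)) // -mE.
rewrite Z ?mul0r ?mulr0 //; apply: contraNneq nm => nm.
by apply/eqP/val_inj; rewrite /= -nm doubleK.
Qed.

Lemma V_scale_sum I (r : seq I) (F : I -> vec -> R) t : (forall i, polyf (F i)) ->
  (fun y => V (fun z => \sum_(i <- r) F i z) (t *: y)) =
  fun y => \sum_(i <- r) V (F i) (t *: y).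
Proof. by move=> pF; apply/funext => y; rewrite (V_sum HV). Qed.

Lemma polyf_V_scale p t : polyf p -> polyf (fun y => V p (t *: y)).
Proof. by move=> pp; apply: polyf_scale; exact: (polyf_V HV). Qed.

Lemma Lam_V_polyf p t : polyf p -> exists M0, forall M, (M0 <= M)%N ->
  Lam (fun y => V p (t *: y)) =
  \sum_(n < M) t ^+ n.*2 * (Dln n p 0 / (rise n N2 * (2 ^+ n * n`!%:R))).
Proof.
move=> /polyf_graded [I [d [F [HF pE]]]].
have pF i : polyf (F i) by have [] := HF i.
exists (\max_i d i).+1 => M HM.
have -> : p = fun z => \sum_i F i z by apply/funext => z.
rewrite V_scale_sum // (Lam_sum HL); last by move=> i; exact: polyf_V_scale.
under [RHS]eq_bigr do rewrite (Dkn_sum k reduced_nil positive_nil) // mulr_suml mulr_sumr.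
rewrite [RHS]exchange_big; apply: eq_bigr => i _ /=.
have [_ hF] := HF i; apply: Lam_V_scale hF _ => //.
by apply: leq_trans HM; rewrite ltnS; exact: leq_bigmax.
Qed.

Lemma Dln_shift n p (z : vec) : polyf p -> Dln n (fun y => p (z + y)) = fun y => Dln n p (z + y).
Proof.
move=> pp; elim: n => //= n ->; have pD := polyf_Dln n pp.
apply/funext => y; apply: eq_bigr => i _; rewrite !T_nilE.
rewrite -dd_shift; last exact: polyf_dd.
by congr (dd _ _ _); apply/funext => u; rewrite dd_shift.
Qed.

(** Separating the variables lets V in x, V in y and the mean be interchanged by linearity alone. *)
Lemma polyf_addition p : polyf p -> exists (J : finType) (g h : J -> vec -> R),
  [/\ forall j, polyf (g j), forall j, polyf (h j) &
      forall x y, p (x + y) = \sum_j g j x * h j y].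
Proof.
elim=> [c|i|f1 f2 _ [J1 [g1 [h1 [pg1 ph1 E1]]]] _ [J2 [g2 [h2 [pg2 ph2 E2]]]]
  |f1 f2 _ [J1 [g1 [h1 [pg1 ph1 E1]]]] _ [J2 [g2 [h2 [pg2 ph2 E2]]]]].
- exists unit, (fun=> fun=> c), (fun=> fun=> 1); split=> [_|_|x y]; try exact: polyf_cst.
  by rewrite big_const card_unit /= addr0 mulr1.
- exists bool, (fun b x => if b then x ord0 i else 1), (fun b x => if b then 1 else x ord0 i).
  split=> [[]|[]|x y]; try exact: polyf_cst; try exact: polyf_coord.
  by rewrite big_bool /= mulr1 mul1r mxE.
- exists (J1 + J2)%type, (fun j => match j with inl a => g1 a | inr b => g2 b end),
    (fun j => match j with inl a => h1 a | inr b => h2 b end); split; try by case.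
  by move=> x y; rewrite big_sumType /= E1 E2.
- exists (J1 * J2)%type, (fun j x => g1 j.1 x * g2 j.2 x), (fun j x => h1 j.1 x * h2 j.2 x).
  split=> [[a b]|[a b]|x y] /=; try exact: polyfM.
  rewrite E1 E2 mulr_suml -(pair_bigA _ (fun a b => g1 a x * g2 b x * (h1 a y * h2 b y))) /=.
  by apply: eq_bigr => a _; rewrite mulr_sumr; apply: eq_bigr => b _; ring.
Qed.

Definition dtr g x y : R := V (fun x' => V (fun z => g (x' + z)) y) x.

Lemma dtr_addition p : polyf p -> exists (J : finType) (g h : J -> vec -> R),
  [/\ forall j, polyf (g j), forall j, polyf (h j),
      forall x y, p (x + y) = \sum_j g j x * h j y &
      forall x y, dtr p x y = \sum_j V (g j) x * V (h j) y].
Proof.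
move=> /polyf_addition [J [g [h [pg ph E]]]]; exists J, g, h; split=> // x y.
have -> : dtr p x y = V (fun x' => \sum_j V (h j) y * g j x') x.
  congr (V _ x); apply/funext => x'.
  have -> : (fun z => p (x' + z)) = fun z => \sum_j g j x' * h j z by apply/funext.
  rewrite (V_sum HV); last by move=> j; exact: polyfZ.
  by apply: eq_bigr => j _; rewrite (VZ HV) // mulrC.
rewrite (V_sum HV); last by move=> j; exact: polyfZ.
by apply: eq_bigr => j _; rewrite (VZ HV) // mulrC.
Qed.

(** For fixed x' the mean of V p(x' + .) is a Pizzetti sum of ordinary Laplacians of p at x';
    applying V in x' turns them into Dunkl Laplacians of V p. *)
Lemma mean_dtr_hom d p x t : polyf p -> hom d p ->
  Lam (fun y => dtr p x (t *: y)) = Lop x t d (V p).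
Proof.
move=> pp hp; have [J [g [h [pg ph E D]]]] := dtr_addition pp.
have pVh j := polyf_V_scale t (ph j).
pose A x' := Lam (fun y => V (fun z => p (x' + z)) (t *: y)).
have AE x' : A x' = \sum_j Lam (fun y => V (h j) (t *: y)) * g j x'.
  rewrite /A.
  have -> : (fun y => V (fun z => p (x' + z)) (t *: y)) =
      fun y => \sum_j g j x' * V (h j) (t *: y).
    apply/funext => y; have -> : (fun z => p (x' + z)) = fun z => \sum_j g j x' * h j z by apply/funext.
    rewrite (V_sum HV); last by move=> j; exact: polyfZ.
    by apply: eq_bigr => j _; rewrite (VZ HV).
  rewrite (Lam_sum HL); last by move=> j; exact: polyfZ.
  by apply: eq_bigr => j _; rewrite (meanZ HL) // mulrC.
have -> : Lam (fun y => dtr p x (t *: y)) = V A x.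
  have -> : A = fun x' => \sum_j Lam (fun y => V (h j) (t *: y)) * g j x' by apply/funext.
  rewrite (V_sum HV); last by move=> j; exact: polyfZ.
  have -> : (fun y => dtr p x (t *: y)) = fun y => \sum_j V (g j) x * V (h j) (t *: y).
    by apply/funext.
  rewrite (Lam_sum HL); last by move=> j; exact: polyfZ.
  by apply: eq_bigr => j _; rewrite (meanZ HL) // (VZ HV) // mulrC.
have -> : A = fun x' => \sum_(n < d.+1) t ^+ n.*2 / (rise n N2 * (2 ^+ n * n`!%:R)) * Dln n p x'.
  apply/funext => x'; have [M0 HM0] := Lam_V_polyf t (polyf_shift x' pp).
  rewrite /A (HM0 (M0 + d.+1)%N) ?leq_addr // addnC big_split_ord /= [X in _ + X]big1 ?addr0 => [|n _].
    by apply: eq_bigr => n _; rewrite Dln_shift // addr0; ring.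
  have Z : Dln (d.+1 + n) (fun z => p (x' + z)) 0 = 0.
    by rewrite Dln_shift // (Dkn_deg k reduced_nil positive_nil _ pp hp) //; lia.
  by rewrite [X in _ * (X / _)](_ : _ = 0) ?mul0r ?mulr0.
rewrite (V_sum HV); last by move=> n; apply: polyfZ; exact: polyf_Dln.
apply: eq_bigr => n _; rewrite (VZ HV); last exact: polyf_Dln.
rewrite /heat_coef Dkn_V // invfM; ring.
Qed.

Lemma mean_dtr (I : finType) (d : I -> nat) (p : I -> vec -> R) x t :
  (forall i, polyf (p i)) -> (forall i, hom (d i) (p i)) ->
  Lam (fun y => dtr (fun z => \sum_i p i z) x (t *: y)) = \sum_i Lop x t (d i) (V (p i)).
Proof.
move=> pp hp; have pdtr i : polyf (fun y => dtr (p i) x (t *: y)).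
  have [J [g [h [pg ph _ D]]]] := dtr_addition (pp i).
  apply: (@eq_polyf _ _ (fun y => \sum_j V (g j) x * V (h j) (t *: y))) => [y|].
    by rewrite D.
  by apply: polyf_sum => j _; apply: polyfZ; exact: polyf_V_scale.
transitivity (Lam (fun y => \sum_i dtr (p i) x (t *: y))); last first.
  by rewrite (Lam_sum HL) //; apply: eq_bigr => i _; exact: mean_dtr_hom.
congr Lam; apply/funext => y; rewrite /dtr.
rewrite (_ : (fun x' => _) = fun x' => \sum_i V (fun z => p i (x' + z)) (t *: y)).
  rewrite (V_sum HV) // => i.
  have [J [g [h [pg ph E]]]] := polyf_addition (pp i).
  apply: (@eq_polyf _ _ (fun x' => \sum_j V (h j) (t *: y) * g j x')) => [x'|].
    have -> : (fun z => p i (x' + z)) = fun z => \sum_j g j x' * h j z by apply/funext.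
    rewrite (V_sum HV); last by move=> j; exact: polyfZ.
    by apply: eq_bigr => j _; rewrite (VZ HV) // mulrC.
  by apply: polyf_sum => j _; exact: polyfZ.
by apply/funext => x'; rewrite (V_sum HV) // => i; exact: polyf_shift.
Qed.

End MeanOfPolynomials.

(** * Bijectivity of V on homogeneous polynomials and commutation of the Dunkl operators *)

Lemma row_dependence (R : realType) (A : finType) (w : 'I_#|A|.+1 -> A -> R) :
  exists u : 'I_#|A|.+1 -> R, (exists i, u i != 0) /\ forall a, \sum_i u i * w i a = 0.
Proof.
pose M := \matrix_(i < #|A|.+1, j < #|A|) w i (enum_val j).
have : kermx M != 0.
  rewrite -mxrank_eq0 mxrank_ker -lt0n subn_gt0; exact: leq_ltn_trans (rank_leq_col M) _.
move=> /rowV0Pn [v /sub_kermxP vM v0]; exists (fun i => v 0 i); split.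
  apply/existsP; apply: contraNT v0 => /existsPn H; apply/eqP/rowP => i.
  by rewrite mxE; have /negPn/eqP := H i.
move=> a; have := congr1 (fun m : 'rV_#|A| => m 0 (enum_rank a)) vM.
rewrite mxE [X in _ = X]mxE => E; rewrite -[RHS]E.
by apply: eq_bigr => i _; rewrite mxE enum_rankK.
Qed.

Section Commutation.
Context {R : realType} {N : nat}.
Local Notation vec := 'rV[R]_N.
Variables (Rs Rp : seq vec) (k : vec -> R).
Hypotheses (Hrs : reduced_root_system Rs) (Hps : positive_subsystem Rs Rp).
Variable V : (vec -> R) -> vec -> R.
Hypothesis HV : intertwining Rp k V.
Implicit Types (x y xi eta : vec) (f q p : vec -> R).
Local Notation T := (dunklT Rp k).

Lemma V_const c : V (fun=> c) = fun=> c.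
Proof.
have E1 : (fun _ : vec => c) = fun y => c * (fun=> 1) y by apply/funext => y; rewrite mulr1.
by apply/funext => y; rewrite E1 (VZ HV) ?(V1 HV) ?mulr1 //; exact: polyf_cst.
Qed.

(** If V p = 0 then V(d_i p) = T_i V p = 0, so by induction on the degree all partial derivatives of
    p vanish, and Euler's identity gives p = 0. *)
Lemma V_inj m p : polyf p -> hom m p -> (forall x, V p x = 0) -> forall x, p x = 0.
Proof.
elim: m p => [|m IH] p pp hp Vp x.
  by have := Vp x; rewrite (hom0_cst hp) V_const.
have : m.+1%:R * p x = 0.
  rewrite -(euler_sum x pp hp) big1 // => i _.
  rewrite (IH (dd (delta_mx 0 i) p)) ?mulr0 //; [exact: polyf_dd | exact: hom_dd |] => y.
  rewrite -(V_T HV) // (_ : V p = fun=> 0) ?(T0 k Hrs Hps) //; exact/funext.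
by move/eqP; rewrite mulf_eq0 pnatr_eq0 => /eqP.
Qed.

(** Exponents at most m form a finite type, which exhibits a finite spanning set for the polynomials
    of degree m. *)
Definition ord_monom m (a : {ffun 'I_N -> 'I_m.+1}) : vec -> R :=
  monom [ffun i => nat_of_ord (a i)].

Lemma ord_monom_span m p : polyf p -> hom m p ->
  exists w : {ffun 'I_N -> 'I_m.+1} -> R, forall x, p x = \sum_a w a * ord_monom a x.
Proof.
move=> pp /(hom_homog_poly pp) [s [sm pE]].
suff [w wE] : exists w : {ffun 'I_N -> 'I_m.+1} -> R,
    forall x, \sum_(c <- s) c.1 * monom c.2 x = \sum_a w a * ord_monom a x.
  by exists w => x; rewrite pE wE.
elim: s sm {pE} => [|c s IH] /=.
  by exists (fun=> 0) => x; rewrite big_nil big1 // => a _; rewrite mul0r.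
case/andP => /eqP cm /IH [w wE].
pose b : {ffun 'I_N -> 'I_m.+1} := [ffun i => inord (c.2 i)].
exists (fun a => (if a == b then c.1 else 0) + w a) => x.
rewrite big_cons wE; under [RHS]eq_bigr do rewrite mulrDl.
rewrite big_split /= [X in _ = X + _](bigD1 b) //= eqxx [X in _ = _ + X + _]big1 ?addr0 => [|a /negPf ->];
  last by rewrite mul0r.
congr (_ * _ + _); congr (monom _ x); apply/ffunP => i; rewrite !ffunE inordK //.
by rewrite ltnS -cm (bigD1 i) //= leq_addr.
Qed.

Lemma iter_V n m q : polyf q -> hom m q -> polyf (iter n V q) /\ hom m (iter n V q).
Proof.
move=> pq hq; elim: n => //= n [pn hn]; split; [exact: (polyf_V HV) | exact: (hom_V HV)].
Qed.

Lemma V_cancel m q (r : nat) (c : nat -> R) (K : nat) : polyf q -> hom m q ->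
  (forall x : vec, \sum_(n < K) c n * iter (r + n)%N V q x = 0) ->
  forall x : vec, \sum_(n < K) c n * iter n V q x = 0.
Proof.
move=> pq hq; have itP n := iter_V n pq hq.
elim: r => [|r IH] H; first exact: H.
apply: IH; apply: (@V_inj m).
- by apply: polyf_sum => n _; apply: polyfZ; exact: (itP _).1.
- by apply: hom_sum => n _; apply: homZ; exact: (itP _).2.
move=> x; rewrite (V_sum HV); last by move=> n; apply: polyfZ; exact: (itP _).1.
rewrite -[RHS](H x); apply: eq_bigr => n _.
by rewrite (VZ HV) //; exact: (itP _).1.
Qed.

(* The iterates q, V q, V^2 q, ... are linearly dependent; cancel the lowest power by injectivity. *)
Lemma V_surj m q : polyf q -> hom m q ->
  exists p, [/\ polyf p, hom m p & V p = q].
Proof.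
move=> pq hq; pose A := {ffun 'I_N -> 'I_m.+1}; pose D := #|A|.
have itP n := iter_V n pq hq.
have [w wE] : {w : 'I_D.+1 -> A -> R |
    forall (i : 'I_D.+1) x, iter i V q x = \sum_a w i a * ord_monom a x}.
  exists (fun i : 'I_D.+1 => sval (cid (ord_monom_span (itP i).1 (itP i).2))) => i.
  by case: (cid _).
have [u [[i1 ui1] uw]] := row_dependence w.
have dep x : \sum_(i < D.+1) u i * iter i V q x = 0.
  under eq_bigr do rewrite wE mulr_sumr.
  rewrite exchange_big big1 // => a _ /=.
  by under eq_bigr do rewrite mulrA; rewrite -mulr_suml uw mul0r.
pose c n := if insub n is Some i then u i else 0.
have cE (i : 'I_D.+1) : c i = u i by rewrite /c valK.
have [n0 cn0 n0min] : {n0 | c n0 != 0 & forall n, (n < n0)%N -> c n = 0}.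
  have ex : exists n, c n != 0 by exists i1; rewrite cE.
  exists (ex_minn ex); first by case: ex_minnP.
  case: ex_minnP => n0 _ H n nn; apply/eqP; apply: contraTT nn => /H; by rewrite -leqNgt.
have dep1 K x : (D < K + n0)%N -> \sum_(n < K) c (n0 + n)%N * iter (n0 + n) V q x = 0.
  move=> DK; rewrite -[RHS](dep x) -[LHS]add0r.
  transitivity (\sum_(n < n0 + K) c n * iter n V q x).
    rewrite big_split_ord /= [X in _ = X + _]big1 // => n _; by rewrite n0min ?mul0r.
  rewrite [RHS](eq_bigr (fun i : 'I_D.+1 => c i * iter i V q x)); last by move=> i _; rewrite cE.
  rewrite [RHS](big_ord_widen (n0 + K)%N (fun i => c i * iter i V q x)); last by rewrite addnC.
  rewrite [RHS]big_mkcond; apply: eq_bigr => n _; case: ifP => // /negbT nD.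
  by rewrite /c insubN ?mul0r.
have dep2 := V_cancel pq hq (c := fun n => c (n0 + n)%N) (fun x => dep1 D.+1 x (leq_addr n0 D.+1)).
(* The relation divided by its lowest coefficient expresses q as V of this combination of
   iterates. *)
pose p x := \sum_(n < D) (- (c (n0 + n.+1)%N / c n0)) * iter n V q x.
have pZ n : polyf (fun x => (- (c (n0 + n.+1)%N / c n0)) * iter n V q x).
  by apply: polyfZ; exact: (itP _).1.
exists p; split; first exact: polyf_sum.
  by apply: hom_sum => n _; apply: homZ; exact: (itP _).2.
apply/funext => x; have := dep2 x; rewrite big_ord_recl addn0 /= => E.
rewrite /p (V_sum HV) //; apply: (mulfI cn0).
rewrite mulr_sumr; move/eqP: E; rewrite addr_eq0 => /eqP ->.
rewrite -sumrN; apply: eq_bigr => n _; rewrite (VZ HV); last exact: (itP _).1.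
by field.
Qed.

Lemma T_comm xi eta f x : polyf f -> T xi (T eta f) x = T eta (T xi f) x.
Proof.
move=> pf; move: f pf xi eta x; apply: polyf_hom_ind.
- by move=> f g /funext ->.
- move=> xi eta x; have E z : T z (fun=> 0) = fun=> 0.
    by apply/funext => y; exact: (T0 k Hrs Hps).
  by rewrite (E eta) (E xi) !E.
- move=> f g pf pg Qf Qg xi eta x.
  have E z : T z (fun x => f x + g x) = fun x => T z f x + T z g x.
    by apply/funext => y; rewrite (T_D k Hrs Hps).
  have pT z h : polyf h -> polyf (T z h) by exact: (polyf_T k Hrs Hps).
  rewrite (E eta) (E xi) (T_D k Hrs Hps xi x (pT eta f pf) (pT eta g pg)).
  by rewrite (T_D k Hrs Hps eta x (pT xi f pf) (pT xi g pg)) Qf Qg.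
move=> m f pf hf xi eta x; have [p [pp hp <-]] := V_surj pf hf.
have E z : T z (V p) = V (dd z p) by apply/funext => y; rewrite (V_T HV).
rewrite (E eta) (E xi) !(V_T HV); try exact: polyf_dd.
by congr (V _ x); apply/funext => y; exact: dd_comm.
Qed.

End Commutation.

(** * Polynomial approximation *)

Lemma bernstein_moments (R : realType) (n : nat) (u : R) :
  [/\ \sum_(j < n.+1) 'C(n, j)%:R * (u ^+ j * (1 - u) ^+ (n - j)) = 1,
      \sum_(j < n.+1) 'C(n, j)%:R * (j%:R * (u ^+ j * (1 - u) ^+ (n - j))) = n%:R * u &
      \sum_(j < n.+1) 'C(n, j)%:R * (j%:R ^+ 2 * (u ^+ j * (1 - u) ^+ (n - j))) =
        n%:R * u * (1 + n.-1%:R * u)].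
Proof.
have M0 m : \sum_(j < m.+1) 'C(m, j)%:R * (u ^+ j * (1 - u) ^+ (m - j)) = 1.
  have E : (1 - u + u) ^+ m = 1 by rewrite subrK expr1n.
  rewrite -[RHS]E exprDn; apply: eq_bigr => j _.
  by rewrite -mulr_natl; ring.
have M1 m : \sum_(j < m.+1) 'C(m, j)%:R * (j%:R * (u ^+ j * (1 - u) ^+ (m - j))) = m%:R * u.
  rewrite (sum_bin_absorb m (fun j => u ^+ j * (1 - u) ^+ (m - j))).
  case: m => [|m]; first by rewrite !mul0r.
  congr (_ * _); transitivity (u * \sum_(j < m.+1) 'C(m, j)%:R * (u ^+ j * (1 - u) ^+ (m - j))).
    rewrite mulr_sumr /=; apply: eq_bigr => j _.
    by rewrite subSS exprS; ring.
  by rewrite M0 mulr1.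
split=> //.
under eq_bigr do rewrite expr2 -mulrA.
rewrite (sum_bin_absorb n (fun j => j%:R * (u ^+ j * (1 - u) ^+ (n - j)))).
case: n => [|n]; first by rewrite !mul0r.
rewrite -mulrA; congr (_ * _).
transitivity (u * (\sum_(j < n.+1) 'C(n, j)%:R * (u ^+ j * (1 - u) ^+ (n - j))) +
  u * (\sum_(j < n.+1) 'C(n, j)%:R * (j%:R * (u ^+ j * (1 - u) ^+ (n - j))))).
  rewrite !mulr_sumr -big_split; apply: eq_bigr => j _ /=.
  by rewrite subSS exprS -natr1; ring.
by rewrite M0 M1 /=; ring.
Qed.

Lemma bernstein_variance (R : realType) (n : nat) (u : R) :
  \sum_(j < n.+2) 'C(n.+1, j)%:R * (u ^+ j * (1 - u) ^+ (n.+1 - j)) * (u - j%:R / n.+1%:R) ^+ 2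
  = u * (1 - u) / n.+1%:R.
Proof.
have [M0 M1 M2] := bernstein_moments n.+1 u.
transitivity (u ^+ 2 * (\sum_(j < n.+2) 'C(n.+1, j)%:R * (u ^+ j * (1 - u) ^+ (n.+1 - j)))
  - 2 * u / n.+1%:R * (\sum_(j < n.+2) 'C(n.+1, j)%:R * (j%:R * (u ^+ j * (1 - u) ^+ (n.+1 - j))))
  + n.+1%:R ^- 2 * \sum_(j < n.+2) 'C(n.+1, j)%:R * (j%:R ^+ 2 * (u ^+ j * (1 - u) ^+ (n.+1 - j)))).
  rewrite !mulr_sumr -sumrB -big_split; apply: eq_bigr => j _ /=.
  by rewrite -exprVn; ring.
have n0 : (n.+1%:R : R) != 0 by rewrite pnatr_eq0.
rewrite M0 M1 M2 /= -[n.+1%:R]natr1 in n0 *; field.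
by rewrite addrC.
Qed.

Section Weierstrass.
Context {R : realType} {N : nat}.
Local Notation vec := 'rV[R]_N.
Implicit Types (g : vec -> R) (y z : vec).

Lemma cube_compact (rho : R) : compact [set y : vec | forall i, `|y ord0 i| <= rho].
Proof.
have := @rV_compact R N (fun=> [set` `[- rho, rho]]) (fun=> @segment_compact R (- rho) rho).
congr compact; apply/seteqP; split=> y /= H i; have := H i; by rewrite in_itv /= ler_norml.
Qed.

(** Only y is confined to the cube; z may lie outside, as is needed when g is compared at two nearby
    translates. *)
Lemma cube_unif_continuous g (rho eps : R) : continuous g -> 0 < eps ->
  exists2 delta : R, 0 < delta & forall y z, (forall i, `|y ord0 i| <= rho) ->
    (forall i, `|y ord0 i - z ord0 i| < delta) -> `|g y - g z| <= eps.
Proof.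
move=> cg e0.
pose P (d : R) (y : vec) := forall z, (forall i, `|y ord0 i - z ord0 i| < d) -> `|g y - g z| <= eps.
have H1 x : [set y : vec | forall i, `|y ord0 i| <= rho] x ->
    \forall x' \near x & d \near (0 : R)^'+, P d x'.
  move=> _; have e2 : 0 < eps / 2 by rewrite divr_gt0.
  have /cvgrPdist_lt/(_ _ e2)/nbhs_ballP [r /= r0 Hr] := cg x.
  have r2 : 0 < r / 2 by rewrite divr_gt0.
  exists (ball x (r / 2), [set d | d < r / 2]); first by split; [exact: nbhsx_ballx | exact: nbhs_right_lt].
  move=> [x' d] /= [[_ bx] dr] z zd.
  have Hx' : `|g x - g x'| < eps / 2.
    apply: Hr; split=> // i j; apply: lt_trans (bx i j) _; lra.
  have Hz : `|g x - g z| < eps / 2.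
    apply: Hr; split=> // i j; have := bx i j; rewrite (ord1 i) => /= b1.
    apply: le_lt_trans (ler_distD (x' ord0 j) (x ord0 j) (z ord0 j)) _.
    by rewrite [ltRHS](splitr r) ltrD // (lt_trans (zd j)).
  rewrite (le_trans (ler_distD (g x) _ _)) // distrC; lra.
have /compact_near_coveringP HK := @cube_compact rho.
have H2 := HK R (0 : R)^'+ P _ H1.
have [d [Hd d0]] := @filter_ex _ (0 : R)^'+ _ _ (filterI (H2 _) (nbhs_right_gt (0 : R))).
by exists d => // y z Hy; apply: Hd.
Qed.

Definition bnode (rho : R) n (a : {ffun 'I_N -> 'I_n.+2}) : vec :=
  \row_i (2 * rho * ((a i)%:R / n.+1%:R) - rho).

Definition bweight (rho : R) n (j : nat) (s : R) : R :=
  'C(n.+1, j)%:R * (((s + rho) / (2 * rho)) ^+ j * (1 - (s + rho) / (2 * rho)) ^+ (n.+1 - j)).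

(** Tensor product Bernstein polynomial on the cube [-rho, rho]^N, of degree n + 1 in each
    variable. *)
Definition bernstein g rho n y : R :=
  \sum_(a : {ffun 'I_N -> 'I_n.+2}) g (bnode rho a) * \prod_i bweight rho n (a i) (y ord0 i).

Lemma polyf_bernstein g rho n : polyf (bernstein g rho n).
Proof.
apply: polyf_sum => a _; apply: polyfZ; apply: polyf_prod => i _.
have pu : polyf (fun y : vec => (y ord0 i + rho) / (2 * rho)).
  apply: polyfM; last exact: polyf_cst.
  by apply: polyfD; [exact: polyf_coord | exact: polyf_cst].
apply: polyfZ; apply: polyfM; apply: polyf_exp => //.
by apply: polyfB => //; exact: polyf_cst.
Qed.

Lemma sum_bweight rho n s : \sum_(j < n.+2) bweight rho n j s = 1.
Proof. by have [-> _ _] := bernstein_moments n.+1 ((s + rho) / (2 * rho)). Qed.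

Lemma bweight_ge0 rho n j s : 0 < rho -> `|s| <= rho -> 0 <= bweight rho n j s.
Proof.
move=> r0; rewrite ler_norml => /andP[s1 s2].
rewrite mulr_ge0 // mulr_ge0 // exprn_ge0 //.
  by rewrite divr_ge0 //; lra.
by rewrite subr_ge0 ler_pdivrMr; lra.
Qed.

Lemma sum_prod_bweight rho n y :
  \sum_(a : {ffun 'I_N -> 'I_n.+2}) \prod_i bweight rho n (a i) (y ord0 i) = 1.
Proof.
rewrite -(bigA_distr_bigA (fun i (j : 'I_n.+2) => bweight rho n j (y ord0 i))) big1 // => i _.
exact: sum_bweight.
Qed.

(** The sum over multi-indices factors over the coordinates: coordinate i contributes the variance 4
    rho^2 u (1 - u) / (n + 1), every other one contributes 1, and u (1 - u) <= 1/4. *)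
Lemma bernstein_dist rho n y i : 0 < rho -> `|y ord0 i| <= rho ->
  \sum_(a : {ffun 'I_N -> 'I_n.+2}) (\prod_l bweight rho n (a l) (y ord0 l)) *
     (y ord0 i - bnode rho a ord0 i) ^+ 2 <= rho ^+ 2 / n.+1%:R.
Proof.
move=> r0 yi; pose F (l : 'I_N) (j : 'I_n.+2) := bweight rho n j (y ord0 l) *
  (if l == i then (y ord0 i - (2 * rho * (j%:R / n.+1%:R) - rho)) ^+ 2 else 1).
rewrite (eq_bigr (fun a : {ffun 'I_N -> 'I_n.+2} => \prod_l F l (a l))) => [|a _]; last first.
  rewrite /F [RHS]big_split /=; congr (_ * _); rewrite (bigD1 i) //= eqxx mxE big1 ?mulr1 // => l /negPf ->.
  by [].
rewrite -(bigA_distr_bigA F) (bigD1 i) //= (_ : \prod_(l < N | l != i) \sum_j F l j = 1) ?mulr1; last first.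
  apply: big1 => l /negPf li.
  by rewrite -[RHS](sum_bweight rho n (y ord0 l)); apply: eq_bigr => j _; rewrite /F li mulr1.
set u := (y ord0 i + rho) / (2 * rho).
have -> : \sum_j F i j = 4 * rho ^+ 2 * (u * (1 - u) / n.+1%:R).
  rewrite -bernstein_variance mulr_sumr; apply: eq_bigr => j _; rewrite /F eqxx /bweight -/u.
  have -> : y ord0 i = 2 * rho * u - rho by rewrite /u; field; lra.
  by ring.
rewrite mulrA; apply: ler_wpM2r => //.
have : 0 <= (2 * u - 1) ^+ 2 by exact: sqr_ge0.
have := sqr_ge0 rho; move: (rho ^+ 2) => r2 r20 H.
have -> : 4 * r2 * (u * (1 - u)) = r2 * (1 - (2 * u - 1) ^+ 2) by ring.
by rewrite -[leRHS]mulr1 ler_wpM2l //; lra.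
Qed.

(* Where y is farther than delta from a node, |g y - g z| is absorbed by the second moment. *)
Theorem weierstrass_cube g (rho eps : R) : continuous g -> 0 < rho -> 0 < eps ->
  exists2 p : vec -> R, polyf p & forall y, (forall i, `|y ord0 i| <= rho) -> `|g y - p y| <= eps.
Proof.
move=> cg r0 e0; have e2 : 0 < eps / 2 by rewrite divr_gt0.
have [delta d0 Hd] := cube_unif_continuous rho cg e2.
have [M HM] : exists M, forall y, (forall i, `|y ord0 i| <= rho) -> `|g y| <= M.
  have cK := @cube_compact rho.
  have c0 : [set y : vec | forall i, `|y ord0 i| <= rho] !=set0.
    by exists 0 => i /=; rewrite mxE normr0 ltW.
  have cn : {within [set y : vec | forall i, `|y ord0 i| <= rho], continuous (fun y => `|g y|)}.
    by apply: continuous_subspaceT => y; apply: continuous_comp; [exact: cg | exact: norm_continuous].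
  have [c _ Hc] := EVT_max_rV c0 cK cn.
  by exists `|g c| => y Hy; apply: Hc; rewrite inE.
have M0 : 0 <= M by apply: le_trans (HM 0 _) => // i; rewrite mxE normr0 ltW.
pose K : R := 2 * M / delta ^+ 2.
have K0 : 0 <= K by apply: divr_ge0; [exact: mulr_ge0 | exact: sqr_ge0].
have [n Hn] : exists n : nat, K * (N%:R * rho ^+ 2) / n.+1%:R <= eps / 2.
  exists (Num.bound (K * (N%:R * rho ^+ 2) / (eps / 2))).
  rewrite ler_pdivrMr ?ltr0n // [leRHS]mulrC -ler_pdivrMr //.
  have := archi_boundP (divr_ge0 (mulr_ge0 K0 (mulr_ge0 (ler0n R N) (sqr_ge0 rho))) (ltW e2)).
  by move=> /ltW /le_trans; apply; rewrite ler_nat.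
exists (bernstein g rho n); first exact: polyf_bernstein.
move=> y Hy; pose w (a : {ffun 'I_N -> 'I_n.+2}) := \prod_i bweight rho n (a i) (y ord0 i).
have w0 a : 0 <= w a by apply: prodr_ge0 => i _; exact: bweight_ge0.
have Hnode (a : {ffun 'I_N -> 'I_n.+2}) i : `|bnode rho a ord0 i| <= rho.
  rewrite mxE; set v := (a i)%:R / n.+1%:R.
  have v0 : 0 <= v by rewrite divr_ge0.
  have v1 : v <= 1 by rewrite ler_pdivrMr ?ltr0n // mul1r ler_nat -ltnS.
  have := ler_wpM2l (ltW r0) v1; have := mulr_ge0 (ltW r0) v0.
  by rewrite ler_norml => A1 A2; apply/andP; split; lra.
have Ha (a : {ffun 'I_N -> 'I_n.+2}) : `|g y - g (bnode rho a)| <= eps / 2 + K * \sum_i (y ord0 i - bnode rho a ord0 i) ^+ 2.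
  have S0 : 0 <= \sum_i (y ord0 i - bnode rho a ord0 i) ^+ 2.
    by apply: sumr_ge0 => i _; exact: sqr_ge0.
  case: (pselect (forall i, `|y ord0 i - bnode rho a ord0 i| < delta)) => [/(Hd _ _ Hy) H|].
    by rewrite (le_trans H) // lerDl mulr_ge0.
  move/existsNP => [i /negP]; rewrite -leNgt => di.
  have : `|g y - g (bnode rho a)| <= 2 * M.
    rewrite (le_trans (ler_normB _ _)) // (mulr_natl M 2) mulr2n lerD // HM //; exact: Hnode.
  move/le_trans; apply.
  have -> : 2 * M = K * delta ^+ 2 by rewrite /K divfK // expf_neq0 // gt_eqF.
  suff : delta ^+ 2 <= \sum_i (y ord0 i - bnode rho a ord0 i) ^+ 2 by move/(ler_wpM2l K0); lra.
  rewrite (bigD1 i) //=; apply: ler_wpDr; first by apply: sumr_ge0 => l _; exact: sqr_ge0.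
  by rewrite -[leRHS]real_normK ?num_real // lerXn2r // nnegrE // ltW.
have -> : g y - bernstein g rho n y = \sum_a w a * (g y - g (bnode rho a)).
  transitivity (g y * (\sum_a w a) - bernstein g rho n y); first by rewrite sum_prod_bweight mulr1.
  by rewrite mulr_sumr -sumrB; apply: eq_bigr => a _; rewrite /w; ring.
rewrite (le_trans (ler_norm_sum _ _ _)) //.
apply: (@le_trans _ _ (\sum_a w a * (eps / 2 + K * \sum_i (y ord0 i - bnode rho a ord0 i) ^+ 2))).
  by apply: ler_sum => a _; rewrite normrM (ger0_norm (w0 a)) ler_wpM2l.
under eq_bigr do rewrite mulrDr.
rewrite big_split /= -mulr_suml sum_prod_bweight mul1r.
have -> : \sum_a w a * (K * \sum_i (y ord0 i - bnode rho a ord0 i) ^+ 2) =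
    K * \sum_i \sum_a w a * (y ord0 i - bnode rho a ord0 i) ^+ 2.
  rewrite exchange_big mulr_sumr; apply: eq_bigr => a _ /=.
  by rewrite mulrCA -mulr_sumr.
have : \sum_i \sum_a w a * (y ord0 i - bnode rho a ord0 i) ^+ 2 <= \sum_(i < N) rho ^+ 2 / n.+1%:R.
  by apply: ler_sum => i _; exact: bernstein_dist.
rewrite sumr_const card_ord -[_ *+ N]mulr_natl => /(ler_wpM2l K0) H.
have Hn2 : K * (N%:R * (rho ^+ 2 / n.+1%:R)) <= eps / 2 by move: Hn; rewrite !mulrA.
rewrite [leRHS](splitr eps) lerD2l; exact: le_trans H Hn2.
Qed.

End Weierstrass.

(** * The representing measures *)

Section Continuity.
Context {R : realType} {N : nat}.
Local Notation vec := 'rV[R]_N.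
Implicit Types (x y z a : vec) (f g : vec -> R).

Lemma polyf_continuous f : polyf f -> continuous f.
Proof.
elim=> [c|i|g h _ cg _ ch|g h _ cg _ ch] x.
- exact: cst_continuous.
- exact: coord_continuous.
- exact: (cvgD (cg x) (ch x)).
- exact: (cvgM (cg x) (ch x)).
Qed.

Lemma lincomb_continuous (U : topologicalType) (I : Type) (s : seq I) (c : I -> U -> R)
    (p : I -> vec) :
  (forall i, continuous (c i)) -> continuous (fun w : U => \sum_(i <- s) c i w *: p i).
Proof.
move=> cc; elim: s => [|i s IH] w.
  rewrite (_ : (fun w => _) = cst 0); first exact: cst_continuous.
  by apply/funext => v; rewrite big_nil.
rewrite (_ : (fun w => _) = (fun w : U => c i w *: p i) + (fun w : U => \sum_(i <- s) c i w *: p i)).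
  exact: (cvgD (cvgZr_tmp (a := p i) (cc i w)) (IH w)).
by apply/funext => v; rewrite big_cons.
Qed.

Lemma dotp_sumr (I : Type) (s : seq I) (F : I -> vec) x :
  dotp x (\sum_(i <- s) F i) = \sum_(i <- s) dotp x (F i).
Proof.
elim: s => [|i s IH]; first by rewrite !big_nil dotp0r.
by rewrite !big_cons dotpDr IH.
Qed.

End Continuity.

(** * Orbits and their convex hulls *)

Section Orbit.
Context {R : realType} {N : nat}.
Local Notation vec := 'rV[R]_N.
Implicit Types (x y z a : vec) (f g : vec -> R).
Variable Rs : seq vec.
Hypothesis Hrs : reduced_root_system Rs.

(** Reflections are moved to the root, so an orbit point meets each root in one of finitely many
    values. *)
Lemma orbit_dotp x y a : Defs.orbit Rs x y -> a \in Rs -> exists2 b, b \in Rs & dotp a y = dotp b x.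
Proof.
move=> Hy; elim: Hy a => [|b y' bR _ IH] a aR; first by exists a.
case: (IH (refl b a)); first by case: Hrs => _ _ H _; exact: H.
by move=> c cR E; exists c => //; rewrite -dotp_reflC //; case: Hrs => _ /(_ _ bR).
Qed.

Lemma orbit_span x y : Defs.orbit Rs x y -> exists c : vec -> R, y = x + \sum_(a <- Rs) c a *: a.
Proof.
have [uR _ _ _] := Hrs.
elim=> [|b y' bR _ [c ->]].
  by exists (fun=> 0); rewrite big1 ?addr0 // => a _; rewrite scale0r.
rewrite /refl; set s := _ / _.
exists (fun a => c a - (if a == b then s else 0)).
rewrite -addrA; congr (_ + _).
under [RHS]eq_bigr do rewrite scalerBl.
rewrite sumrB; congr (_ - _); rewrite (bigD1_seq b) //= eqxx big1 ?addr0 // => a /negPf ->.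
by rewrite scale0r.
Qed.

(** The difference of two orbit points lies in the span of the roots; being orthogonal to every
    root, it is orthogonal to itself. *)
Lemma orbit_dotp_inj x y z : Defs.orbit Rs x y -> Defs.orbit Rs x z ->
  (forall a, a \in Rs -> dotp a y = dotp a z) -> y = z.
Proof.
move=> /orbit_span [c yE] /orbit_span [d zE] H.
have E : y - z = \sum_(a <- Rs) (c a - d a) *: a.
  under eq_bigr do rewrite scalerBl.
  by rewrite sumrB yE zE; rewrite opprD addrACA subrr add0r.
apply/eqP; rewrite -subr_eq0 -dotp_eq0 {2}E dotp_sumr big_seq big1 // => a aR.
by rewrite dotpZr dotpC dotpBr H // subrr mulr0.
Qed.

(** An orbit point is determined by its inner products with the roots, each of the form <b, x> for a
    root b. Hence maps from root indices to root indices enumerate the orbit. *)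
Lemma orbit_finite x : exists (K : nat) (q : 'I_K -> vec),
  (forall j, Defs.orbit Rs x (q j)) /\ forall y, Defs.orbit Rs x y -> exists j, y = q j.
Proof.
pose m := size Rs; pose r (i : 'I_m) := nth 0 Rs i.
pose I := {ffun 'I_m -> 'I_m}.
pose Q (F : I) y := Defs.orbit Rs x y /\ forall i, dotp (r i) y = dotp (r (F i)) x.
(* A map realised by no orbit point is sent to the default x, which is itself in the orbit. *)
pose p (F : I) := xget x (Q F).
have Hp F : Defs.orbit Rs x (p F).
  by rewrite /p; case: xgetP => [y _ []|_] //; exact: Defs.orbit_refl.
exists #|{: I}|, (fun j => p (enum_val j)); split=> // y Hy.
have ex (i : 'I_m) : exists j : 'I_m, dotp (r i) y = dotp (r j) x.
  have [b bR E] := orbit_dotp Hy (mem_nth 0 (ltn_ord i)).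
  have bi : (index b Rs < m)%N by rewrite index_mem.
  by exists (Ordinal bi); rewrite /r /= nth_index.
have [F HF] := choice ex.
exists (enum_rank [ffun i => F i]); rewrite enum_rankK.
have QF : Q [ffun i => F i] y by split=> // i; rewrite ffunE.
rewrite /p; case: xgetP => [z _ [Hz1 Hz2]|/(_ y)] //.
apply: (orbit_dotp_inj Hy Hz1) => a aR.
have ai : (index a Rs < m)%N by rewrite index_mem.
have -> : a = r (Ordinal ai) by rewrite /r /= nth_index.
by rewrite Hz2 HF ffunE.
Qed.

(** By finiteness of the orbit the hull is a continuous image of a compact standard simplex.
    Closedness makes it a Borel set, over which integrals can be taken. *)
Lemma conv_orbit_closed x : closed (conv_orbit Rs x).
Proof.
have [K [q [Hq1 Hq2]]] := orbit_finite x.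
pose A : set 'rV[R]_K := [set w | (forall j, 0 <= w ord0 j) /\ \sum_j w ord0 j = 1].
have cA : compact A.
  apply: (@subclosed_compact _ _ [set w : 'rV[R]_K | forall j, `|w ord0 j| <= 1]).
  - have -> : A = (\bigcap_j [set w : 'rV[R]_K | 0 <= w ord0 j]) `&` [set w | \sum_j w ord0 j = 1].
      by apply/seteqP; split=> w [w0 w1]; split=> // j; [move=> _|]; exact: w0.
    apply: closedI.
      apply: closed_bigI => j _.
      apply: (@preimage_closed _ _ (fun w : 'rV[R]_K => w ord0 j) [set t | 0 <= t]).
        by move=> w _; exact: coord_continuous.
      exact: closed_ge.
    apply: (@preimage_closed _ _ (fun w : 'rV[R]_K => \sum_j w ord0 j) [set 1]).
      move=> w _; apply: polyf_continuous; apply: polyf_sum => j _; exact: polyf_coord.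
    exact: closed_eq.
  - exact: cube_compact.
  move=> w [w0 w1] j /=; rewrite ger0_norm // -w1 (bigD1 j) //= lerDl.
  by apply: sumr_ge0 => i _.
have -> : conv_orbit Rs x = (fun w : 'rV[R]_K => \sum_j w ord0 j *: q j) @` A.
  apply/seteqP; split=> z.
    move=> [n [p [w [Hp w0 w1 ->]]]].
    have [f Hf] := choice (fun i => Hq2 _ (Hp i)).
    exists (\row_j \sum_(i | f i == j) w i).
      split=> [j|]; first by rewrite mxE; apply: sumr_ge0.
      rewrite -w1 (partition_big f predT) //=; apply: eq_bigr => j _; by rewrite mxE.
    rewrite [RHS](partition_big f predT) //=; apply: eq_bigr => j _.
    by rewrite mxE scaler_suml; apply: eq_bigr => i /eqP <-; rewrite -Hf.
  move=> [w [w0 w1] <-]; exists K, q, (fun j => w ord0 j); split=> //.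
apply: compact_closed; first exact: norm_hausdorff.
apply: continuous_compact cA; apply: continuous_subspaceT.
by apply: lincomb_continuous => i w; exact: coord_continuous.
Qed.

(** Orbit points p satisfy |p| = |x|, and 2 <z, p> <= |z|^2 + |p|^2 is averaged over the convex
    combination. *)
Lemma conv_orbit_ball x z : conv_orbit Rs x z -> dotp z z <= dotp x x.
Proof.
move=> [n [p [w [Hp w0 w1 zE]]]].
have Hpp i : dotp (p i) (p i) = dotp x x.
  elim: (Hp i) => // a y aR _ <-; case: Hrs => _ H2 _ _; exact: dotp_refl_refl (H2 _ aR).
have : dotp z z <= \sum_i w i * ((dotp x x + dotp z z) / 2).
  rewrite {2}zE dotp_sumr; apply: ler_sum => i _; rewrite dotpZr ler_wpM2l //.
  have := dotp_ge0 (z - p i); rewrite dotpBr !(dotpC (z - p i)) !dotpBr Hpp (dotpC (p i) z); lra.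
by rewrite -mulr_suml w1 mul1r; lra.
Qed.

End Orbit.

Lemma shift_continuous (R : realType) (N : nat) (g : 'rV[R]_N -> R) (u : 'rV[R]_N) : continuous g -> continuous (fun z => g (u + z)).
Proof.
move=> cg z; apply: (@continuous_comp _ _ _ (fun z : 'rV[R]_N => u + z) g); last exact: cg.
have H1 : {for z, continuous (fun _ : 'rV[R]_N => u)} by exact: cst_continuous.
have H2 : {for z, continuous (fun v : 'rV[R]_N => v)} by move=> A; exact.
exact: (cvgD H1 H2).
Qed.

Section BallApproximation.
Context {R : realType} {N : nat}.
Local Notation vec := 'rV[R]_N.
Implicit Types (x y z a : vec) (f g p : vec -> R).

Lemma sqr_coord_le y i : (y ord0 i) ^+ 2 <= dotp y y.
Proof.
rewrite /dotp (bigD1 i) //= expr2 lerDl.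
by apply: sumr_ge0 => j _; rewrite -expr2 sqr_ge0.
Qed.

(** |r| + 1 exceeds the square root of r, so a ball fits into this cube without square roots being
    mentioned. *)
Lemma coord_le y (r : R) i : dotp y y <= r -> `|y ord0 i| <= `|r| + 1.
Proof.
move=> Hy; have := sqr_coord_le y i; rewrite -[X in X <= _ -> _]real_normK ?num_real //.
have := ler_norm r; have := normr_ge0 r; move: `|_| `|r| => u v; nra.
Qed.

Lemma weierstrass_ball g (r eps : R) : continuous g -> 0 < eps ->
  exists2 p : vec -> R, polyf p & forall y, dotp y y <= r -> `|g y - p y| <= eps.
Proof.
move=> cg e0; have r0 : 0 < `|r| + 1 by have := normr_ge0 r; lra.
have [p pp Hp] := weierstrass_cube cg r0 e0.
by exists p => // y Hy; apply: Hp => i; exact: coord_le.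
Qed.

Lemma continuous_bounded_ball g (r : R) : continuous g ->
  exists B, forall y, dotp y y <= r -> `|g y| <= B.
Proof.
move=> cg; have [p pp Hp] := weierstrass_ball r cg (@ltr01 R).
have [B HB] := polyf_bounded r pp.
exists (1 + B) => y Hy; rewrite -[g y](subrK (p y)) (le_trans (ler_normD _ _)) // lerD ?Hp ?HB //.
Qed.

Lemma continuous_measurable_borelV f : continuous f -> measurable_fun setT (f : borelV R N -> R).
Proof.
move=> cf; apply: (measurability _ (RGenOInfty.measurableE R)) => _ [_ [r ->] <-].
rewrite setTI; apply: sub_sigma_algebra.
apply: (@open_comp _ _ f); first by move=> y _; exact: cf.
exact: interval_open.
Qed.

End BallApproximation.

(** * Integration of continuous functions against the representing measures *)

Section VkContinuous.
Context {R : realType} {N : nat}.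
Local Notation vec := 'rV[R]_N.
Variables (Rs : seq vec) (mu : vec -> probability (borelV R N) R).
Hypotheses (Hrs : reduced_root_system Rs)
  (Hmu : forall x, mu x (~` conv_orbit Rs x) = 0%E).
Implicit Types (x y z a : vec) (f g p : vec -> R).

Lemma conv_orbit_measurable x : measurable (conv_orbit Rs x : set (borelV R N)).
Proof.
rewrite -[conv_orbit Rs x]setCK; apply: measurableC; apply: sub_sigma_algebra.
by apply: closed_openC; exact: conv_orbit_closed.
Qed.

Lemma integrable_conv_orbit f x : continuous f -> (mu x).-integrable (conv_orbit Rs x) (EFin \o (f : borelV R N -> R)).
Proof.
move=> cf; apply: measurable_bounded_integrable.
- exact: conv_orbit_measurable.
- by rewrite (le_lt_trans (probability_le1 _ (conv_orbit_measurable x))) // ltry.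
- by apply: measurable_funTS; exact: continuous_measurable_borelV.
have [B HB] := continuous_bounded_ball (dotp x x) cf.
exists B; split; first exact: num_real.
by move=> M BM z /(conv_orbit_ball Hrs) Hz /=; rewrite (le_trans (HB z Hz)) // ltW.
Qed.

Lemma integrable_continuous f x : continuous f -> (mu x).-integrable setT (EFin \o (f : borelV R N -> R)).
Proof.
move=> cf; have mf := continuous_measurable_borelV cf.
apply/integrableP; split; first exact/measurable_EFinP.
rewrite (@ge0_negligible_integral _ _ _ _ _ ((~` conv_orbit Rs x) : set (borelV R N))) //.
- rewrite setTD setCK; have /integrableP [_] := integrable_conv_orbit x cf; exact.
- by apply: measurableC; exact: conv_orbit_measurable.
- by apply/measurable_EFinP; apply: measurableT_comp.
- exact: Hmu.
Qed.

Lemma VkE f x : continuous f ->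
  Vk mu f x = Rintegral (mu x) (conv_orbit Rs x) (f : borelV R N -> R).
Proof.
move=> cf; rewrite /Vk /Rintegral; congr fine.
rewrite (@negligible_integral _ _ _ _ _ ((~` conv_orbit Rs x) : set (borelV R N))) //.
- by rewrite setTD setCK.
- by apply: measurableC; exact: conv_orbit_measurable.
- exact: integrable_continuous.
- exact: Hmu.
Qed.

Lemma Vk_cst c x : Vk mu (fun=> c) x = c.
Proof. by rewrite /Vk Rintegral_cst //= probability_setT mulr1. Qed.

Lemma VkD f g x : continuous f -> continuous g ->
  Vk mu (fun z => f z + g z) x = Vk mu f x + Vk mu g x.
Proof. by move=> cf cg; rewrite /Vk RintegralD //; exact: integrable_continuous. Qed.

Lemma VkB f g x : continuous f -> continuous g ->
  Vk mu (fun z => f z - g z) x = Vk mu f x - Vk mu g x.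
Proof. by move=> cf cg; rewrite /Vk RintegralB //; exact: integrable_continuous. Qed.

Lemma VkZ c f x : continuous f -> Vk mu (fun z => c * f z) x = c * Vk mu f x.
Proof. by move=> cf; rewrite /Vk RintegralZl //; exact: integrable_continuous. Qed.

Lemma ler_Vk f g x : continuous f -> continuous g ->
  (forall z, dotp z z <= dotp x x -> f z <= g z) -> Vk mu f x <= Vk mu g x.
Proof.
move=> cf cg H; rewrite !VkE //; apply: le_Rintegral.
- exact: conv_orbit_measurable.
- exact: integrable_conv_orbit.
- exact: integrable_conv_orbit.
by move=> z /(conv_orbit_ball Hrs); exact: H.
Qed.

Lemma Vk_dist f g x eps : continuous f -> continuous g ->
  (forall z, dotp z z <= dotp x x -> `|f z - g z| <= eps) -> `|Vk mu f x - Vk mu g x| <= eps.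
Proof.
move=> cf cg H.
have cB : continuous (fun z => f z - g z) by move=> z; exact: (cvgB (cf z) (cg z)).
have cC (c : R) : continuous (fun _ : vec => c) by move=> z; exact: cst_continuous.
rewrite -VkB // ler_norml -[X in X <= _](Vk_cst _ x) -[X in _ && (_ <= X)](Vk_cst _ x).
by apply/andP; split; apply: ler_Vk => // z /H; rewrite ler_norml => /andP[].
Qed.

(* g is uniformly continuous on compacts, so the inner integral is continuous in x. *)
Lemma Vk_shift_continuous g y : continuous g -> continuous (fun x => Vk mu (fun z => g (x + z)) y).
Proof.
move=> cg x.
have cs (u : vec) := @shift_continuous R N g u cg.
pose rho := (`|dotp x x| + 1) + (`|dotp y y| + 1).
apply/(@cvgrPdist_le _ _ _ (nbhs x) (nbhs_filter x)) => /= e e0.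
have [d d0 Hd] := cube_unif_continuous rho cg e0.
apply: (@filterS _ (nbhs x) _ (ball x d)); last exact: nbhsx_ballx.
move=> x' bx.
apply: Vk_dist; [exact: cs | exact: cs |] => z Hz.
apply: Hd => i.
  by rewrite mxE (le_trans (ler_normD _ _)) // lerD // coord_le.
rewrite !mxE opprD addrACA subrr addr0.
by case: bx => _; exact.
Qed.

(** The translate only sees g at points u + z with |u| <= |x| and |z| <= |y|, where |u + z|^2 <= 2
    (|x|^2 + |y|^2). *)
Lemma dtrans_dist g p x y r eps : continuous g -> continuous p ->
  (forall z, dotp z z <= r -> `|g z - p z| <= eps) -> 2 * (dotp x x + dotp y y) <= r ->
  `|dtrans mu g x y - dtrans mu p x y| <= eps.
Proof.
move=> cg cp H Hr.
have cs := @shift_continuous R N.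
apply: Vk_dist; [exact: Vk_shift_continuous | exact: Vk_shift_continuous |] => u Hu.
apply: Vk_dist; [exact: cs | exact: cs |] => z Hz.
apply: H; apply: le_trans Hr.
have := dotp_ge0 (u - z); rewrite dotpBr !dotpBl dotpDr !dotpDl (dotpC z u); lra.
Qed.

End VkContinuous.

(** * The measure operator as an intertwining operator on polynomials *)

Section VkIntertwining.
Context {R : realType} {N : nat}.
Local Notation vec := 'rV[R]_N.
Variables (Rs Rp : seq vec) (k : vec -> R) (mu : vec -> probability (borelV R N) R).
Hypotheses (Hrs : reduced_root_system Rs) (Hps : positive_subsystem Rs Rp)
  (Hmu : forall x, mu x (~` conv_orbit Rs x) = 0%E) (HV : intertwiner Rp k (Vk mu)).

Lemma polyf_Vk f : polyf f -> polyf (Vk mu f).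
Proof.
move=> pf; have [I [e [F [HF fE]]]] := polyf_graded pf.
have pF i : polyf (F i) by case: (HF i).
have -> : Vk mu f = fun x => \sum_(i <- enum I) Vk mu (F i) x.
  apply/funext => x; rewrite (_ : f = fun x => \sum_(i <- enum I) F i x); last first.
    by apply/funext => z; rewrite fE big_enum.
  elim: (enum I) => [|i s IH].
    by rewrite big_nil -[RHS](Vk_cst mu 0 x); congr Vk; apply/funext => z; rewrite big_nil.
  rewrite big_cons -IH -(VkD Hrs Hmu).
  - by congr Vk; apply/funext => z; rewrite big_cons.
  - exact: polyf_continuous.
  - by apply: polyf_continuous; exact: polyf_sum.
apply: polyf_sum => i _; case: HV => Hh _ _.
by case: (HF i) => pi hi; case: (homog_poly_polyf (Hh _ _ (hom_homog_poly pi hi))).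
Qed.

Lemma Vk_intertwining : intertwining Rp k (Vk mu).
Proof.
have [Hh H1 HT] := HV; have pc := @polyf_continuous R N.
split.
- by move=> f g x pf pg; rewrite (VkD Hrs Hmu) //; exact: pc.
- by move=> c f x pf; rewrite (VkZ Hrs Hmu) //; exact: pc.
- exact/funext.
- exact: polyf_Vk.
- by move=> m f pf hf; case: (homog_poly_polyf (Hh _ _ (hom_homog_poly pf hf))).
- move=> f y pf f0; rewrite -(Vk_cst mu 0 y); apply: (ler_Vk Hrs Hmu) => //; last exact: pc.
  by move=> z; exact: cst_continuous.
move=> xi f x pf; apply/eqP; rewrite -subr_eq0; apply/eqP; move: x.
have [b Hb] := generic_point Hps.
have pV := polyf_Vk pf; have pd := polyf_dd xi pf; have pVd := polyf_Vk pd.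
have pT := polyf_T k Hrs Hps xi pV.
(* The relation is given off the hyperplanes; multiplied by the product of all <a, x> it holds
   everywhere, and this product is cancelled because it is nonzero at the generic point b. *)
apply: (@polyf_integral _ _ _ (fun x => \prod_(a <- Rp) dotp a x) b).
- exact: polyfB.
- by apply: polyf_prod => a _; exact: polyf_dotp.
- by rewrite prodf_seq_neq0; apply/allP => a /Hb.
move=> x; have [H|] := pselect (forall a, a \in Rp -> dotp a x != 0).
  rewrite -(dunklE k Hrs Hps) // HT //; last exact: poly_fun_polyf.
  by rewrite (_ : dd xi f = fun y => 'D_xi f y) ?subrr ?mul0r //; apply/funext => y; rewrite ddE.
move=> /existsNP [a /not_implyP [aP /negP]]; rewrite negbK => /eqP ax.
by rewrite (big_rem a) //= ax mul0r mulr0.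
Qed.

End VkIntertwining.

(** * Iterated Lebesgue integrals *)

Section LebintMeasurable.
Context {R : realType}.

(* Measurability along every measurable parametrization of the coordinates: no sigma-algebra
   on row vectors has to be compared with the iterated product structure of [lebint]. *)
Definition pmeas n (F : 'rV[R]_n -> R) : Prop :=
  forall d (T : measurableType d) (phi : 'I_n -> T -> R),
    (forall i, measurable_fun setT (phi i)) ->
    measurable_fun setT (fun t => F (\row_i phi i t)).

(** Version with a parameter: integrating out the first coordinate moves it into the parameter,
    which carries the induction in [lebint_measurable]. *)
Definition jmeas d (T : measurableType d) n (G : T -> 'rV[R]_n -> R) : Prop :=
  forall d' (T' : measurableType d') (psi : T' -> T) (phi : 'I_n -> T' -> R),
    measurable_fun setT psi -> (forall i, measurable_fun setT (phi i)) ->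
    measurable_fun setT (fun t => G (psi t) (\row_i phi i t)).

Definition consv n (c : R) (v : 'rV[R]_n) : 'rV[R]_n.+1 := row_mx (const_mx c : 'rV_1) v.

Lemma consv0 n c (v : 'rV[R]_n) : consv c v ord0 ord0 = c.
Proof.
have := @row_mxEl R 1 1 n (const_mx c) v ord0 ord0; rewrite [RHS]mxE => E; rewrite -[RHS]E.
by congr (fun_of_matrix _ _ _); apply: val_inj.
Qed.

Lemma consvS n c (v : 'rV[R]_n) i : consv c v ord0 (lift ord0 i) = v ord0 i.
Proof.
have E := @row_mxEr R 1 1 n (const_mx c) v ord0 i; rewrite -[RHS]E.
by congr (fun_of_matrix _ _ _); apply: val_inj.
Qed.

Lemma consvZ n s c (v : 'rV[R]_n) : s *: consv c v = consv (s * c) (s *: v).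
Proof.
apply/rowP => i; rewrite mxE; case: (unliftP ord0 i) => [j|] ->.
  by rewrite !consvS mxE.
by rewrite !consv0.
Qed.

Lemma dotp_consv n c (v : 'rV[R]_n) : dotp (consv c v) (consv c v) = c ^+ 2 + dotp v v.
Proof.
rewrite /dotp big_ord_recl consv0 expr2; congr (_ + _).
by apply: eq_bigr => i _; rewrite consvS.
Qed.

Lemma lebintS n (F : 'rV[R]_n.+1 -> R) :
  lebint F = Rintegral (@lebesgue_measure R) setT (fun c : R => lebint (fun v => F (consv c v))).
Proof. by []. Qed.

Lemma jmeas_consv d (T : measurableType d) n (G : T -> 'rV[R]_n.+1 -> R) : jmeas G ->
  jmeas (fun (tc : T * R) v => G tc.1 (consv tc.2 v)).
Proof.
move=> mG d' T' psi phi mpsi mphi.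
pose phi' (i : 'I_n.+1) t := if unlift ord0 i is Some j then phi j t else (psi t).2.
have E t : consv (psi t).2 (\row_i phi i t) = \row_i phi' i t.
  apply/rowP => i; rewrite mxE /phi'; case: (unliftP ord0 i) => [j|] ->.
    by rewrite consvS mxE.
  by rewrite consv0.
rewrite (_ : (fun t => _) = fun t => G (psi t).1 (\row_i phi' i t)); last first.
  by apply/funext => t; rewrite E.
apply: mG; first exact: measurableT_comp measurable_fst mpsi.
move=> i; rewrite /phi'; case: unliftP => [j|] _; first exact: mphi.
exact: measurableT_comp measurable_snd mpsi.
Qed.

(** Tonelli's theorem is applied to the positive and negative parts separately. *)
Lemma measurable_Rintegral2 d (T : measurableType d) (H : T * R -> R) : measurable_fun setT H ->
  measurable_fun setT (fun t => Rintegral (@lebesgue_measure R) setT (fun c => H (t, c))).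
Proof.
move=> mH.
have mE : measurable_fun setT (EFin \o H) by exact/measurable_EFinP.
rewrite (_ : (fun t => _) = fine \o (fun t =>
   fubini_F (@lebesgue_measure R) (EFin \o H)^\+ t - fubini_F (@lebesgue_measure R) (EFin \o H)^\- t)%E).
  apply: measurableT_comp; first exact: fine_measurable.
  apply: emeasurable_funB.
    apply: measurable_fun_fubini_tonelli_F; first exact: measurable_funepos.
    by move=> x; exact: funepos_ge0.
  apply: measurable_fun_fubini_tonelli_F; first exact: measurable_funeneg.
  by move=> x; exact: funeneg_ge0.
apply/funext => t /=; rewrite /Rintegral integralE /fubini_F.
by congr (fine (_ - _)%E); apply: eq_integral => c _; rewrite ?funeposE ?funenegE.
Qed.

Lemma lebint_measurable n : forall d (T : measurableType d) (G : T -> 'rV[R]_n -> R), jmeas G ->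
  measurable_fun setT (fun t => lebint (G t)).
Proof.
elim: n => [|n IH] d T G mG.
  rewrite /= (_ : (fun t => _) = fun t => G t (\row_i (0 : 'I_0 -> T -> R) i t)).
    by apply: (mG _ _ id) => [|[]] //.
  by apply/funext => t; congr (G t); apply/rowP => -[].
apply: (@measurable_Rintegral2 _ T (fun tc => lebint (fun v => G tc.1 (consv tc.2 v)))).
by apply: IH; exact: jmeas_consv.
Qed.

Lemma pmeas_slice n (F : 'rV[R]_n.+1 -> R) : pmeas F -> measurable_fun setT (fun c => lebint (fun v => F (consv c v))).
Proof.
move=> mF; apply: lebint_measurable.
have jF : jmeas (fun (_ : R) => F) by move=> d T psi phi _; exact: mF.
move=> d T psi phi mpsi mphi.
apply: (@jmeas_consv _ R n (fun=> F) jF _ T (fun t => (0 : R, psi t)) phi) => //.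
by apply: measurable_fun_pair => //; exact: measurable_cst.
Qed.

Lemma pmeas_consv n c (F : 'rV[R]_n.+1 -> R) : pmeas F -> pmeas (fun v => F (consv c v)).
Proof.
move=> mF d T phi mphi.
have jF : jmeas (fun (_ : R) => F) by move=> d' T' psi phi' _; exact: mF.
apply: (@jmeas_consv _ R n (fun=> F) jF _ T (fun=> (0 : R, c)) phi) => //.
Qed.

Lemma pmeasP1 (f : R -> R) n (F : 'rV[R]_n -> R) : measurable_fun setT f -> pmeas F -> pmeas (fun y => f (F y)).
Proof. move=> mf mF d T phi mphi; exact: measurableT_comp mf (mF _ _ _ mphi). Qed.

Lemma pmeas_cst n c : pmeas (fun _ : 'rV[R]_n => c).
Proof. by move=> d T phi _; exact: measurable_cst. Qed.

Lemma pmeas_coord n i : pmeas (fun y : 'rV[R]_n => y ord0 i).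
Proof.
move=> d T phi mphi; rewrite (_ : (fun t => _) = phi i) //.
by apply/funext => t; rewrite mxE.
Qed.

Lemma pmeasD n (F G : 'rV[R]_n -> R) : pmeas F -> pmeas G -> pmeas (fun y => F y + G y).
Proof. by move=> mF mG d T phi mphi; apply: measurable_funD; [exact: mF | exact: mG]. Qed.

Lemma pmeasM n (F G : 'rV[R]_n -> R) : pmeas F -> pmeas G -> pmeas (fun y => F y * G y).
Proof. by move=> mF mG d T phi mphi; apply: measurable_funM; [exact: mF | exact: mG]. Qed.

Lemma pmeasZ n c (F : 'rV[R]_n -> R) : pmeas F -> pmeas (fun y => c * F y).
Proof. by move=> mF; apply: pmeasM => //; exact: pmeas_cst. Qed.

Lemma pmeas_polyf n (f : 'rV[R]_n -> R) : polyf f -> pmeas f.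
Proof.
elim=> [c|i|g h _ mg _ mh|g h _ mg _ mh].
- exact: pmeas_cst.
- exact: pmeas_coord.
- exact: pmeasD.
- exact: pmeasM.
Qed.

Lemma pmeas_prod n I (s : seq I) (F : I -> 'rV[R]_n -> R) : (forall i, pmeas (F i)) ->
  pmeas (fun y => \prod_(i <- s) F i y).
Proof.
move=> mF; elim: s => [|i s IH].
  rewrite (_ : (fun y => _) = fun=> 1); first exact: pmeas_cst.
  by apply/funext => y; rewrite big_nil.
rewrite (_ : (fun y => _) = fun y => F i y * \prod_(j <- s) F j y); first exact: pmeasM.
by apply/funext => y; rewrite big_cons.
Qed.

Lemma pmeas_comp m n (F : 'rV[R]_n -> R) (A : 'rV[R]_m -> 'rV[R]_n) : pmeas F ->
  (forall i, pmeas (fun y => A y ord0 i)) -> pmeas (fun y => F (A y)).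
Proof.
move=> mF mA d T phi mphi.
rewrite (_ : (fun t => _) = fun t => F (\row_i A (\row_j phi j t) ord0 i)).
  by apply: mF => i; exact: mA.
by apply/funext => t; congr F; apply/rowP => i; rewrite mxE.
Qed.

Lemma pmeas_scale n s (F : 'rV[R]_n -> R) : pmeas F -> pmeas (fun y => F (s *: y)).
Proof.
move=> mF; apply: pmeas_comp => // i.
rewrite (_ : (fun y => _) = fun y : 'rV[R]_n => s * y ord0 i); first by apply: pmeasZ; exact: pmeas_coord.
by apply/funext => y; rewrite mxE.
Qed.

Lemma pmeas_ite n (q F : 'rV[R]_n -> R) c : pmeas q -> pmeas F -> pmeas (fun y => if q y <= c then F y else 0).
Proof.
move=> mq mF.
rewrite (_ : (fun y => _) = fun y => \1_(`]-oo, c]%classic) (q y) * F y); last first.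
  apply/funext => y; rewrite indicE mem_setE in_itv /=.
  by case: (_ <= _); rewrite ?mul1r ?mul0r.
apply: pmeasM => //; apply: pmeasP1 mq.
exact: measurable_indic.
Qed.

Lemma pmeas_lim n (F : nat -> 'rV[R]_n -> R) (G : 'rV[R]_n -> R) : (forall j, pmeas (F j)) ->
  (forall y, F ^~ y @ \oo --> G y) -> pmeas G.
Proof.
move=> mF FG d T phi mphi.
apply: (@measurable_fun_cvg _ _ _ setT (fun j t => F j (\row_i phi i t))).
  by move=> j; exact: mF.
by move=> t _; exact: FG.
Qed.

End LebintMeasurable.

(** * Linearity, monotonicity and bounds for the iterated integral *)

Section LebintLinear.
Context {R : realType}.

Definition bsupp n (r B : R) (F : 'rV[R]_n -> R) : Prop :=
  (forall y, `|F y| <= B) /\ (forall (y : 'rV[R]_n) i, r < `|y ord0 i| -> F y = 0).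

(** Measurable, bounded and of bounded support. The support is measured coordinate by coordinate so
    that the class is stable under fixing a coordinate; [lebint_bound] makes the partial integrals
    admissible again. *)
Definition adm n (F : 'rV[R]_n -> R) : Prop :=
  pmeas F /\ exists r B, 0 <= r /\ bsupp r B F.

Definition adm1 (f : R -> R) : Prop :=
  measurable_fun setT f /\ exists r B, 0 <= r /\ forall c, `|f c| <= B /\ (r < `|c| -> f c = 0).

Lemma restrict_bsupp1 (f : R -> R) r : (forall c, r < `|c| -> f c = 0) -> f \_ `[- r, r] = f.
Proof.
move=> Hf; apply/funext => c; rewrite patchE; case: ifPn => //.
by rewrite mem_setE in_itv /= -ler_norml -ltNge => /Hf.
Qed.

Lemma segment_fin (a b : R) : (@lebesgue_measure R `[a, b]%classic < +oo)%E.
Proof. by rewrite lebesgue_measure_itv /=; case: ifP => _ //; rewrite -EFinB ltry. Qed.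

Lemma segment_len (a b : R) : a <= b -> fine (@lebesgue_measure R `[a, b]%classic) = b - a.
Proof.
rewrite lebesgue_measure_itv /= lte_fin le_eqVlt => /predU1P[-> | ab].
  by rewrite ltxx subrr.
by rewrite ab.
Qed.

Lemma adm1_integrable f : adm1 f -> (@lebesgue_measure R).-integrable setT (EFin \o f).
Proof.
move=> [mf [r [B [r0 Hf]]]].
rewrite -(restrict_bsupp1 (fun c => (Hf c).2)) -restrict_EFin.
apply: (proj1 (@integrable_mkcond _ _ _ (@lebesgue_measure R) `[- r, r] (EFin \o f) _)) => //.
apply: measurable_bounded_integrable => //.
- exact: segment_fin.
- exact: measurable_funTS.
exists B; split; first exact: num_real.
by move=> M BM c _ /=; rewrite (le_trans (Hf c).1) // ltW.
Qed.

Lemma adm1_bound (f : R -> R) (r B : R) : measurable_fun setT f -> 0 <= r ->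
  (forall c, `|f c| <= B /\ (r < `|c| -> f c = 0)) ->
  `|Rintegral (@lebesgue_measure R) setT f| <= 2 * r * B.
Proof.
move=> mf r0 Hf; have af : adm1 f by split=> //; exists r, B.
have iS : measurable (`[- r, r] : set R) by [].
have i1 := adm1_integrable af.
rewrite -(restrict_bsupp1 (fun c => (Hf c).2)) -Rintegral_mkcond.
have i2 : (@lebesgue_measure R).-integrable `[- r, r] (EFin \o f) by apply: integrableS i1.
have fin := segment_fin (- r) r.
apply: le_trans; first by apply: le_normr_Rintegral; [exact: iS | exact: i2].
apply: (@le_trans _ _ (Rintegral (@lebesgue_measure R) `[- r, r] (fun=> B))).
  apply: le_Rintegral => //; first by apply: integrable_norm.
    apply: measurable_bounded_integrable => //.
    by exists `|B|; split; [exact: num_real | move=> M BM c _ /=; exact: ltW].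
  by move=> c _; case: (Hf c).
rewrite Rintegral_cst // (_ : fine _ = r - - r); last by apply: segment_len; lra.
by rewrite mulrC opprK -mulr2n mulr_natl.
Qed.

Lemma lebint0 n : lebint (fun _ : 'rV[R]_n => 0) = 0 :> R.
Proof.
elim: n => [//|n IH]; rewrite lebintS.
by under eq_Rintegral do rewrite IH; rewrite Rintegral_cst // mul0r.
Qed.

Lemma bsupp_consv n r B c (F : 'rV[R]_n.+1 -> R) : bsupp r B F -> bsupp r B (fun v => F (consv c v)).
Proof. by move=> [H1 H2]; split=> // v i Hi; apply: (H2 _ (lift ord0 i)); rewrite consvS. Qed.

Lemma lebint_consv_supp n r B c (F : 'rV[R]_n.+1 -> R) : bsupp r B F -> r < `|c| ->
  lebint (fun v => F (consv c v)) = 0.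
Proof.
move=> [_ H2] rc; rewrite -[RHS](lebint0 n); congr lebint; apply/funext => v.
by apply: (H2 _ ord0); rewrite consv0.
Qed.

Lemma lebint_bound n r B (F : 'rV[R]_n -> R) : pmeas F -> 0 <= r -> bsupp r B F ->
  `|lebint F| <= (2 * r) ^+ n * B.
Proof.
elim: n F => [|n IH] F mF r0 sF; first by rewrite mul1r; case: sF => H _; exact: H.
rewrite exprS -mulrA lebintS; apply: adm1_bound => //; first exact: pmeas_slice.
move=> c; split; last exact: lebint_consv_supp sF.
by apply: IH => //; [exact: pmeas_consv | exact: bsupp_consv].
Qed.

Lemma adm_consv n c (F : 'rV[R]_n.+1 -> R) : adm F -> adm (fun v => F (consv c v)).
Proof.
move=> [mF [r [B [r0 sF]]]]; split; first exact: pmeas_consv.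
by exists r, B; split=> //; exact: bsupp_consv.
Qed.

Lemma adm_slice n (F : 'rV[R]_n.+1 -> R) : adm F -> adm1 (fun c => lebint (fun v => F (consv c v))).
Proof.
move=> [mF [r [B [r0 sF]]]]; split; first exact: pmeas_slice.
exists r, ((2 * r) ^+ n * B); split=> // c; split; last exact: lebint_consv_supp sF.
by apply: lebint_bound => //; [exact: pmeas_consv | exact: bsupp_consv].
Qed.

Lemma admD n (F G : 'rV[R]_n -> R) : adm F -> adm G -> adm (fun y => F y + G y).
Proof.
move=> [mF [r [B [r0 [F1 F2]]]]] [mG [s [C [s0 [G1 G2]]]]]; split; first exact: pmeasD.
exists (r + s), (B + C); split; first exact: addr_ge0.
split=> [y|y i Hi]; first by rewrite (le_trans (ler_normD _ _)) // lerD.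
by rewrite (F2 y i) ?(G2 y i) ?addr0 //; apply: le_lt_trans Hi; rewrite ?lerDl ?lerDr.
Qed.

Lemma admZ n c (F : 'rV[R]_n -> R) : adm F -> adm (fun y => c * F y).
Proof.
move=> [mF [r [B [r0 [F1 F2]]]]]; split; first exact: pmeasZ.
exists r, (`|c| * B); split=> //; split=> [y|y i Hi]; first by rewrite normrM ler_wpM2l.
by rewrite (F2 y i Hi) mulr0.
Qed.

Lemma lebintD n (F G : 'rV[R]_n -> R) : adm F -> adm G ->
  lebint (fun y => F y + G y) = lebint F + lebint G.
Proof.
elim: n F G => [//|n IH] F G aF aG; rewrite !lebintS.
under eq_Rintegral => c _ do rewrite (IH _ _ (@adm_consv n c F aF) (@adm_consv n c G aG)).
by rewrite RintegralD //; apply: adm1_integrable; exact: adm_slice.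
Qed.

Lemma lebintZ n c (F : 'rV[R]_n -> R) : adm F -> lebint (fun y => c * F y) = c * lebint F.
Proof.
elim: n F => [//|n IH] F aF; rewrite !lebintS.
under eq_Rintegral => x _ do rewrite (IH _ (@adm_consv n x F aF)).
by rewrite RintegralZl //; apply: adm1_integrable; exact: adm_slice.
Qed.

Lemma lebintB n (F G : 'rV[R]_n -> R) : adm F -> adm G ->
  lebint (fun y => F y - G y) = lebint F - lebint G.
Proof.
move=> aF aG; rewrite -mulN1r -lebintZ // -lebintD //; last exact: admZ.
by congr lebint; apply/funext => y; rewrite mulN1r.
Qed.

Lemma ler_lebint n (F G : 'rV[R]_n -> R) : adm F -> adm G ->
  (forall y, F y <= G y) -> lebint F <= lebint G.
Proof.
elim: n F G => [|n IH] F G aF aG FG; first exact: FG.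
rewrite !lebintS; apply: le_Rintegral => //; try by apply: adm1_integrable; exact: adm_slice.
by move=> c _; apply: IH => //; exact: adm_consv.
Qed.

End LebintLinear.

(** s times the image of Lebesgue measure under x -> s x agrees with Lebesgue measure on half-open
    intervals, hence on all measurable sets. *)
Lemma integral_scale (R : realType) (s : R) (f : R -> \bar R) : 0 < s -> measurable_fun setT f ->
  (forall x, (0 <= f x)%E) ->
  (\int[@lebesgue_measure R]_x f x = s%:E * \int[@lebesgue_measure R]_x f (s * x)%R)%E.
Proof.
move=> s0 mf f0.
have mphi : measurable_fun setT (fun x : measurableTypeR R => s * x : measurableTypeR R).
  exact: mulrl_measurable.
pose nu : {measure set (measurableTypeR R) -> \bar R} := mscale (NngNum (ltW s0)) (measure_function_pushforward__canonical__measure_function_Measure (@lebesgue_measure R) mphi).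
have E A : measurable A -> @lebesgue_measure R A = nu A.
  apply: lebesgue_measure_unique => _ [[a b] _ <-].
  rewrite /nu /= /mscale /=.
  rewrite (_ : pushforward _ _ _ = @lebesgue_measure R `]a / s, b / s]%classic); last first.
    congr (lebesgue_measure _); by apply/seteqP; split=> x /=; rewrite !in_itv /= ltr_pdivrMr // ler_pdivlMr // mulrC.
  rewrite !lebesgue_measure_itv /= !lte_fin ltr_pM2r ?invr_gt0 //.
  case: ifP => _; last by rewrite mule0.
  by rewrite -!EFinB -EFinM; congr (_%:E); field; rewrite gt_eqF.
rewrite (eq_measure_integral nu); last by move=> A mA _; exact: E.
rewrite ge0_integral_mscale //=; congr (_ * _)%E.
exact: (ge0_integral_pushforward mphi).
Qed.

Lemma adm1_scale (R : realType) (s : R) (f : R -> R) : 0 < s -> adm1 f -> adm1 (fun c => f (s * c)).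
Proof.
move=> s0 [mf [r [B [r0 Hf]]]]; split.
  by apply: (measurableT_comp mf); exact: mulrl_measurable.
exists (r / s), B; split=> [|c]; first by rewrite divr_ge0 // ltW.
split; first by case: (Hf (s * c)).
rewrite ltr_pdivrMr // => H; apply: (Hf _).2.
by rewrite normrM gtr0_norm // mulrC.
Qed.

Lemma Rintegral_scale (R : realType) (s : R) (f : R -> R) : 0 < s -> adm1 f ->
  Rintegral (@lebesgue_measure R) setT f = s * Rintegral (@lebesgue_measure R) setT (fun c => f (s * c)).
Proof.
move=> s0 af; have ag := adm1_scale s0 af.
have i1 := adm1_integrable af; have i2 := adm1_integrable ag.
have mE : measurable_fun setT (EFin \o f) by case: af => mf _; exact/measurable_EFinP.
rewrite /Rintegral integralE [in RHS]integralE.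
rewrite (integral_scale s0 (measurable_funepos mE)); last by move=> x; exact: funepos_ge0.
rewrite (integral_scale s0 (measurable_funeneg mE)); last by move=> x; exact: funeneg_ge0.
have pE : (\int[@lebesgue_measure R]_x (EFin \o f)^\+ (s * x)%R = \int[@lebesgue_measure R]_x (EFin \o (fun c : R => f (s * c)%R))^\+ x)%E.
  by apply: eq_integral => x _; rewrite !funeposE.
have nE : (\int[@lebesgue_measure R]_x (EFin \o f)^\- (s * x)%R = \int[@lebesgue_measure R]_x (EFin \o (fun c : R => f (s * c)%R))^\- x)%E.
  by apply: eq_integral => x _; rewrite !funenegE.
rewrite pE nE.
have /fineK <- := integrable_fin_num measurableT (integrable_funepos measurableT i2).
have /fineK <- := integrable_fin_num measurableT (integrable_funeneg measurableT i2).
by rewrite -!EFinM -!EFinB /= mulrBr.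
Qed.

Lemma adm_scale (R : realType) (s : R) n (F : 'rV[R]_n -> R) : 0 < s -> adm F -> adm (fun v => F (s *: v)).
Proof.
move=> s0 [mF [r [B [r0 [F1 F2]]]]]; split; first exact: pmeas_scale.
exists (r / s), B; split; first by rewrite divr_ge0 // ltW.
split=> // y i; rewrite ltr_pdivrMr // => H; apply: (F2 _ i).
by rewrite mxE normrM gtr0_norm // mulrC.
Qed.

Lemma lebint_scale (R : realType) (s : R) n (F : 'rV[R]_n -> R) : 0 < s -> adm F ->
  lebint F = s ^+ n * lebint (fun v => F (s *: v)).
Proof.
move=> s0; elim: n F => [|n IH] F aF.
  by rewrite expr0 mul1r /=; congr F; apply/rowP => -[].
rewrite lebintS (Rintegral_scale s0) ?[in RHS]lebintS; last exact: adm_slice.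
rewrite exprS -mulrA; congr (_ * _).
have aS := adm_slice (adm_scale s0 aF).
rewrite -RintegralZl //; last exact: adm1_integrable.
apply: eq_Rintegral => c _; rewrite (IH _ (@adm_consv _ _ (s * c) _ aF)).
by congr (_ * lebint _); apply/funext => v; rewrite consvZ.
Qed.

(** * Ball and sphere integrals *)

Section SemicircleMoments.
Context {R : realType}.
Implicit Types (x : R) (p q : nat).

(** Radius of the slice of the unit ball at height x. *)
Definition wb x : R := Num.sqrt (1 - x ^+ 2).

Lemma wb_sq x : -1 <= x <= 1 -> wb x ^+ 2 = 1 - x ^+ 2.
Proof. by move=> xI; rewrite sqr_sqrtr //; nra. Qed.

Lemma wb_continuous p q : continuous (fun x => x ^+ p * wb x ^+ q).
Proof.
move=> x; apply: cvgM; first exact: exprn_continuous.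
apply: (@continuous_comp _ _ _ wb (fun t => t ^+ q)); last exact: exprn_continuous.
apply: (@continuous_comp _ _ _ (fun t : R => 1 - t ^+ 2) Num.sqrt); last exact: sqrt_continuous.
by apply: cvgB; [exact: cvg_cst | exact: exprn_continuous].
Qed.

Lemma is_derive_wb x : -1 < x < 1 -> is_derive x 1 wb (- x / wb x).
Proof.
move=> xI; have x0 : 0 < 1 - x ^+ 2 by nra.
have H1 : is_derive x 1 (fun t : R => 1 - t ^+ 2) (- (2 * x)).
  apply: is_derive_eq; rewrite /GRing.scale /= !mulr1.
  by ring.
have H2 := is_derive1_sqrt x0.
have := @is_derive1_comp R Num.sqrt (fun t : R => 1 - t ^+ 2) x _ _ H2 H1.
have w0 : wb x != 0 by rewrite gt_eqF // sqrtr_gt0.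
by move=> H; apply: (is_derive_eq H); rewrite /= -/(wb x); field.
Qed.

Lemma is_derive_wb_moment p q x : -1 < x < 1 ->
  is_derive x 1 (fun t => t ^+ p * wb t ^+ q.+2)
    (p%:R * (x ^+ p.-1 * wb x ^+ q.+2) - q.+2%:R * (x ^+ p.+1 * wb x ^+ q)).
Proof.
move=> xI; have H := is_derive_wb xI.
have w0 : wb x != 0 by rewrite gt_eqF // sqrtr_gt0; nra.
have Hw : is_derive x 1 (fun t => wb t ^+ q.+2) (q.+2%:R * wb x ^+ q.+1 * (- x / wb x)).
  have := @is_deriveX R R wb q.+2 x 1 _ H.
  by rewrite (_ : wb ^+ q.+2 = fun t => wb t ^+ q.+2) //; apply/funext => t; rewrite fctE.
have Hp : is_derive x 1 (fun t : R => t ^+ p) (p%:R * x ^+ p.-1).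
  have := @is_deriveX R R id p x 1 _ (is_derive_id _ _).
  by rewrite (_ : id ^+ p = fun t : R => t ^+ p) /=; [rewrite /GRing.scale /= mulr1 | apply/funext => t; rewrite fctE].
have := is_deriveM Hp Hw.
move=> HM; apply: (is_derive_eq HM); rewrite /GRing.scale /= [wb x ^+ q.+2]exprS [wb x ^+ q.+1]exprS [x ^+ p.+1]exprS.
by field.
Qed.

Definition Iw p q : R := Rintegral (@lebesgue_measure R) `[-1, 1] (fun x => x ^+ p * wb x ^+ q).

Lemma wb_integrable p q : (@lebesgue_measure R).-integrable `[-1, 1] (EFin \o (fun x : R => x ^+ p * wb x ^+ q)).
Proof.
apply: continuous_compact_integrable; first exact: segment_compact.
by apply: continuous_subspaceT; exact: wb_continuous.
Qed.

Lemma Iw_lower p q : Iw p q.+2 = Iw p q - Iw p.+2 q.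
Proof.
rewrite /Iw -RintegralB //; try exact: wb_integrable.
apply: eq_Rintegral => x; rewrite inE /= in_itv /= => xI.
by rewrite -addn2 exprD wb_sq // -[p.+2]addn2 exprD; ring.
Qed.

(** The fundamental theorem of calculus for x^p wb(x)^(q+2), which vanishes at both ends. The
    derivative is used only in the open interval, as wb is not differentiable at the ends. *)
Lemma Iw_parts p q : q.+2%:R * Iw p.+1 q = p%:R * Iw p.-1 q.+2.
Proof.
pose f (x : R) := p%:R * (x ^+ p.-1 * wb x ^+ q.+2) - q.+2%:R * (x ^+ p.+1 * wb x ^+ q).
pose F (x : R) := x ^+ p * wb x ^+ q.+2.
have cZ (c : R) a b : continuous (fun x : R => c * (x ^+ a * wb x ^+ b)).
  by move=> x; apply: cvgM; [exact: cst_continuous | exact: wb_continuous].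
have cf : continuous f by move=> x; exact: (cvgB (cZ _ _ _ x) (cZ _ _ _ x)).
have dF : derivable_oo_LRcontinuous F (-1) 1.
  split.
  - by move=> x; rewrite in_itv /= => /(is_derive_wb_moment p q) [].
  - by apply: cvg_at_right_filter; exact: wb_continuous.
  - by apply: cvg_at_left_filter; exact: wb_continuous.
have F'f : {in `]-1, 1[, derive1 F =1 f}.
  move=> x; rewrite in_itv /= => /(is_derive_wb_moment p q) H.
  by rewrite derive1E; exact: derive_val.
have n11 : (-1 : R) < 1 by lra.
have := continuous_FTC2 n11 (continuous_subspaceT cf) dF F'f.
have wE x : x ^+ 2 = 1 -> F x = 0.
  by move=> x1; rewrite /F /wb x1 subrr sqrtr0 expr0n mulr0.
rewrite !wE ?expr1n ?sqrrN ?expr1n // subee //.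
move=> /(congr1 fine) /= E.
have : Rintegral (@lebesgue_measure R) `[-1, 1] f = 0 by exact: E.
rewrite /f RintegralB //; first last.
- by apply: continuous_compact_integrable; [exact: segment_compact | apply: continuous_subspaceT; exact: cZ].
- by apply: continuous_compact_integrable; [exact: segment_compact | apply: continuous_subspaceT; exact: cZ].
rewrite !RintegralZl //; try exact: wb_integrable.
by rewrite -/(Iw _ _) -/(Iw _ _) => /eqP; rewrite subr_eq0 => /eqP.
Qed.

Lemma Iw_rec p q : (p + q + 2)%:R * Iw p.+1 q = p%:R * Iw p.-1 q.
Proof.
have := Iw_parts p q; case: p => [|p] /=.
  by rewrite !mul0r add0n addn2.
by rewrite Iw_lower !natrD -[p.+1%:R]natr1 -[q.+2%:R]natr1 -[q.+1%:R]natr1; lra.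
Qed.

Lemma Iw_rec_weight p q : (p + q.+1 + 2)%:R * Iw p q.+2 = q.+2%:R * Iw p q.
Proof.
have := Iw_rec p.+1 q; rewrite Iw_lower !natrD -[p.+1%:R]natr1 -[q.+2%:R]natr1 -[q.+1%:R]natr1; lra.
Qed.

End SemicircleMoments.

(** * Monomial integrals over the unit ball *)

Section BallIntegral.
Context {R : realType}.

Definition bcut n (F : 'rV[R]_n -> R) (y : 'rV[R]_n) : R := if dotp y y <= 1 then F y else 0.
Definition bint n (F : 'rV[R]_n -> R) : R := lebint (bcut F).

Lemma adm_bcut n (F : 'rV[R]_n -> R) : pmeas F ->
  (exists B, forall y, dotp y y <= 1 -> `|F y| <= B) -> adm (bcut F).
Proof.
move=> mF [B HB]; split.
  by apply: pmeas_ite => //; apply: pmeas_polyf; exact: polyf_dotpp.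
exists 2, `|B|; split=> //; split=> [y|y i Hi]; rewrite /bcut; case: ifP => // y1.
- by rewrite (le_trans (HB y y1)) // ler_norm.
- by rewrite normr0.
by have := coord_le i y1; rewrite normr1; lra.
Qed.

Lemma adm_bcut_polyf n (f : 'rV[R]_n -> R) : polyf f -> adm (bcut f).
Proof. by move=> pf; apply: adm_bcut; [exact: pmeas_polyf | exact: polyf_bounded]. Qed.

Lemma bintD n (f g : 'rV[R]_n -> R) : polyf f -> polyf g -> bint (fun y => f y + g y) = bint f + bint g.
Proof.
move=> pf pg; rewrite /bint -lebintD; try exact: adm_bcut_polyf.
by congr lebint; apply/funext => y; rewrite /bcut; case: ifP => _; rewrite ?addr0.
Qed.

Lemma bintZ n c (f : 'rV[R]_n -> R) : polyf f -> bint (fun y => c * f y) = c * bint f.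
Proof.
move=> pf; rewrite /bint -lebintZ; last exact: adm_bcut_polyf.
by congr lebint; apply/funext => y; rewrite /bcut; case: ifP => _; rewrite ?mulr0.
Qed.

Lemma bint0 n : bint (fun _ : 'rV[R]_n => 0) = 0.
Proof. by rewrite -[RHS](@lebint0 R n) /bint; congr lebint; apply/funext => y; rewrite /bcut; case: ifP. Qed.

Lemma bint_sum n I (s : seq I) (f : I -> 'rV[R]_n -> R) : (forall i, polyf (f i)) ->
  bint (fun y => \sum_(i <- s) f i y) = \sum_(i <- s) bint (f i).
Proof.
move=> pf; elim: s => [|i s IH].
  by rewrite big_nil -[RHS](bint0 n); congr bint; apply/funext => y; rewrite big_nil.
rewrite big_cons -IH -bintD //; last exact: polyf_sum.
by congr bint; apply/funext => y; rewrite big_cons.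
Qed.

Definition mono n (a : 'I_n -> nat) (y : 'rV[R]_n) : R := \prod_i y ord0 i ^+ a i.

Lemma polyf_mono n (a : 'I_n -> nat) : polyf (mono a).
Proof. by apply: polyf_prod => i _; apply: polyf_exp; exact: polyf_coord. Qed.

Lemma mono_scale n (a : 'I_n -> nat) s y : mono a (s *: y) = s ^+ (\sum_i a i) * mono a y.
Proof.
rewrite /mono -prodrXr -big_split; apply: eq_bigr => i _ /=.
by rewrite mxE exprMn.
Qed.

Lemma mono_consv n (a : 'I_n.+1 -> nat) c v :
  mono a (consv c v) = c ^+ a ord0 * mono (fun i => a (lift ord0 i)) v.
Proof.
rewrite /mono big_ord_recl consv0; congr (_ * _).
by apply: eq_bigr => i _; rewrite consvS.
Qed.

(** The slice is scaled to the unit ball by its radius: the remaining exponents come from the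
    monomial, the additional n from the volume. *)
Lemma bint_slice n (a : 'I_n.+1 -> nat) c : -1 < c < 1 ->
  lebint (fun v => bcut (mono a) (consv c v)) =
  c ^+ a ord0 * wb c ^+ (\sum_i a (lift ord0 i) + n) * bint (mono (fun i => a (lift ord0 i))).
Proof.
move=> cI; set a' := fun i => a (lift ord0 i).
have c1 : 0 < 1 - c ^+ 2 by nra.
have w0 : 0 < wb c by rewrite sqrtr_gt0.
have w2 : wb c ^+ 2 = 1 - c ^+ 2 by apply: wb_sq; lra.
have aS : adm (fun v => bcut (mono a) (consv c v)).
  by apply: adm_consv; apply: adm_bcut_polyf; exact: polyf_mono.
rewrite (lebint_scale w0 aS) addnC exprD.
have -> : (fun v => bcut (mono a) (consv c (wb c *: v))) =
    fun v => (c ^+ a ord0 * wb c ^+ (\sum_i a' i)) * bcut (mono a') v.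
  apply/funext => v; rewrite /bcut dotp_consv dotpZr dotpC dotpZr mulrA -expr2 w2.
  have -> : (c ^+ 2 + (1 - c ^+ 2) * dotp v v <= 1) = (dotp v v <= 1).
    by rewrite addrC -lerBrDr -[leRHS]mulr1 ler_pM2l.
  case: ifP => _; last by rewrite mulr0.
  by rewrite mono_consv mono_scale mulrA.
rewrite lebintZ; last by apply: adm_bcut_polyf; exact: polyf_mono.
by rewrite /bint; ring.
Qed.

Lemma bint_monoS n (a : 'I_n.+1 -> nat) :
  bint (mono a) = Iw (a ord0) (\sum_i a (lift ord0 i) + n) * bint (mono (fun i => a (lift ord0 i))).
Proof.
set a' := fun i => a (lift ord0 i); set q := (_ + n)%N.
rewrite {1}/bint lebintS; set f := fun c : R => lebint _.
have af : adm1 f by apply: adm_slice; apply: adm_bcut_polyf; exact: polyf_mono.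
have f0 c : 1 < `|c| -> f c = 0.
  move=> c1; rewrite /f -[RHS](@lebint0 R n); congr lebint; apply/funext => v.
  rewrite /bcut dotp_consv; case: ifP => // H; exfalso.
  have := dotp_ge0 v; have : 1 < c ^+ 2 by rewrite -real_normK ?num_real //; nra.
  lra.
have i1 : (@lebesgue_measure R).-integrable `[-1, 1] (EFin \o f).
  by apply: integrableS (adm1_integrable af).
have ii : (@lebesgue_measure R).-integrable `[-1, 1[ (EFin \o f).
  by apply: integrableS i1 => //; exact: subset_itv_co_cc.
have wI := @wb_integrable R (a ord0) q.
have wi : (@lebesgue_measure R).-integrable `[-1, 1[ (EFin \o (fun x : R => x ^+ a ord0 * wb x ^+ q)).
  by apply: integrableS wI => //; exact: subset_itv_co_cc.
have wo : (@lebesgue_measure R).-integrable `]-1, 1[ (EFin \o (fun x : R => x ^+ a ord0 * wb x ^+ q)).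
  by apply: integrableS wI => //; exact: subset_itv_oo_cc.
(* The slice formula holds in the open interval, so the two end points are removed as a null set. *)
rewrite -(restrict_bsupp1 f0) -Rintegral_mkcond /Iw.
rewrite -(Rintegral_itv_bndo_bndc ii) -(Rintegral_itv_bndo_bndc wi).
rewrite -!Rintegral_itv_obnd_cbnd //; try by apply: integrableS i1 => //; exact: subset_itv_oo_cc.
rewrite -RintegralZr //.
apply: eq_Rintegral => c; rewrite inE /= in_itv /= => cI.
by rewrite /f bint_slice.
Qed.

Definition incr n (a : 'I_n -> nat) i j : nat := (a j + (j == i))%N.
(** The subtraction is truncated; in the identities below the case [a i = 0] carries the factor
    0. *)
Definition decr n (a : 'I_n -> nat) i j : nat := (a j - (j == i))%N.

Lemma sum_incr n (a : 'I_n -> nat) i : \sum_j incr a i j = (\sum_j a j).+1.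
Proof.
rewrite big_split /= -addn1; congr (_ + _)%N.
by rewrite (bigD1 i) //= eqxx big1 ?addn0 // => j /negPf ->.
Qed.

Lemma sum_decr n (a : 'I_n -> nat) i : (0 < a i)%N -> (\sum_j decr a i j).+1 = \sum_j a j.
Proof.
move=> ai; rewrite -(sum_incr _ i); apply: eq_bigr => j _; rewrite /incr /decr.
by case: eqP => [->|_]; rewrite ?subn0 ?addn0 // subnK.
Qed.

(** Induction on the dimension, slicing along the first coordinate. For that coordinate it is
    [Iw_rec]; for the others the induction hypothesis applies and the change of the slice exponent
    is accounted for by [Iw_rec_weight]. *)
Lemma bint_mono_rec n (a : 'I_n -> nat) i :
  (\sum_j a j + n + 1)%:R * bint (mono (incr a i)) = (a i)%:R * bint (mono (decr a i)).
Proof.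
elim: n a i => [a []//|n IH] a i; rewrite !bint_monoS.
case: (unliftP ord0 i) => [j|] ->.
  set a' := fun j => a (lift ord0 j).
  have E1 : (fun l => incr a (lift ord0 j) (lift ord0 l)) = incr a' j.
    by apply/funext => l; rewrite /incr (inj_eq (@lift_inj _ ord0)).
  have E2 : (fun l => decr a (lift ord0 j) (lift ord0 l)) = decr a' j.
    by apply/funext => l; rewrite /decr (inj_eq (@lift_inj _ ord0)).
  have F1 : incr a (lift ord0 j) ord0 = a ord0 by rewrite /incr addn0.
  have F2 : decr a (lift ord0 j) ord0 = a ord0 by rewrite /decr subn0.
  have S1 : (\sum_l incr a (lift ord0 j) (lift ord0 l) = \sum_l incr a' j l)%N.
    by apply: eq_bigr => l _; rewrite -E1.
  have S2 : (\sum_l decr a (lift ord0 j) (lift ord0 l) = \sum_l decr a' j l)%N.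
    by apply: eq_bigr => l _; rewrite -E2.
  rewrite S1 S2 E1 E2 F1 F2 sum_incr big_ord_recl -/a'.
  set q := (\sum_l a' l)%N; have := IH a' j; rewrite -/q; set p := a ord0.
  rewrite -[a (lift ord0 j)]/(a' j) => H.
  have [aj0|aj0] := posnP (a' j).
    have : (q + n + 1)%:R * bint (mono (incr a' j)) = 0 by rewrite H aj0 mul0r.
    by move/eqP; rewrite mulf_eq0 addn1 pnatr_eq0 /= => /eqP ->; rewrite aj0 !mulr0 mul0r.
  have qE := sum_decr aj0; rewrite -/q in qE.
  rewrite -qE; set r := (\sum_l decr a' j l + n)%N.
  have := @Iw_rec_weight R p r.
  have -> : ((\sum_l decr a' j l).+2 + n = r.+2)%N by rewrite /r; lia.
  have -> : (p + r.+1 + 2 = p + (\sum_l decr a' j l).+1 + n.+1 + 1)%N by rewrite /r; lia.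
  move: H; rewrite -qE.
  have -> : ((\sum_l decr a' j l).+1 + n + 1 = r.+2)%N by rewrite /r; lia.
  move=> H K.
  by rewrite mulrA K mulrAC H; ring.
have E1 : (fun l => incr a ord0 (lift ord0 l)) = fun l => a (lift ord0 l).
  by apply/funext => l; rewrite /incr addn0.
have E2 : (fun l => decr a ord0 (lift ord0 l)) = fun l => a (lift ord0 l).
  by apply/funext => l; rewrite /decr subn0.
have S1 : (\sum_l incr a ord0 (lift ord0 l) = \sum_l a (lift ord0 l))%N.
  by apply: eq_bigr => l _; rewrite /incr addn0.
have S2 : (\sum_l decr a ord0 (lift ord0 l) = \sum_l a (lift ord0 l))%N.
  by apply: eq_bigr => l _; rewrite /decr subn0.
rewrite S1 S2 E1 E2 big_ord_recl /incr /decr eqxx addn1 subn1.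
set q := (\sum_l _)%N.
have := @Iw_rec R (a ord0) (q + n).
have -> : (a ord0 + (q + n) + 2 = a ord0 + q + n.+1 + 1)%N by lia.
by rewrite !addn1 => K; rewrite !mulrA K.
Qed.

End BallIntegral.

(** * Integration by parts over the ball and its consequences *)

Section BallParts.
Context {R : realType} {N : nat}.
Local Notation vec := 'rV[R]_N.
Implicit Types (x y a xi : vec) (f g : vec -> R).
Local Notation e i := (delta_mx 0 i : vec).

Lemma dd_prod0 I (s : seq I) (P : pred I) (F : I -> vec -> R) v x : (forall i, polyf (F i)) ->
  (forall i x, P i -> dd v (F i) x = 0) -> dd v (fun x => \prod_(i <- s | P i) F i x) x = 0.
Proof.
move=> pF dF; elim: s => [|i s IH].
  by rewrite (_ : (fun x => _) = fun=> 1) ?dd_cst //; apply/funext => z; rewrite big_nil.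
case: (boolP (P i)) => Pi.
  rewrite (_ : (fun x => _) = fun x => F i x * \prod_(j <- s | P j) F j x).
    by rewrite ddM ?IH ?dF ?mul0r ?mulr0 ?addr0 //; exact: polyf_prod.
  by apply/funext => z; rewrite big_cons Pi.
by rewrite -[RHS]IH; congr dd; apply/funext => z; rewrite big_cons (negbTE Pi).
Qed.

Lemma dd_coord_exp i k v x : dd v (fun x => x ord0 i ^+ k) x = k%:R * x ord0 i ^+ k.-1 * v ord0 i.
Proof.
have pc := @polyf_coord R N i.
elim: k => [|k IH]; first by rewrite mul0r mul0r (_ : (fun x => _) = fun=> 1) ?dd_cst.
rewrite (_ : (fun x => _) = fun x => x ord0 i * x ord0 i ^+ k); last by apply/funext => z; rewrite exprS.
rewrite ddM ?dd_coord ?IH //; last exact: polyf_exp.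
by case: k {IH} => [|k] /=; rewrite ?exprS -?natr1 /=; ring.
Qed.

Lemma dd_mono (a : 'I_N -> nat) i x : dd (e i) (mono a) x = (a i)%:R * mono (decr a i) x.
Proof.
have pc j : polyf (fun x : vec => x ord0 j ^+ a j) by apply: polyf_exp; exact: polyf_coord.
rewrite (_ : mono a = fun x => x ord0 i ^+ a i * \prod_(j | j != i) x ord0 j ^+ a j); last first.
  by apply/funext => z; rewrite /mono (bigD1 i).
rewrite ddM //; last exact: polyf_prod.
rewrite dd_coord_exp dd_prod0 => //; last first.
  by move=> j z ji; rewrite dd_coord_exp mxE eqxx (negbTE ji) mulr0.
rewrite mxE !eqxx mulr1 mulr0 addr0 -mulrA; congr (_ * _).
rewrite /mono [RHS](bigD1 i) //= /decr eqxx subn1; congr (_ * _).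
by apply: eq_bigr => j /negPf ->; rewrite subn0.
Qed.

(** The divergence theorem without a surface integral: y_i f is homogeneous of degree m + 1, so its
    boundary term is m + 1 + N times its integral over the ball. On monomials this is
    [bint_mono_rec]. *)
Lemma bint_coord m f i : polyf f -> hom m f ->
  (m + N + 1)%:R * bint (fun y => y ord0 i * f y) = bint (dd (e i) f).
Proof.
move=> pf hf; have [s [/allP sm fE]] := hom_homog_poly pf hf.
have pm (c : R * {ffun 'I_N -> nat}) : polyf (fun y : vec => c.1 * mono c.2 y).
  by apply: polyfZ; exact: polyf_mono.
have fE' : f = fun y => \sum_(c <- s) c.1 * mono c.2 y by apply/funext => y; rewrite fE.
rewrite (_ : (fun y => _) = fun y => \sum_(c <- s) c.1 * mono (incr c.2 i) y); last first.
  apply/funext => y; rewrite fE' mulr_sumr; apply: eq_bigr => c _.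
  rewrite mulrCA; congr (_ * _); rewrite /mono (bigD1 i) //= [RHS](bigD1 i) //= /incr eqxx addn1 exprS mulrA.
  by congr (_ * _); apply: eq_bigr => j /negPf ->; rewrite addn0.
rewrite (_ : dd (e i) f = fun y => \sum_(c <- s) c.1 * ((c.2 i)%:R * mono (decr c.2 i) y)); last first.
  apply/funext => y; rewrite {1}fE' dd_sum; last by move=> c _; exact: pm.
  by apply: eq_bigr => c _; rewrite ddZ ?dd_mono //; exact: polyf_mono.
rewrite !bint_sum; try by move=> c; apply: polyfZ; (exact: polyf_mono || (apply: polyfZ; exact: polyf_mono)).
rewrite mulr_sumr big_seq [RHS]big_seq; apply: eq_bigr => c /sm /eqP cm.
rewrite !bintZ; try exact: polyf_mono; last by apply: polyfZ; exact: polyf_mono.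
by rewrite mulrCA -cm bint_mono_rec.
Qed.

Lemma bint_dotp m f xi : polyf f -> hom m f ->
  (m + N + 1)%:R * bint (fun y => dotp xi y * f y) = bint (dd xi f).
Proof.
move=> pf hf.
rewrite (_ : (fun y => _) = fun y => \sum_i xi ord0 i * (y ord0 i * f y)); last first.
  by apply/funext => y; rewrite /dotp mulr_suml; apply: eq_bigr => i _; rewrite mulrA.
rewrite (_ : dd xi f = fun y => \sum_i xi ord0 i * dd (e i) f y); last first.
  by apply/funext => y; rewrite -dd_basis.
have pM i : polyf (fun y : vec => y ord0 i * f y) by apply: polyfM => //; exact: polyf_coord.
have pd i : polyf (dd (e i) f) by exact: polyf_dd.
rewrite !bint_sum; try by move=> i; exact: polyfZ.
rewrite mulr_sumr; apply: eq_bigr => i _.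
by rewrite !bintZ // mulrCA (bint_coord i pf hf).
Qed.

Lemma bint_euler m f : polyf f -> hom m f ->
  m%:R * bint f = \sum_i bint (fun y => y ord0 i * dd (e i) f y).
Proof.
move=> pf hf; have pM i : polyf (fun y : vec => y ord0 i * dd (e i) f y).
  by apply: polyfM; [exact: polyf_coord | exact: polyf_dd].
rewrite -bintZ // -bint_sum //; congr bint; apply/funext => y.
by rewrite -(euler_sum y pf hf).
Qed.

(* The recursion of bint_coord determines the ball integral on homogeneous
   polynomials, and it is invariant under a reflection. *)
Lemma bint_refl a f : dotp a a = 2 -> polyf f -> bint (fun y => f (refl a y)) = bint f.
Proof.
move=> a2; have pr := @polyf_refl R N a.
suff H m f' : polyf f' -> hom m f' -> bint (fun y => f' (refl a y)) = bint f'.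
  apply: (@polyf_hom_ind _ _ (fun f => bint (fun y => f (refl a y)) = bint f)).
  - by move=> f1 f2 /funext ->.
  - by [].
  - by move=> f1 f2 p1 p2 E1 E2; rewrite !bintD ?E1 ?E2 //; exact: pr.
  - by move=> m f1; exact: H.
elim/ltn_ind: m f' => m IH f' pf hf.
case: m IH hf => [|m] IH hf; first by rewrite (hom0_cst hf).
have m0 : (m.+1%:R : R) != 0 by rewrite pnatr_eq0.
apply: (mulfI m0); have hr := hom_refl a hf.
have mn0 : ((m + N + 1)%:R : R) != 0 by rewrite pnatr_eq0 addn1.
have pd i : polyf (dd (e i) f') by exact: polyf_dd.
have hd i : hom m (dd (e i) f') by exact: hom_dd.
rewrite (bint_euler pf hf) -bintZ; last exact: pr.
rewrite (_ : (fun y => _) = fun y => \sum_i dotp (refl a (e i)) y * dd (e i) f' (refl a y)); last first.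
  apply/funext => y; rewrite -(euler_sum _ pf hf); apply: eq_bigr => i _.
  by rewrite dotp_reflC // dotpC dotp_delta.
rewrite bint_sum; last by move=> i; apply: polyfM; [exact: polyf_dotp | exact: pr].
apply: eq_bigr => i _; apply: (mulfI mn0).
rewrite (bint_dotp _ (pr _ (pd i)) (hom_refl a (hd i))) (bint_coord _ (pd i) (hd i)).
rewrite (_ : dd _ _ = fun y => dd (e i) (dd (e i) f') (refl a y)); last first.
  by apply/funext => y; rewrite dd_refl // reflK.
case: m IH hd {hf m0 hr mn0} => [|m] IH hd.
  by congr bint; apply/funext => y; rewrite !hom0_dd.
by apply: (IH m) => //; [exact: polyf_dd | exact: hom_dd].
Qed.

Lemma bint_odd m f : polyf f -> hom m f -> odd m -> bint f = 0.
Proof.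
elim/ltn_ind: m f => m IH f pf hf om.
case: m IH hf om => [//|m] IH hf om.
have pd i : polyf (dd (e i) f) by exact: polyf_dd.
have hd i : hom m (dd (e i) f) by exact: hom_dd.
have m0 : (m.+1%:R : R) != 0 by rewrite pnatr_eq0.
have mn0 : ((m + N + 1)%:R : R) != 0 by rewrite pnatr_eq0 addn1.
apply: (mulfI m0); rewrite (bint_euler pf hf) mulr0 big1 // => i _.
apply: (mulfI mn0); rewrite (bint_coord _ (pd i) (hd i)) mulr0.
case: m IH hd om {hf m0 mn0} => [|m] IH hd om.
  by rewrite -[RHS](@bint0 R N); congr bint; apply/funext => y; rewrite hom0_dd.
apply: (IH m) => //; [exact: polyf_dd | exact: hom_dd | by move: om; rewrite /= negbK].
Qed.

Lemma bint_normsq m f : polyf f -> hom m f ->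
  (m + N + 2)%:R * bint (fun y => dotp y y * f y) = (m + N)%:R * bint f.
Proof.
move=> pf hf; have pc := @polyf_coord R N; have pd i : polyf (dd (e i) f) by exact: polyf_dd.
have pM i : polyf (fun y : vec => y ord0 i * f y) by exact: polyfM.
rewrite (_ : (fun y => _) = fun y => \sum_i y ord0 i * (y ord0 i * f y)); last first.
  by apply/funext => y; rewrite /dotp mulr_suml; apply: eq_bigr => i _; rewrite mulrA.
rewrite bint_sum; last by move=> i; exact: polyfM.
rewrite mulr_sumr [in RHS]natrD [RHS]mulrDl (bint_euler pf hf) [RHS]addrC.
transitivity (\sum_i (bint f + bint (fun y => y ord0 i * dd (e i) f y))).
  apply: eq_bigr => i _.
  have hM : hom m.+1 (fun y => y ord0 i * f y) by have := homM (hom_coord i) hf; rewrite add1n.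
  have := bint_coord i (pM i) hM; rewrite (_ : (m.+1 + N + 1 = m + N + 2)%N); last by lia.
  move=> ->; rewrite -bintD //; last exact: polyfM.
  congr bint; apply/funext => y; rewrite ddM // dd_coord mxE !eqxx mul1r //.
by rewrite big_split /= sumr_const card_ord -[_ *+ N]mulr_natl.
Qed.

End BallParts.

(** * Sphere integrals and their relation to ball integrals *)

Section SphereIntegral.
Context {R : realType} {N : nat}.
Local Notation vec := 'rV[R]_N.
Implicit Types (x y a xi : vec) (f g h : vec -> R).

(** At the origin the inverse norm is 0 and the value is 0, which is off the sphere; hence bounds
    below are required on the closed ball. *)
Definition nrm y : vec := (enorm y)^-1 *: y.
Definition scut h y : R := if enorm y <= 1 then h (nrm y) else 0.

Lemma sphere_intE h : sphere_int h = N%:R * lebint (scut h).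
Proof. by []. Qed.

Lemma enorm_le1 y : (enorm y <= 1) = (dotp y y <= 1).
Proof.
rewrite /enorm -{1}[1 : R]sqrtr1 ler_sqrt //.
Qed.

Lemma enorm_ge0 y : 0 <= enorm y. Proof. exact: sqrtr_ge0. Qed.

Lemma enorm_sqr y : enorm y ^+ 2 = dotp y y.
Proof. by rewrite sqr_sqrtr // dotp_ge0. Qed.

Lemma enorm_eq0 y : (enorm y == 0) = (y == 0).
Proof. by rewrite -dotp_eq0 -enorm_sqr sqrf_eq0. Qed.

Lemma enormZ s y : 0 <= s -> enorm (s *: y) = s * enorm y.
Proof.
move=> s0; rewrite /enorm dotpZr dotpZl mulrA -expr2 sqrtrM ?sqr_ge0 //.
by rewrite sqrtr_sqr ger0_norm.
Qed.

Lemma nrmZ s y : 0 < s -> nrm (s *: y) = nrm y.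
Proof.
move=> s0; rewrite /nrm enormZ ?ltW // scalerA invfM; congr (_ *: _).
by rewrite mulrAC mulVf ?mul1r // gt_eqF.
Qed.

Lemma nrmK y : y = enorm y *: nrm y.
Proof.
have [->|y0] := eqVneq y 0; first by rewrite /nrm !scaler0.
by rewrite scalerA divff ?scale1r // enorm_eq0.
Qed.

Lemma dotp_nrm y : y != 0 -> dotp (nrm y) (nrm y) = 1.
Proof.
move=> y0; have n0 : enorm y != 0 by rewrite enorm_eq0.
by rewrite /nrm dotpZr dotpZl -enorm_sqr; field.
Qed.

Lemma dotp_nrm_le1 y : dotp (nrm y) (nrm y) <= 1.
Proof.
have [->|y0] := eqVneq y 0; first by rewrite /nrm scaler0 dotp0r ler01.
by rewrite dotp_nrm.
Qed.

Definition sadm h : Prop := adm (scut h).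

Lemma pmeas_enormV : pmeas (fun y : vec => (enorm y)^-1).
Proof.
rewrite (_ : (fun y => _) = fun y : vec => (dotp y y) `^ (- 2^-1)).
  apply: (@pmeasP1 _ (fun t => t `^ (- 2^-1))); first exact: measurable_powR.
  by apply: pmeas_polyf; exact: polyf_dotpp.
by apply/funext => y; rewrite powRN powR12_sqrt // dotp_ge0.
Qed.

Lemma sadmP h : pmeas h -> (exists B, forall y, dotp y y <= 1 -> `|h y| <= B) -> sadm h.
Proof.
move=> mh [B HB].
rewrite /sadm; have -> : scut h = bcut (fun y => h (nrm y)) by apply/funext => y; rewrite /scut enorm_le1.
apply: adm_bcut; last by exists B => y _; apply: HB; exact: dotp_nrm_le1.
apply: pmeas_comp => // i.
rewrite (_ : (fun y => _) = fun y : vec => (enorm y)^-1 * y ord0 i).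
  by apply: pmeasM; [exact: pmeas_enormV | exact: pmeas_coord].
by apply/funext => y; rewrite mxE.
Qed.

Lemma sadm_polyf f : polyf f -> sadm f.
Proof. by move=> pf; apply: sadmP; [exact: pmeas_polyf | exact: polyf_bounded]. Qed.

Lemma sphere_intD f g : sadm f -> sadm g ->
  sphere_int (fun y => f y + g y) = sphere_int f + sphere_int g.
Proof.
move=> af ag; rewrite !sphere_intE -mulrDr -lebintD //; congr (_ * lebint _).
by apply/funext => y; rewrite /scut; case: ifP => _; rewrite ?addr0.
Qed.

Lemma sphere_intZ c f : sadm f -> sphere_int (fun y => c * f y) = c * sphere_int f.
Proof.
move=> af; rewrite !sphere_intE mulrCA -(lebintZ c af) //; congr (_ * lebint _).
by apply/funext => y; rewrite /scut; case: ifP => _; rewrite ?mulr0.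
Qed.

Lemma sadmD f g : sadm f -> sadm g -> sadm (fun y => f y + g y).
Proof.
move=> af ag; rewrite /sadm (_ : scut _ = fun y => scut f y + scut g y); first exact: admD.
by apply/funext => y; rewrite /scut; case: ifP => _; rewrite ?addr0.
Qed.

Lemma sadmZ c f : sadm f -> sadm (fun y => c * f y).
Proof.
move=> af; rewrite /sadm (_ : scut _ = fun y => c * scut f y); first exact: admZ.
by apply/funext => y; rewrite /scut; case: ifP => _; rewrite ?mulr0.
Qed.

Lemma ler_sphere_int f g : sadm f -> sadm g ->
  (forall y, dotp y y <= 1 -> f y <= g y) -> sphere_int f <= sphere_int g.
Proof.
move=> af ag H; rewrite !sphere_intE; apply: ler_wpM2l => //; apply: ler_lebint => // y.
by rewrite /scut; case: ifP => // _; apply: H; exact: dotp_nrm_le1.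
Qed.

Lemma sphere_int_dist f g eps : sadm f -> sadm g ->
  (forall y, dotp y y <= 1 -> `|f y - g y| <= eps) ->
  `|sphere_int f - sphere_int g| <= eps * sphere_int (fun _ : vec => 1).
Proof.
move=> af ag H; have a1 : sadm (fun _ : vec => 1) by apply: sadm_polyf; exact: polyf_cst.
have := ler_sphere_int af (sadmD ag (sadmZ eps a1)); rewrite sphere_intD ?sphere_intZ //; last exact: sadmZ.
have := ler_sphere_int ag (sadmD af (sadmZ eps a1)); rewrite sphere_intD ?sphere_intZ //; last exact: sadmZ.
move=> H1 H2; have {}H1 := H1 _; have {}H2 := H2 _.
have : sphere_int g <= sphere_int f + eps * sphere_int (fun _ : vec => 1).
  by apply: H1 => y /H; rewrite ler_norml => /andP[] *; lra.
have : sphere_int f <= sphere_int g + eps * sphere_int (fun _ : vec => 1).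
  by apply: H2 => y /H; rewrite ler_norml => /andP[] *; lra.
by rewrite ler_norml => *; apply/andP; split; lra.
Qed.

Lemma sadm_lim (F : nat -> vec -> R) h B : (forall j, sadm (F j)) ->
  (forall y, dotp y y <= 1 -> F ^~ y @ \oo --> h y) ->
  (forall y, dotp y y <= 1 -> `|h y| <= B) -> sadm h.
Proof.
move=> aF Fh hB; split.
  apply: (@pmeas_lim _ _ (fun j => scut (F j))); first by move=> j; case: (aF j).
  move=> y; rewrite /scut; case: ifP => _; last exact: cvg_cst.
  by apply: Fh; exact: dotp_nrm_le1.
exists 2, `|B|; split=> //; split=> [y|y i Hi]; rewrite /scut; case: ifP => //; rewrite ?normr0 //.
  by move=> _; rewrite (le_trans (hB _ (dotp_nrm_le1 y))) // ler_norm.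
rewrite enorm_le1 => y1; have := coord_le i y1; rewrite normr1; lra.
Qed.

(** Divide by 1 - s and let s tend to 1: (1 - s^j) / (1 - s) tends to j, whereas the right side is
    of second order in 1 - s. *)
Lemma geometric_rigidity (m n : nat) (P F C : R) : 0 <= C ->
  (forall s, 0 < s < 1 -> `|(1 - s ^+ (m + n)) * P - (1 - s ^+ n) * F| <= C * (1 - s ^+ m) * (1 - s ^+ n)) ->
  n%:R * F = (m + n)%:R * P.
Proof.
move=> C0 H; pose gs (j : nat) (s : R) := \sum_(i < j) s ^+ i.
have gE j s : 1 - s ^+ j = (1 - s) * gs j s.
  by have := subrX1 s j; rewrite -/(gs j s) => E; rewrite -[LHS]opprB E; ring.
have g0 j s : 0 < s < 1 -> 0 <= gs j s.
  by move=> sI; apply: sumr_ge0 => i _; apply: exprn_ge0; lra.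
have gj j s : 0 < s < 1 -> gs j s <= j%:R.
  move=> sI; rewrite -[j%:R]mulr1 mulr_natl -[X in _ *+ X](card_ord j) -sumr_const; apply: ler_sum => i _.
  by apply: exprn_ile1; lra.
have gd j s : 0 < s < 1 -> j%:R - gs j s <= (1 - s) * j%:R ^+ 2.
  move=> sI; have -> : j%:R - gs j s = \sum_(i < j) (1 - s ^+ i).
    by rewrite sumrB sumr_const card_ord.
  have -> : (1 - s) * j%:R ^+ 2 = \sum_(i < j) (1 - s) * j%:R :> R.
    by rewrite sumr_const card_ord -[RHS]mulr_natl; ring.
  apply: ler_sum => i _; rewrite gE ler_wpM2l; [by [] | lra |].
  by apply: le_trans (gj _ _ sI) _; rewrite ler_nat ltnW.
pose X := (m + n)%:R * P - n%:R * F.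
pose K := C * m%:R * n%:R + (m + n)%:R ^+ 2 * `|P| + n%:R ^+ 2 * `|F|.
have K0 : 0 <= K by rewrite !addr_ge0 ?mulr_ge0 ?sqr_ge0.
have HX s : 0 < s < 1 -> `|X| <= (1 - s) * K.
  move=> sI; have s1 : 0 < 1 - s by lra.
  have := H s sI; rewrite !gE.
  have -> : (1 - s) * gs (m + n)%N s * P - (1 - s) * gs n s * F =
    (1 - s) * (gs (m + n)%N s * P - gs n s * F) by ring.
  have -> : C * ((1 - s) * gs m s) * ((1 - s) * gs n s) = (1 - s) * ((1 - s) * (C * (gs m s * gs n s))) by ring.
  rewrite normrM (gtr0_norm s1) ler_pM2l // => H1.
  have H2 : C * (gs m s * gs n s) <= C * m%:R * n%:R.
    by rewrite -mulrA ler_wpM2l // ler_pM // ?g0 // gj.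
  have -> : X = ((m + n)%:R - gs (m + n)%N s) * P - (n%:R - gs n s) * F + (gs (m + n)%N s * P - gs n s * F).
    by rewrite /X; ring.
  rewrite (le_trans (ler_normD _ _)) //.
  have -> : (1 - s) * K = ((1 - s) * (m + n)%:R ^+ 2 * `|P| + (1 - s) * n%:R ^+ 2 * `|F|) + (1 - s) * (C * m%:R * n%:R).
    by rewrite /K; ring.
  apply: lerD; last by apply: le_trans H1 _; rewrite ler_pM2l.
  rewrite (le_trans (ler_normB _ _)) // !normrM.
  by rewrite lerD // ler_wpM2r // ger0_norm ?gd // subr_ge0 gj.
have [X0|X0] := eqVneq X 0; first by apply/esym/eqP; rewrite -subr_eq0 -/X X0.
have Xp : 0 < `|X| by rewrite normr_gt0.
exfalso; pose t := Num.min (2^-1) (`|X| / (2 * (K + 1))).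
have K1 : 0 < 2 * (K + 1) by lra.
have t0 : 0 < t by rewrite lt_min invr_gt0 ltr0n divr_gt0.
have t2 : t <= 2^-1 by rewrite ge_min lexx.
have tX : t * (2 * (K + 1)) <= `|X| by rewrite -ler_pdivlMr // ge_min lexx orbT.
have tI : 0 < 1 - t < 1 by lra.
have := HX _ tI; rewrite opprB addrC subrK; nra.
Qed.

(* Comparison of p with its radial projection on the shell s < |y| <= 1. *)
Lemma sphere_int_hom m (p : vec -> R) : polyf p -> hom m p -> sphere_int p = (m + N)%:R * bint p.
Proof.
move=> pp hp; rewrite sphere_intE.
have [M HM] := polyf_bounded 1 pp.
have M0 : 0 <= M by apply: le_trans (HM 0 _) => //; rewrite dotp0r.
have p1 : polyf (fun _ : vec => 1 : R) by exact: polyf_cst.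
have aQ := adm_bcut_polyf pp; have aF : adm (scut p) := sadm_polyf pp.
have aW := adm_bcut_polyf p1.
set v := bint (fun _ : vec => 1 : R).
have v0 : 0 <= v.
  rewrite -(@lebint0 R N); apply: ler_lebint => //.
    by have := admZ 0 aW; congr adm; apply/funext => y; rewrite mul0r.
  by move=> y; rewrite /bcut; case: ifP.
apply: (@geometric_rigidity m N (bint p) (lebint (scut p)) (M * v)).
  exact: mulr_ge0.
move=> s sI; have s0 : 0 < s by lra. have t0 : 0 < s^-1 by rewrite invr_gt0.
have sn (G : vec -> R) : adm G -> lebint (fun y => G (s^-1 *: y)) = s ^+ N * lebint G.
  by move=> aG; rewrite (lebint_scale t0 aG) exprVn mulrA divff ?mul1r // expf_neq0 // gt_eqF.
have aQs := adm_scale t0 aQ; have aFs := adm_scale t0 aF; have aWs := adm_scale t0 aW.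
(* Subtracting the copies dilated by s leaves p minus its radial projection on the shell s < |y| <=
   1. There the two differ by the factor |y|^m, hence by at most M (1 - s^m), which is the height of
   [E]. *)
pose D y := (bcut p y - s ^+ m * bcut p (s^-1 *: y)) - (scut p y - scut p (s^-1 *: y)).
have aB (F G : vec -> R) : adm F -> adm G -> adm (fun y => F y - G y).
  by move=> aFF aG; have := admD aFF (admZ (-1) aG); congr adm; apply/funext => y; rewrite mulN1r.
have a1 := aB _ _ aQ (admZ (s ^+ m) aQs); have a2 := aB _ _ aF aFs.
have aD : adm D := aB _ _ a1 a2.
have ID : lebint D = (1 - s ^+ (m + N)) * bint p - (1 - s ^+ N) * lebint (scut p).
  by rewrite (lebintB a1 a2) (lebintB aQ (admZ _ aQs)) (lebintB aF aFs) lebintZ // !sn // /bint exprD; ring.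
pose E y := M * (1 - s ^+ m) * (bcut (fun _ : vec => 1) y - bcut (fun _ : vec => 1) (s^-1 *: y)).
have aE : adm E by apply: admZ; exact: aB.
have IE : lebint E = M * v * (1 - s ^+ m) * (1 - s ^+ N).
  by rewrite /E lebintZ ?(lebintB aW aWs) ?sn //; [rewrite -/(bint _) -/v; ring | exact: aB].
suff DE y : `|D y| <= E y.
  rewrite -ID -IE ler_norml; apply/andP; split.
    rewrite -mulN1r -lebintZ //; apply: ler_lebint => //; first exact: admZ.
    by move=> y; rewrite mulN1r; have := DE y; rewrite ler_norml => /andP[].
  by apply: ler_lebint => // y; have := DE y; rewrite ler_norml => /andP[].
have sm1 : 0 <= 1 - s ^+ m by rewrite subr_ge0; apply: exprn_ile1; lra.
rewrite /D /E /bcut /scut -!enorm_le1 enormZ ?nrmZ ?(ltW t0) // hp.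
have -> : (s^-1 * enorm y <= 1) = (enorm y <= s) by rewrite mulrC ler_pdivrMr // mul1r.
have [ys|ys] := leP (enorm y) s.
  have -> : enorm y <= 1 by lra.
  by rewrite mulrA -exprMn divff ?gt_eqF // expr1n mul1r !subrr normr0 mulr0.
case: (leP (enorm y) 1) => y1; last by rewrite !mulr0 !subr0 normr0 mulr0.
rewrite mulr0 !subr0 mulr1 {1}(nrmK y) hp -[X in _ - X]mul1r -mulrBl normrM mulrC.
apply: ler_pM => //; first by apply: HM; exact: dotp_nrm_le1.
have yn : enorm y ^+ m <= 1 by apply: exprn_ile1; [exact: enorm_ge0 | exact: y1].
rewrite ler0_norm ?subr_le0 // opprB lerD2l lerN2.
by rewrite lerXn2r // ?nnegrE ?enorm_ge0 ?(ltW s0) ?(ltW ys).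
Qed.

End SphereIntegral.

(** * The weight *)

Section PowerApproximation.
Context {R : realType}.
Implicit Types (s t eps kap : R) (P : {poly R}).

Lemma continuous_norm_powR kap : 0 <= kap -> continuous (fun t : R => `|t| `^ kap).
Proof.
rewrite le_eqVlt => /predU1P[<-|k0] t.
  rewrite (_ : (fun t => _) = fun=> 1); first exact: cst_continuous.
  by apply/funext => u; rewrite powRr0.
have [->|t0] := eqVneq t 0.
  apply/(@cvgrPdist_le _ _ _ (nbhs (0 : R)) (nbhs_filter (0 : R))) => /= e e0.
  have d0 : 0 < e `^ kap^-1 by exact: powR_gt0.
  apply: (@filterS _ (nbhs (0 : R)) _ (ball (0 : R) (e `^ kap^-1))); last exact: nbhsx_ballx.
  move=> u; rewrite /ball /= sub0r normrN => ud.
  rewrite normr0 powR0 ?gt_eqF // sub0r normrN ger0_norm ?powR_ge0 //.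
  have -> : e = (e `^ kap^-1) `^ kap by rewrite -powRrM mulVf ?gt_eqF // powRr1 // ltW.
  by apply: ge0_ler_powR => //; rewrite ?nnegrE ?normr_ge0 ?powR_ge0 // ltW.
apply: (@continuous_comp _ _ _ (fun u : R => `|u|) (fun u => u `^ kap)); first exact: norm_continuous.
have tp : 0 < `|t| by rewrite normr_gt0.
apply: differentiable_continuous; apply/derivable1_diffP.
by have [] := is_derive1_powR kap tp.
Qed.

(** The equation says (X P)' = Q, so P is the average of Q from 0 to s, obtained coefficient by
    coefficient. *)
Lemma poly_antiderivative (Q : {poly R}) : exists P, P + 'X * P^`() = Q.
Proof.
exists (\poly_(j < size Q) (Q`_j / j.+1%:R)).
apply/polyP => i; rewrite coefD coefXM coef_deriv !coef_poly.
case: i => [|i] /=.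
  by rewrite addr0 divr1; case: ltnP => // /(nth_default 0) ->.
case: ltnP => [_|/(nth_default 0) ->]; last by rewrite mul0rn addr0.
rewrite -[_ *+ i.+1]mulr_natl.
have : (i.+2%:R : R) != 0 by rewrite pnatr_eq0.
by rewrite -[i.+2%:R]natr1 -[i.+1%:R]natr1 => H; field.
Qed.

(* With g = P - s^kap, the derivative of s * g(s) is Q - (1 + kap) s^kap, which is
   uniformly small; hence so are g and s * g'. *)
Lemma powR_poly_approx kap eps : 0 <= kap -> 0 < eps ->
  exists P, forall s, 0 <= s <= 2 ->
    `|P.[s] - s `^ kap| <= eps /\ `|s * P^`().[s] - kap * s `^ kap| <= eps.
Proof.
move=> k0 e0; have e2 : 0 < eps / 2 by rewrite divr_gt0.
pose E (y : 'rV[R]_1) := (1 + kap) * `|y ord0 ord0| `^ kap.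
have cE : continuous E.
  have cc : continuous (fun _ : 'rV[R]_1 => 1 + kap : R) by move=> z; exact: cst_continuous.
  have cg : continuous (fun y : 'rV[R]_1 => `|y ord0 ord0| `^ kap).
    move=> y; apply: (@continuous_comp _ _ _ (fun y : 'rV[R]_1 => y ord0 ord0) (fun u => `|u| `^ kap)).
      exact: coord_continuous.
    exact: continuous_norm_powR.
  by move=> y; exact: (cvgM (cc y) (cg y)).
(* The radius 2 covers all values <b, y>^2 with |b|^2 = 2 and |y| <= 1. *)
have [p pp Hp] := weierstrass_cube cE (@ltr0n R 2) e2.
have [Q HQ] := polyf_scalel (const_mx 1) pp.
have QE s : 0 <= s <= 2 -> `|Q.[s] - (1 + kap) * s `^ kap| <= eps / 2.
  move=> sI; rewrite -HQ distrC.
  have -> : (1 + kap) * s `^ kap = E (s *: const_mx 1).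
    by rewrite /E !mxE mulr1 ger0_norm //; lra.
  by apply: Hp => i; rewrite !mxE mulr1 ger0_norm; lra.
have [P PE] := poly_antiderivative Q.
have PQ s : s * P^`().[s] = Q.[s] - P.[s] by rewrite -PE hornerD hornerM hornerX addrC addKr.
suff H s : 0 <= s <= 2 -> `|P.[s] - s `^ kap| <= eps / 2.
  exists P => s sI; have H1 := H s sI; split; first by apply: le_trans H1 _; lra.
  have -> : s * P^`().[s] - kap * s `^ kap = (Q.[s] - (1 + kap) * s `^ kap) - (P.[s] - s `^ kap).
    by rewrite PQ; ring.
  by rewrite (le_trans (ler_normB _ _)) // [leRHS]splitr lerD // QE.
move=> /andP[]; rewrite le_eqVlt => /predU1P[<- _|s0 s2].
  have := QE 0; rewrite -(subrK (P.[0]) Q.[0]) -PQ mul0r add0r.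
  have -> : (1 + kap) * 0 `^ kap = 0 `^ kap.
    by have [->|kn] := eqVneq kap 0; rewrite ?addr0 ?mul1r // powR0 // mulr0.
  by apply; lra.
pose F (t : R) := t * P.[t] - t * t `^ kap.
pose dF (t : R) := Q.[t] - (1 + kap) * t `^ kap.
have dFE t : t \in `]0, s[ -> is_derive t 1 F (dF t).
  rewrite in_itv /= => /andP[t0 ts].
  have D1 := is_derive1_powR kap t0.
  have D2 := @is_deriveM R R id (fun t => t `^ kap) t 1 _ _ (is_derive_id _ _) D1.
  have D3 : is_derive t 1 (fun t => ('X * P).[t]) (('X * P)^`()).[t] by exact: is_derive_poly.
  have := is_deriveB D3 D2.
  have -> : ((fun t => ('X * P).[t]) - id * (fun t => t `^ kap)) = F.
    by apply/funext => u; rewrite /F !fctE hornerM hornerX.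
  move=> D; apply: (is_derive_eq D); rewrite /dF -PE derivM derivX mul1r !hornerD /GRing.scale /=.
  have -> : t `^ kap = t * t `^ (kap - 1).
    have tn : t != 0 by rewrite gt_eqF.
    by rewrite -[X in X * _]powRr1 ?ltW // -powRD ?tn ?implybT // addrC subrK.
  by ring.
have cF : {within `[0, s], continuous F}.
  apply: (@subspace_eq_continuous _ _ _ (fun t : R => t * P.[t] - t * `|t| `^ kap)).
    by move=> t; rewrite inE /= in_itv /= => /andP[t0 _]; rewrite /F ger0_norm.
  apply: continuous_subspaceT => t; apply: cvgB; apply: cvgM; try exact: cvg_id.
    exact: continuous_poly.
  exact: continuous_norm_powR.
have [c cI] := MVT s0 dFE cF.
have -> : F s - F 0 = s * (P.[s] - s `^ kap) by rewrite /F !mul0r; ring.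
rewrite subr0 mulrC => /(mulIf (lt0r_neq0 s0)) ->.
by apply: QE; move: cI; rewrite in_itv /=; lra.
Qed.

End PowerApproximation.

(** * Symmetries and integration by parts on the sphere *)

Section SpherePolynomials.
Context {R : realType} {N : nat}.
Local Notation vec := 'rV[R]_N.
Implicit Types (x y a xi : vec) (f g h : vec -> R).
Local Notation e i := (delta_mx 0 i : vec).

Lemma sphere_int_polyD f g : polyf f -> polyf g ->
  sphere_int (fun y => f y + g y) = sphere_int f + sphere_int g.
Proof. by move=> pf pg; apply: sphere_intD; exact: sadm_polyf. Qed.

Lemma sphere_int_polyZ c f : polyf f -> sphere_int (fun y => c * f y) = c * sphere_int f.
Proof. by move=> pf; apply: sphere_intZ; exact: sadm_polyf. Qed.

Lemma sphere_int0 : sphere_int (fun _ : vec => 0) = 0 :> R.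
Proof.
rewrite -[RHS](mul0r (sphere_int (fun _ : vec => 0 : R))) -sphere_int_polyZ; last exact: polyf_cst.
by congr sphere_int; apply/funext => y; rewrite mul0r.
Qed.

Lemma sphere_int_poly_sum I (s : seq I) (F : I -> vec -> R) : (forall i, polyf (F i)) ->
  sphere_int (fun y => \sum_(i <- s) F i y) = \sum_(i <- s) sphere_int (F i).
Proof.
move=> pF; elim: s => [|i s IH].
  by rewrite big_nil -[RHS]sphere_int0; congr sphere_int; apply/funext => y; rewrite big_nil.
rewrite big_cons -IH -sphere_int_polyD //; last exact: polyf_sum.
by congr sphere_int; apply/funext => y; rewrite big_cons.
Qed.

Lemma sphere_int_refl a f : dotp a a = 2 -> polyf f -> sphere_int (fun y => f (refl a y)) = sphere_int f.
Proof.
move=> a2; have pr := @polyf_refl R N a.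
move: f; apply: polyf_hom_ind.
- by move=> f1 f2 /funext ->.
- by [].
- by move=> f1 f2 p1 p2 E1 E2; rewrite !sphere_int_polyD ?E1 ?E2 //; exact: pr.
move=> m f pf hf; rewrite (sphere_int_hom (pr _ pf) (hom_refl a hf)) (sphere_int_hom pf hf).
by rewrite bint_refl.
Qed.

Lemma sphere_int_odd m f : polyf f -> hom m f -> odd m -> sphere_int f = 0.
Proof. by move=> pf hf om; rewrite (sphere_int_hom pf hf) (bint_odd pf hf om) mulr0. Qed.

Lemma sphere_int_normsq f : polyf f -> sphere_int (fun y => dotp y y * f y) = sphere_int f.
Proof.
have pM f' : polyf f' -> polyf (fun y : vec => dotp y y * f' y).
  by move=> pf; apply: polyfM => //; exact: polyf_dotpp.
move: f; apply: polyf_hom_ind.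
- by move=> f1 f2 /funext ->.
- by congr sphere_int; apply/funext => y; rewrite mulr0.
- move=> f1 f2 p1 p2 E1 E2.
  rewrite [RHS]sphere_int_polyD // -E1 -E2 -sphere_int_polyD; try exact: pM.
  by congr sphere_int; apply/funext => y; rewrite mulrDr.
move=> m f pf hf; have hM : hom (2 + m) (fun y => dotp y y * f y) by exact: homM hom_dotpp hf.
rewrite (sphere_int_hom (pM _ pf) hM) (sphere_int_hom pf hf) -(bint_normsq pf hf).
by congr (_%:R * _); lia.
Qed.

Lemma polyf_euler f : polyf f -> polyf (fun y => dd y f y).
Proof.
move=> pf; apply: (@eq_polyf _ _ (fun y => \sum_i y ord0 i * dd (e i) f y)).
  by move=> y; rewrite -dd_basis.
by apply: polyf_sum => i _; apply: polyfM; [exact: polyf_coord | exact: polyf_dd].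
Qed.

(** Proved on homogeneous parts, where the radial derivative is multiplication by the degree.
    Keeping the radial derivative makes it applicable to products with the model weights, which are
    not homogeneous. *)
Lemma sphere_int_parts i f : (0 < N)%N -> polyf f ->
  sphere_int (dd (e i) f) = sphere_int (fun y => y ord0 i * dd y f y) + (N%:R - 1) * sphere_int (fun y => y ord0 i * f y).
Proof.
move=> N0; have pc := @polyf_coord R N i.
move: f; apply: polyf_hom_ind.
- by move=> f1 f2 /funext ->.
- have p0 : polyf (fun _ : vec => 0 : R) by exact: polyf_cst.
  rewrite (_ : dd (e i) (fun=> 0) = fun=> 0); last by apply/funext => y; rewrite dd_cst.
  rewrite (_ : (fun y : vec => y ord0 i * dd y (fun=> 0) y) = fun=> 0); last by apply/funext => y; rewrite dd_cst mulr0.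
  rewrite (_ : (fun y : vec => y ord0 i * 0) = fun=> 0); last by apply/funext => y; rewrite mulr0.
  by rewrite sphere_int0; ring.
- move=> f1 f2 p1 p2 E1 E2.
  rewrite (_ : dd _ (fun x => _) = fun y => dd (e i) f1 y + dd (e i) f2 y); last by apply/funext => y; rewrite ddD.
  rewrite (_ : (fun y : vec => y ord0 i * dd y _ y) = fun y => y ord0 i * dd y f1 y + y ord0 i * dd y f2 y); last first.
    by apply/funext => y; rewrite ddD // mulrDr.
  rewrite (_ : (fun y : vec => y ord0 i * (f1 y + f2 y)) = fun y => y ord0 i * f1 y + y ord0 i * f2 y); last first.
    by apply/funext => y; rewrite mulrDr.
  rewrite !sphere_int_polyD ?E1 ?E2; try exact: polyf_dd; try (by apply: polyfM => //; exact: polyf_euler); try exact: polyfM.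
  by ring.
move=> m f pf hf; have pM : polyf (fun y : vec => y ord0 i * f y) by exact: polyfM.
have hM : hom (1 + m) (fun y : vec => y ord0 i * f y) := homM (hom_coord i) hf.
rewrite (_ : (fun y : vec => y ord0 i * dd y f y) = fun y => m%:R * (y ord0 i * f y)); last first.
  by apply/funext => y; rewrite (euler y pf hf) mulrCA.
rewrite sphere_int_polyZ // (sphere_int_hom pM hM) -mulrDl.
have := bint_coord i pf hf.
case: m hf hM => [|m] hf hM H.
  have d0 : dd (e i) f = fun=> 0 by apply/funext => y; exact: hom0_dd.
  move: H; rewrite d0 sphere_int0 bint0 => /eqP; rewrite mulf_eq0 pnatr_eq0 addn1 /= => /eqP ->.
  by rewrite !mulr0.
rewrite (sphere_int_hom (polyf_dd _ pf) (hom_dd _ pf hf)) -H.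
have -> : (1 + m.+1 + N = m.+1 + N + 1)%N by lia.
by rewrite natrD -[m.+1%:R]natr1; ring.
Qed.

End SpherePolynomials.

Section Products.
Context {R : realType} {N : nat}.
Local Notation vec := 'rV[R]_N.
Implicit Types (x y a xi : vec) (f g h : vec -> R).

Lemma polyf_horner (P : {poly R}) f : polyf f -> polyf (fun y => P.[f y]).
Proof.
move=> pf; apply: (@eq_polyf _ _ (fun y => \sum_(i < size P) P`_i * f y ^+ i)).
  by move=> y; rewrite horner_coef.
by apply: polyf_sum => i _; apply: polyfZ; exact: polyf_exp.
Qed.

Lemma dd_horner (P : {poly R}) f v y : polyf f -> dd v (fun y => P.[f y]) y = P^`().[f y] * dd v f y.
Proof.
move=> pf; elim/poly_ind: P y => [|P c IH] y.
  by rewrite deriv0 horner0 mul0r (_ : (fun y => _) = fun=> 0) ?dd_cst //; apply/funext => z; rewrite horner0.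
rewrite (_ : (fun y => _) = fun y => P.[f y] * f y + c); last by apply/funext => z; rewrite hornerMXaddC.
rewrite ddD; [|by apply: polyfM => //; exact: polyf_horner|exact: polyf_cst].
rewrite ddM //; last exact: polyf_horner.
by rewrite dd_cst IH derivD derivM derivX derivC !hornerE; ring.
Qed.

Lemma dd_prod (I : eqType) (s : seq I) (F : I -> vec -> R) v y : uniq s -> (forall i, polyf (F i)) ->
  dd v (fun y => \prod_(i <- s) F i y) y =
  \sum_(a <- s) \prod_(b <- s) (if b == a then dd v (F b) y else F b y).
Proof.
move=> + pF; elim: s => [_|c s IH /andP[cs us]].
  by rewrite big_nil (_ : (fun y => _) = fun=> 1) ?dd_cst //; apply/funext => z; rewrite big_nil.
rewrite (_ : (fun y => _) = fun y => F c y * \prod_(i <- s) F i y); last by apply/funext => z; rewrite big_cons.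
rewrite ddM // ?IH //; last exact: polyf_prod.
rewrite [RHS]big_cons big_cons eqxx; congr (_ * _ + _).
  rewrite big_seq [RHS]big_seq; apply: eq_bigr => b bs.
  by case: eqP => // bc; move: cs; rewrite -bc bs.
rewrite mulr_sumr [LHS]big_seq [RHS]big_seq; apply: eq_bigr => a as_.
by rewrite big_cons; case: eqP => // ca; move: cs; rewrite ca as_.
Qed.

(** One factor is exchanged at a time; d <= 1 bounds the factors u by B + 1, so C depends only on B
    and the number of factors. *)
Lemma prod_dist (I : eqType) (s : seq I) (B : R) : 0 <= B -> exists2 C, 0 <= C &
  forall (u v : I -> R) d, 0 <= d <= 1 ->
    (forall b, b \in s -> `|u b - v b| <= d /\ `|v b| <= B) ->
    `|\prod_(b <- s) u b - \prod_(b <- s) v b| <= C * d.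
Proof.
move=> B0; elim: s => [|c s [C C0 IH]].
  by exists 0 => // u v d _ _; rewrite !big_nil subrr normr0 mul0r.
exists ((B + 1) ^+ size s + B * C).
  by rewrite addr_ge0 ?mulr_ge0 // exprn_ge0 // addr_ge0.
move=> u v d /[dup] dI /andP[d0 d1] H; rewrite !big_cons.
have Hs b : b \in s -> `|u b - v b| <= d /\ `|v b| <= B by move=> bs; apply: H; rewrite inE bs orbT.
have [Hc1 Hc2] : `|u c - v c| <= d /\ `|v c| <= B by apply: H; rewrite inE eqxx.
have Hu : `|\prod_(b <- s) u b| <= (B + 1) ^+ size s.
  elim: s Hs {IH H} => [|b s IHs] Hs; first by rewrite big_nil normr1.
  rewrite big_cons normrM exprS; apply: ler_pM => //.
    have [H1 H2] : `|u b - v b| <= d /\ `|v b| <= B by apply: Hs; rewrite inE eqxx.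
    by rewrite -[u b](subrK (v b)) (le_trans (ler_normD _ _)) // addrC lerD // (le_trans H1).
  by apply: IHs => b' b's; apply: Hs; rewrite inE b's orbT.
have -> : u c * \prod_(b <- s) u b - v c * \prod_(b <- s) v b =
  (u c - v c) * \prod_(b <- s) u b + v c * (\prod_(b <- s) u b - \prod_(b <- s) v b) by ring.
rewrite (le_trans (ler_normD _ _)) // !normrM mulrDl; apply: lerD.
  by rewrite mulrC ler_pM.
by rewrite -mulrA; apply: ler_pM => //; exact: IH.
Qed.

Lemma cvg_of_harmonic (u : nat -> R) (l K : R) : (forall j, `|u j - l| <= K / j.+1%:R) -> u @ \oo --> l.
Proof.
move=> H; have cK (c : R) : (fun _ : nat => c) @ \oo --> c by exact: cvg_cst.
have hK : (fun j => K * harmonic j) @ \oo --> K * 0 by apply: cvgM; [exact: cK | exact: cvg_harmonic].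
have h1 : (fun j => l - K * harmonic j) @ \oo --> l - K * 0 by apply: cvgB; [exact: cK | exact: hK].
have h2 : (fun j => l + K * harmonic j) @ \oo --> l + K * 0 by apply: cvgD; [exact: cK | exact: hK].
rewrite mulr0 subr0 in h1; rewrite mulr0 addr0 in h2.
apply: (squeeze_cvgr _ h1 h2); apply: nearW => j.
by rewrite -ler_distl; exact: H.
Qed.

Lemma cvgn_sum_in (I : eqType) (s : seq I) (u : I -> nat -> R) (l : I -> R) :
  (forall a : I, a \in s -> u a @ \oo --> l a) ->
  (fun n => \sum_(a <- s) u a n) @ \oo --> \sum_(a <- s) l a.
Proof.
move=> H; rewrite big_seq big_mkcond.
rewrite (_ : (fun n => _) = fun n => \sum_(a <- s) (if a \in s then u a n else 0)); last first.
  by apply/funext => n; rewrite big_seq big_mkcond.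
apply: cvgn_sum => a; case: ifP => [/H//|_]; exact: cvg_cst.
Qed.

Lemma sphere_int_poly_sum_in (I : eqType) (s : seq I) (F : I -> vec -> R) : (forall a : I, a \in s -> polyf (F a)) ->
  sphere_int (fun y => \sum_(a <- s) F a y) = \sum_(a <- s) sphere_int (F a).
Proof.
move=> pF; pose G (a : I) y := if a \in s then F a y else 0.
transitivity (sphere_int (fun y => \sum_(a <- s) G a y)).
  by congr sphere_int; apply/funext => y; rewrite big_seq [RHS]big_seq; apply: eq_bigr => a as_; rewrite /G as_.
rewrite sphere_int_poly_sum; last first.
  move=> a; case: (boolP (a \in s)) => as_.
    by apply: eq_polyf (pF _ as_) => y; rewrite /G as_.
  by apply: eq_polyf (polyf_cst 0) => y; rewrite /G (negbTE as_).
rewrite big_seq [RHS]big_seq; apply: eq_bigr => a as_.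
by congr sphere_int; apply/funext => y; rewrite /G as_.
Qed.

Lemma sphere_int_opp f : polyf f -> sphere_int (fun y => f (- y)) = sphere_int f.
Proof.
have pN f' : polyf f' -> polyf (fun y => f' (- y)).
  move=> pf; apply: (@eq_polyf _ _ (fun y => f' (-1 *: y))) => [y|]; first by rewrite scaleN1r.
  exact: polyf_scale.
move: f; apply: polyf_hom_ind.
- by move=> f1 f2 /funext ->.
- by [].
- by move=> f1 f2 p1 p2 E1 E2; rewrite !sphere_int_polyD ?E1 ?E2 //; exact: pN.
move=> m f pf hf; rewrite (_ : (fun y => _) = fun y => (-1) ^+ m * f y); last first.
  by apply/funext => y; rewrite -hf scaleN1r.
rewrite sphere_int_polyZ //; have [om|em] := boolP (odd m).
  by rewrite (sphere_int_odd pf hf om) mulr0.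
by rewrite -signr_odd (negbTE em) mul1r.
Qed.

End Products.

(** * Integration by parts for polynomial models of the weight *)

Section WeightedSphere.
Context {R : realType} {N : nat}.
Local Notation vec := 'rV[R]_N.
Variables (Rs Rp : seq vec) (k : vec -> R).
Hypotheses (N0 : (0 < N)%N) (Hrs : reduced_root_system Rs) (Hps : positive_subsystem Rs Rp)
  (Hk : multiplicity Rs k).
Implicit Types (x y a b xi v : vec) (f g q : vec -> R) (Pol : R -> {poly R}).
Local Notation e i := (delta_mx 0 i : vec).

(* [Wp] models w_k; [Bp a] is the coefficient of a in half its gradient, and [Dp a] = <a, y> Bp a
   models k(a) w_k. *)
Definition wfac Pol b y : R := (Pol (k b)).[dotp b y ^+ 2].
Definition Wp Pol y : R := \prod_(b <- Rp) wfac Pol b y.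
Definition Bp Pol a y : R :=
  \prod_(b <- Rp) (if b == a then dotp b y * (Pol (k b))^`().[dotp b y ^+ 2] else wfac Pol b y).
Definition Dp Pol a y : R :=
  \prod_(b <- Rp) (if b == a then dotp b y ^+ 2 * (Pol (k b))^`().[dotp b y ^+ 2] else wfac Pol b y).

Lemma polyf_if (c : bool) f g : polyf f -> polyf g -> polyf (fun y => if c then f y else g y).
Proof. by case: c. Qed.

Lemma polyf_dotp_sqr b : polyf (fun y : vec => dotp b y ^+ 2).
Proof. by apply: polyf_exp; exact: polyf_dotp. Qed.

Lemma polyf_wfac Pol b : polyf (wfac Pol b).
Proof. by apply: polyf_horner; exact: polyf_dotp_sqr. Qed.

Lemma polyf_Wp Pol : polyf (Wp Pol).
Proof. by apply: polyf_prod => b _; exact: polyf_wfac. Qed.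

Lemma polyf_Bp Pol a : polyf (Bp Pol a).
Proof.
apply: polyf_prod => b _; apply: polyf_if; last exact: polyf_wfac.
by apply: polyfM; [exact: polyf_dotp | apply: polyf_horner; exact: polyf_dotp_sqr].
Qed.

Lemma polyf_Dp Pol a : polyf (Dp Pol a).
Proof.
apply: polyf_prod => b _; apply: polyf_if; last exact: polyf_wfac.
by apply: polyfM; [exact: polyf_dotp_sqr | apply: polyf_horner; exact: polyf_dotp_sqr].
Qed.

Lemma Dp_Bp Pol a y : a \in Rp -> Dp Pol a y = dotp a y * Bp Pol a y.
Proof.
move=> aP; have uP := pos_uniq Hrs Hps.
rewrite /Dp /Bp (bigD1_seq a) //= [in RHS](bigD1_seq a) //= !eqxx mulrA; congr (_ * _); first by ring.
by apply: eq_bigr => b /negPf ->.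
Qed.

Lemma dd_Wp Pol v y : dd v (Wp Pol) y = \sum_(a <- Rp) 2 * dotp a v * Bp Pol a y.
Proof.
have uP := pos_uniq Hrs Hps.
rewrite /Wp dd_prod //; last by move=> b; exact: polyf_wfac.
rewrite big_seq [RHS]big_seq; apply: eq_bigr => a aP.
rewrite /Bp (bigD1_seq a) //= [in RHS](bigD1_seq a) //= !eqxx mulrA; congr (_ * _); last first.
  by apply: eq_bigr => b /negPf ->.
by rewrite /wfac dd_horner ?dd_dotp_exp; [ring | exact: polyf_dotp_sqr].
Qed.

Lemma Wp_refl Pol c y : c \in Rs -> Wp Pol (refl c y) = Wp Pol y.
Proof.
move=> cR; have c2 := root2 Hrs cR.
rewrite /Wp -[RHS](pos_reindex Hrs Hps _ cR (phi := fun b => wfac Pol b y)); last first.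
  by move=> a aR; rewrite /wfac (multN Hrs Hk) // dotpNl sqrrN.
rewrite big_seq [RHS]big_seq; apply: eq_bigr => b /(pos_root Hps) bR.
by rewrite /wfac (mult_refl Hk) // dotp_reflC.
Qed.

Lemma Bp_refl Pol a y : a \in Rp -> Bp Pol a (refl a y) = - Bp Pol a y.
Proof.
move=> aP; have aR := pos_root Hps aP; have a2 := root2 Hrs aR; have uP := pos_uniq Hrs Hps.
have aN : - a \notin Rp by rewrite (pos_rootN Hrs Hps aR) aP.
rewrite /Bp (bigD1_seq a) //= [in RHS](bigD1_seq a) //= !eqxx dotp_refl // sqrrN !mulNr; congr (- (_ * _)).
(* The factors of a and -a are replaced by 1, so that [phi] is even in b and the product over all
   positive roots can be reindexed by the reflection. *)
pose phi b := if (b == a) || (b == - a) then 1 else wfac Pol b y.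
have E : \prod_(b <- Rp | b != a) (if b == a then dotp b y * (Pol (k b))^`().[dotp b y ^+ 2] else wfac Pol b y)
   = \prod_(b <- Rp) phi b.
  rewrite big_mkcond big_seq [RHS]big_seq; apply: eq_bigr => b bP; rewrite /phi.
  have bN : (b == - a) = false by apply/eqP => bE; move: aN; rewrite -bE bP.
  by rewrite bN orbF; case: (b == a).
rewrite E -[RHS](pos_reindex Hrs Hps _ aR (phi := phi)); last first.
  by move=> b bR; rewrite /phi eqr_opp orbC -[b == - a]eqr_oppLR /wfac (multN Hrs Hk) // dotpNl sqrrN.
rewrite big_mkcond big_seq [RHS]big_seq; apply: eq_bigr => b bP; rewrite /phi.
have bR := pos_root Hps bP.
have E1 : (refl a b == - a) = (b == a).
  by rewrite -(inj_eq (can_inj (fun z => reflK z a2))) reflK // reflN refl_self // opprK.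
have E2 : (refl a b == a) = false.
  rewrite -(inj_eq (can_inj (fun z => reflK z a2))) reflK // refl_self //.
  by apply/eqP => bE; move: aN; rewrite -bE bP.
rewrite E1 E2 /=; case: (b == a) => //.
by rewrite /wfac (mult_refl Hk) // dotp_reflC.
Qed.

(** [Bp] is odd under the reflection in a, so q may be replaced by half of q - q o s_a, which is <a,
    y> times the quotient; the factor <a, y> turns [Bp] into [Dp]. Thus the gradient coefficient,
    whose limit may be singular on the hyperplane, gives way to one tending to k(a) w_k. *)
Lemma sphere_int_Bp Pol a q : a \in Rp -> polyf q ->
  2 * sphere_int (fun y => q y * Bp Pol a y) = sphere_int (fun y => linquot a q y * Dp Pol a y).
Proof.
move=> aP pq; have a2 := pos_root2 Hrs Hps aP; have pB := polyf_Bp Pol a.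
have pr := polyf_refl a pq; have pqB := polyfM pq pB; have prB := polyfM pr pB.
have E : sphere_int (fun y => q y * Bp Pol a y) = - sphere_int (fun y => q (refl a y) * Bp Pol a y).
  rewrite -(sphere_int_refl a2 pqB) -mulN1r -sphere_int_polyZ //.
  by congr sphere_int; apply/funext => y; rewrite Bp_refl //; ring.
have -> : (fun y => linquot a q y * Dp Pol a y) = fun y => q y * Bp Pol a y + -1 * (q (refl a y) * Bp Pol a y).
  by apply/funext => y; rewrite Dp_Bp // mulrCA mulrA (linquotE Hrs Hps) //; ring.
rewrite sphere_int_polyD //; last exact: polyfZ.
by rewrite sphere_int_polyZ // mulN1r -E; ring.
Qed.

(** In the limit [Dp] tends to k(a) w_k: the bracket in the sum vanishes, and the last terms add 2
    [gam_sum] to N, which gives the constant in [mean_T]. *)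
Lemma weighted_parts Pol m q i : polyf q -> hom m q ->
  sphere_int (fun y => dunklT Rp k (e i) q y * Wp Pol y) =
    (m%:R - 1 + N%:R) * sphere_int (fun y => y ord0 i * q y * Wp Pol y) +
    \sum_(a <- Rp) (a ord0 i * (k a * sphere_int (fun y => linquot a q y * Wp Pol y)
                      - sphere_int (fun y => linquot a q y * Dp Pol a y))
                   + 2 * sphere_int (fun y => y ord0 i * q y * Dp Pol a y)).
Proof.
move=> pq hq; have pW := polyf_Wp Pol; have pB := polyf_Bp Pol; have pD := polyf_Dp Pol.
have pc := @polyf_coord R N i; have pqW := polyfM pq pW; have pd := polyf_dd (e i) pq.
have pl a : a \in Rp -> polyf (linquot a q) by move=> aP; exact: (polyf_linquot Hrs Hps aP pq).
have H := sphere_int_parts i N0 pqW.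
have E1 : dd (e i) (fun y => q y * Wp Pol y) =
    fun y => dd (e i) q y * Wp Pol y + \sum_(a <- Rp) 2 * a ord0 i * (q y * Bp Pol a y).
  apply/funext => y; rewrite ddM // dd_Wp mulr_sumr; congr (_ + _); apply: eq_bigr => a _.
  by rewrite dotp_delta; ring.
have E2 : (fun y => y ord0 i * dd y (fun y => q y * Wp Pol y) y) =
    fun y => m%:R * (y ord0 i * q y * Wp Pol y) + \sum_(a <- Rp) 2 * (y ord0 i * q y * Dp Pol a y).
  apply/funext => y; rewrite ddM // dd_Wp (euler y pq hq) mulrDr; congr (_ + _); first by ring.
  rewrite !mulr_sumr big_seq [RHS]big_seq; apply: eq_bigr => a aP.
  by rewrite (Dp_Bp _ _ aP); ring.
have E3 : (fun y => y ord0 i * (q y * Wp Pol y)) = fun y => y ord0 i * q y * Wp Pol y.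
  by apply/funext => y; rewrite mulrA.
have pyq : polyf (fun y : vec => y ord0 i * q y) by exact: polyfM.
rewrite E1 E2 E3 !sphere_int_polyD in H; first last.
- by apply: polyf_sum => a _; apply: polyfZ; exact: polyfM.
- exact: polyfM.
- by apply: polyf_sum => a _; apply: polyfZ; exact: polyfM.
- by apply: polyfZ; exact: polyfM.
rewrite !sphere_int_poly_sum in H; try by move=> a; apply: polyfZ; exact: polyfM.
rewrite sphere_int_polyZ in H; last exact: polyfM.
have -> : (fun y => dunklT Rp k (e i) q y * Wp Pol y) =
    fun y => dd (e i) q y * Wp Pol y + \sum_(a <- Rp) k a * a ord0 i * (linquot a q y * Wp Pol y).
  apply/funext => y; rewrite TfunE /T_def mulrDl mulr_suml; congr (_ + _); apply: eq_bigr => a _.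
  by rewrite dotp_delta; ring.
have plW a : a \in Rp -> polyf (fun y => k a * a ord0 i * (linquot a q y * Wp Pol y)).
  by move=> aP; apply: polyfZ; apply: polyfM => //; exact: pl.
rewrite sphere_int_polyD; [|exact: polyfM|]; last first.
  apply: (@eq_polyf _ _ (fun y => \sum_(a <- Rp | a \in Rp) k a * a ord0 i * (linquot a q y * Wp Pol y))).
    by move=> y; rewrite -big_seq.
  by apply: polyf_sum => a; exact: plW.
rewrite sphere_int_poly_sum_in //.
have S1 : \sum_(a <- Rp) sphere_int (fun y => k a * a ord0 i * (linquot a q y * Wp Pol y)) =
    \sum_(a <- Rp) a ord0 i * (k a * sphere_int (fun y => linquot a q y * Wp Pol y)).
  rewrite big_seq [RHS]big_seq; apply: eq_bigr => a aP; rewrite sphere_int_polyZ; last by apply: polyfM => //; exact: pl.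
  by ring.
have S2 : \sum_(a <- Rp) sphere_int (fun y => 2 * a ord0 i * (q y * Bp Pol a y)) =
    \sum_(a <- Rp) a ord0 i * sphere_int (fun y => linquot a q y * Dp Pol a y).
  rewrite big_seq [RHS]big_seq; apply: eq_bigr => a aP; rewrite sphere_int_polyZ; last exact: polyfM.
  by rewrite -sphere_int_Bp //; ring.
have S3 : \sum_(a <- Rp) sphere_int (fun y => 2 * (y ord0 i * q y * Dp Pol a y)) =
    \sum_(a <- Rp) 2 * sphere_int (fun y => y ord0 i * q y * Dp Pol a y).
  by apply: eq_bigr => a _; rewrite sphere_int_polyZ //; exact: polyfM.
rewrite S1; rewrite S2 S3 in H.
rewrite big_split /=; under [in RHS]eq_bigr do rewrite mulrBr.
rewrite sumrB; move: H; lra.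
Qed.

End WeightedSphere.

(** * The w_k-mean over the sphere *)

Section WeightedMean.
Context {R : realType} {N : nat}.
Local Notation vec := 'rV[R]_N.
Variables (Rs Rp : seq vec) (k : vec -> R).
Hypotheses (N0 : (0 < N)%N) (Hrs : reduced_root_system Rs) (Hps : positive_subsystem Rs Rp)
  (Hk : multiplicity Rs k).
Implicit Types (x y a b xi v : vec) (f g q : vec -> R).
Local Notation e i := (delta_mx 0 i : vec).

Lemma dotp_sqr_le2 b y : dotp b b = 2 -> dotp y y <= 1 -> 0 <= dotp b y ^+ 2 <= 2.
Proof.
move=> b2 y1; rewrite sqr_ge0 /=; set c := dotp b y.
have : 0 <= dotp (b - c *: y) (b - c *: y) by exact: dotp_ge0.
rewrite dotpBl !dotpBr !dotpZl !dotpZr b2 (dotpC y b) -/c.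
have : 0 <= c ^+ 2 * (1 - dotp y y) by rewrite mulr_ge0 ?sqr_ge0 // subr_ge0.
by rewrite expr2; lra.
Qed.

Lemma wkE y : wk Rp k y = \prod_(b <- Rp) (dotp b y ^+ 2) `^ k b.
Proof.
apply: eq_bigr => b _; rewrite powRrM powR_mulrn //.
by rewrite real_normK ?num_real.
Qed.

Lemma pmeas_wk : pmeas (wk Rp k).
Proof.
rewrite (_ : wk Rp k = fun y => \prod_(b <- Rp) (dotp b y ^+ 2) `^ k b); last by apply/funext => y; rewrite wkE.
apply: pmeas_prod => b; apply: (@pmeasP1 _ (fun t => t `^ k b)); first exact: measurable_powR.
by apply: pmeas_polyf; exact: polyf_dotp_sqr.
Qed.

Lemma wk_ge0 y : 0 <= wk Rp k y.
Proof. by apply: prodr_ge0 => b _; exact: powR_ge0. Qed.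

Lemma powR_poly_family : exists Pol : nat -> R -> {poly R}, forall j kap s, 0 <= kap -> 0 <= s <= 2 ->
  `|(Pol j kap).[s] - s `^ kap| <= j.+1%:R^-1 /\
  `|s * (Pol j kap)^`().[s] - kap * s `^ kap| <= j.+1%:R^-1.
Proof.
have ex (p : nat * R) : exists P : {poly R}, 0 <= p.2 -> forall s, 0 <= s <= 2 ->
    `|P.[s] - s `^ p.2| <= p.1.+1%:R^-1 /\ `|s * P^`().[s] - p.2 * s `^ p.2| <= p.1.+1%:R^-1.
  have [p0|pn] := leP 0 p.2; last by exists 0 => p0; lra.
  have j0 : 0 < (p.1.+1%:R^-1 : R) by rewrite invr_gt0.
  by have [P HP] := powR_poly_approx p0 j0; exists P.
have [Q HQ] := choice ex.
by exists (fun j kap => Q (j, kap)) => j kap s k0 sI; exact: (HQ (j, kap) k0 s sI).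
Qed.

Variable Pol : nat -> R -> {poly R}.
Hypothesis HPol : forall j kap s, 0 <= kap -> 0 <= s <= 2 ->
  `|(Pol j kap).[s] - s `^ kap| <= j.+1%:R^-1 /\
  `|s * (Pol j kap)^`().[s] - kap * s `^ kap| <= j.+1%:R^-1.

Let kp b : b \in Rp -> 0 <= k b.
Proof. by move=> /(pos_root Hps) bR; case: Hk => H _; exact: H. Qed.

Lemma pow_bound : exists2 B, 0 <= B & forall b y, b \in Rp -> dotp y y <= 1 ->
  `|(dotp b y ^+ 2) `^ k b| <= B /\ `|k b * (dotp b y ^+ 2) `^ k b| <= B.
Proof.
have t0 b : b \in Rp -> 0 <= (1 + k b) * 2 `^ k b.
  by move=> bP; rewrite mulr_ge0 ?powR_ge0 // addr_ge0 // kp.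
exists (\sum_(b <- Rp) (1 + k b) * 2 `^ k b).
  by rewrite big_seq; apply: sumr_ge0 => b; exact: t0.
move=> b y bP y1; have b2 := pos_root2 Hrs Hps bP.
have /andP[s0 s2] := dotp_sqr_le2 b2 y1; have kb := kp bP.
have H2 : (dotp b y ^+ 2) `^ k b <= 2 `^ k b by apply: ge0_ler_powR => //; rewrite nnegrE.
have p0 := powR_ge0 (dotp b y ^+ 2) (k b).
have HB : (1 + k b) * 2 `^ k b <= \sum_(b <- Rp) (1 + k b) * 2 `^ k b.
  rewrite (bigD1_seq b) //=; last exact: (pos_uniq Hrs Hps).
  by rewrite lerDl big_seq_cond; apply: sumr_ge0 => c /andP[cP _]; exact: t0.
have Hm : 0 <= k b * (dotp b y ^+ 2) `^ k b by exact: mulr_ge0.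
have Hk2 : k b * (dotp b y ^+ 2) `^ k b <= k b * 2 `^ k b by exact: ler_wpM2l.
have k2 : 0 <= k b * 2 `^ k b by rewrite mulr_ge0 // powR_ge0.
have p2 : 0 <= 2 `^ k b :> R by exact: powR_ge0.
move: HB; rewrite mulrDl mul1r => HB.
by rewrite !ger0_norm //; split; apply: le_trans HB; [apply: ler_wpDr | apply: ler_wpDl].
Qed.

Let inv01 (j : nat) : 0 <= (j.+1%:R^-1 : R) <= 1.
Proof. by rewrite invr_ge0 ler0n /= invf_le1 ?ltr0n // ler1n. Qed.

Lemma Wp_dist : exists2 C, 0 <= C & forall j y, dotp y y <= 1 ->
  `|Wp Rp k (Pol j) y - wk Rp k y| <= C * j.+1%:R^-1.
Proof.
have [B B0 HB] := pow_bound; have [C C0 HC] := @prod_dist R _ Rp B B0.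
exists C => // j y y1; rewrite wkE; apply: HC => // b bP.
have b2 := pos_root2 Hrs Hps bP; split; last by case: (HB b y bP y1).
by case: (HPol j (kp bP) (dotp_sqr_le2 b2 y1)).
Qed.

Lemma Dp_dist a : a \in Rp -> exists2 C, 0 <= C & forall j y, dotp y y <= 1 ->
  `|Dp Rp k (Pol j) a y - k a * wk Rp k y| <= C * j.+1%:R^-1.
Proof.
move=> aP; have [B B0 HB] := pow_bound; have [C C0 HC] := @prod_dist R _ Rp B B0.
exists C => // j y y1.
have -> : k a * wk Rp k y = \prod_(b <- Rp) (if b == a then k b * (dotp b y ^+ 2) `^ k b else (dotp b y ^+ 2) `^ k b).
  have uP := pos_uniq Hrs Hps.
  rewrite wkE (bigD1_seq a) //= [RHS](bigD1_seq a) //= eqxx mulrA; congr (_ * _).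
  by apply: eq_bigr => b /negPf ->.
apply: HC => // b bP; have b2 := pos_root2 Hrs Hps bP.
have [H1 H2] := HB b y bP y1; have [H3 H4] := HPol j (kp bP) (dotp_sqr_le2 b2 y1).
by case: (b == a).
Qed.

Lemma wk_bounded : exists B, forall y, dotp y y <= 1 -> `|wk Rp k y| <= B.
Proof.
have [C C0 HC] := Wp_dist; have [M HM] := polyf_bounded 1 (polyf_Wp Rp k (Pol 0)).
exists (C + M) => y y1; rewrite -[wk Rp k y](subrK (Wp Rp k (Pol 0) y)).
rewrite (le_trans (ler_normD _ _)) // lerD ?HM // distrC.
by have := HC 0%N y y1; rewrite invr1 mulr1.
Qed.

Lemma sadm_wk f : polyf f -> sadm (fun y => f y * wk Rp k y).
Proof.
move=> pf; apply: sadmP; first by apply: pmeasM; [exact: pmeas_polyf | exact: pmeas_wk].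
have [B HB] := wk_bounded; have [M HM] := polyf_bounded 1 pf.
by exists (M * B) => y y1; rewrite normrM ler_pM ?HM ?HB.
Qed.

Lemma cvg_weighted f (h : nat -> vec -> R) (c : R) : polyf f -> (forall j, polyf (h j)) ->
  (exists2 C, 0 <= C & forall j y, dotp y y <= 1 -> `|h j y - c * wk Rp k y| <= C * j.+1%:R^-1) ->
  (fun j => sphere_int (fun y => f y * h j y)) @ \oo --> c * sphere_int (fun y => f y * wk Rp k y).
Proof.
move=> pf ph [C C0 HC]; have [M HM] := polyf_bounded 1 pf.
have M0 : 0 <= M by apply: le_trans (HM 0 _) => //; rewrite dotp0r.
apply: (@cvg_of_harmonic _ _ _ (M * C * sphere_int (fun _ : vec => 1))) => j.
rewrite -sphere_intZ; last exact: sadm_wk.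
have -> : M * C * sphere_int (fun _ : vec => 1) / j.+1%:R = M * (C * j.+1%:R^-1) * sphere_int (fun _ : vec => 1) :> R by ring.
apply: sphere_int_dist.
- by apply: sadm_polyf; exact: polyfM.
- by apply: sadmZ; exact: sadm_wk.
move=> y y1; rewrite mulrCA -mulrBr normrM; apply: ler_pM => //; first exact: HM.
exact: HC.
Qed.

Lemma cvg_Wp f : polyf f ->
  (fun j => sphere_int (fun y => f y * Wp Rp k (Pol j) y)) @ \oo --> sphere_int (fun y => f y * wk Rp k y).
Proof.
move=> pf; rewrite -[X in _ --> X]mul1r; apply: cvg_weighted => //.
  by move=> j; exact: polyf_Wp.
have [C C0 HC] := Wp_dist; exists C => // j y y1.
by rewrite mul1r; exact: HC.
Qed.

Lemma cvg_Dp f a : a \in Rp -> polyf f ->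
  (fun j => sphere_int (fun y => f y * Dp Rp k (Pol j) a y)) @ \oo --> k a * sphere_int (fun y => f y * wk Rp k y).
Proof.
move=> aP pf; apply: cvg_weighted => //; last exact: Dp_dist.
by move=> j; exact: polyf_Dp.
Qed.

(** Linearity and positivity hold for w_k directly. Reflection invariance, oddness and invariance
    under |y|^2 hold exactly for the model weights and pass to the limit; so does the identity for
    T_i, whose error terms cancel in the limit. *)
Lemma weighted_sphere_mean : sphere_int (wk Rp k) != 0 ->
  dunkl_mean Rp k (fun f => sphere_int (fun y => f y * wk Rp k y) / sphere_int (wk Rp k)).
Proof.
set Z := sphere_int (wk Rp k) => Z0.
have p1 : polyf (fun _ : vec => 1 : R) by exact: polyf_cst.
have awk : sadm (wk Rp k).
  by have := sadm_wk p1; congr sadm; apply/funext => y; rewrite mul1r.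
have p0 : polyf (fun _ : vec => 0 : R) by exact: polyf_cst.
have a0 := sadm_polyf p0.
have Zp : 0 <= Z.
  by rewrite -(@sphere_int0 R N); apply: ler_sphere_int => // y _; exact: wk_ge0.
have ulim (u : nat -> R) (l1 l2 : R) : u @ \oo --> l1 -> u @ \oo --> l2 -> l1 = l2.
  by move=> u1 u2; exact: (cvg_unique _ u1 u2).
split.
- move=> f g pf pg; rewrite -mulrDl -sphere_intD; try exact: sadm_wk.
  by congr (sphere_int _ / _); apply/funext => y; rewrite mulrDl.
- move=> c f pf; rewrite mulrA -sphere_intZ; last exact: sadm_wk.
  by congr (sphere_int _ / _); apply/funext => y; rewrite mulrA.
- rewrite (_ : (fun y => 1 * wk Rp k y) = wk Rp k) ?divff //.
  by apply/funext => y; rewrite mul1r.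
- move=> a f aP pf; congr (_ / _); have aR := pos_root Hps aP; have a2 := root2 Hrs aR.
  apply: (ulim _ _ _ (cvg_Wp (polyf_refl a pf))).
  rewrite (_ : (fun j => _) = fun j => sphere_int (fun y => f y * Wp Rp k (Pol j) y)); first exact: cvg_Wp.
  apply/funext => j; rewrite -[RHS](sphere_int_refl a2); last by apply: polyfM => //; exact: polyf_Wp.
  by congr sphere_int; apply/funext => y; rewrite (Wp_refl Hrs Hps Hk).
- move=> m i f pf hf; rewrite mulrA; congr (_ / _).
  have pc := @polyf_coord R N i.
  have pM : polyf (fun y : vec => y ord0 i * f y) by exact: polyfM.
  have pT := polyf_T k Hrs Hps (e i) pf.
  apply: (ulim _ _ _ (cvg_Wp pT)).
  rewrite (_ : (fun j => _) = fun j => (m%:R - 1 + N%:R) * sphere_int (fun y => y ord0 i * f y * Wp Rp k (Pol j) y) +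
    \sum_(a <- Rp) (a ord0 i * (k a * sphere_int (fun y => linquot a f y * Wp Rp k (Pol j) y)
                      - sphere_int (fun y => linquot a f y * Dp Rp k (Pol j) a y))
                   + 2 * sphere_int (fun y => y ord0 i * f y * Dp Rp k (Pol j) a y))); last first.
    by apply/funext => j; exact: (weighted_parts N0 Hrs Hps Hk).
  set L := sphere_int (fun y => y ord0 i * f y * wk Rp k y).
  have -> : (m%:R - 1 + dunkl_dim Rp k) * L = (m%:R - 1 + N%:R) * L +
      \sum_(a <- Rp) (a ord0 i * (k a * sphere_int (fun y => linquot a f y * wk Rp k y)
                      - k a * sphere_int (fun y => linquot a f y * wk Rp k y))
                   + 2 * (k a * L)).
    under [in RHS]eq_bigr do rewrite subrr mulr0 add0r.
    by rewrite -mulr_sumr -mulr_suml /dunkl_dim -/(gam_sum Rp k); ring.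
  have cK (c : R) : (fun _ : nat => c) @ \oo --> c by exact: cvg_cst.
  have cZ c (u : nat -> R) l : u @ \oo --> l -> (fun j => c * u j) @ \oo --> c * l.
    by move=> ul; exact: (cvgM (cK c) ul).
  apply: (cvgD (cZ _ _ _ (cvg_Wp pM))); apply: cvgn_sum_in => a aP.
  have pl := polyf_linquot Hrs Hps aP pf.
  exact: (cvgD (cZ _ _ _ (cvgB (cZ _ _ _ (cvg_Wp pl)) (cvg_Dp aP pl))) (cZ _ _ _ (cvg_Dp aP pM))).
- move=> m f pf hf om; rewrite (_ : sphere_int _ = 0) ?mul0r //.
  apply: (ulim _ _ _ (cvg_Wp pf)).
  rewrite (_ : (fun j => _) = fun=> 0); first exact: cvg_cst.
  apply/funext => j; have pfW := polyfM pf (polyf_Wp Rp k (Pol j)).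
  have : sphere_int (fun y => f y * Wp Rp k (Pol j) y) = - sphere_int (fun y => f y * Wp Rp k (Pol j) y).
    rewrite -{1}(sphere_int_opp pfW) -mulN1r -sphere_int_polyZ //.
    congr sphere_int; apply/funext => y; rewrite mulrA; congr (_ * _).
      by rewrite -scaleN1r hf -signr_odd om.
    by apply: eq_bigr => b _; rewrite /wfac dotpNr sqrrN.
  by lra.
- move=> f pf; congr (_ / _).
  have pM : polyf (fun y : vec => dotp y y * f y) by apply: polyfM => //; exact: polyf_dotpp.
  apply: (ulim _ _ _ (cvg_Wp pM)).
  rewrite (_ : (fun j => _) = fun j => sphere_int (fun y => f y * Wp Rp k (Pol j) y)); first exact: cvg_Wp.
  apply/funext => j; rewrite -[RHS]sphere_int_normsq; last by apply: polyfM => //; exact: polyf_Wp.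
  by congr sphere_int; apply/funext => y; rewrite mulrA.
move=> f pf f0; rewrite divr_ge0 // -(@sphere_int0 R N); apply: ler_sphere_int => //; first exact: sadm_wk.
by move=> y _; rewrite mulr_ge0 // wk_ge0.
Qed.

End WeightedMean.

(** * Conclusion *)

Section Positivity.
Context {R : realType} {N : nat}.
Local Notation vec := 'rV[R]_N.
Variables (Rs Rp : seq vec) (k : vec -> R) (mu : vec -> probability (borelV R N) R).
Hypotheses (N0 : (0 < N)%N) (Hrs : reduced_root_system Rs) (Hps : positive_subsystem Rs Rp)
  (Hk : multiplicity Rs k) (Hmu : forall x, mu x (~` conv_orbit Rs x) = 0%E)
  (HI : intertwiner Rp k (Vk mu)).
Implicit Types (x y : vec) (f g p : vec -> R) (t : R).

Let HV := Vk_intertwining Hrs Hps Hmu HI.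

Lemma polyf_dtrans p x t : polyf p -> polyf (fun y => dtrans mu p x (t *: y)).
Proof.
move=> pp; have [J [g [h [pg ph _ D]]]] := dtr_addition HV pp.
apply: (@eq_polyf _ _ (fun y => \sum_j Vk mu (g j) x * Vk mu (h j) (t *: y))).
  by move=> y; rewrite -D.
by apply: polyf_sum => j _; apply: polyfZ; apply: polyf_scale; exact: (polyf_V HV).
Qed.

Lemma dtrans_ball_dist g p x t rho eps : continuous g -> polyf p ->
  (forall z, dotp z z <= rho -> `|g z - p z| <= eps) -> 4 * (t ^+ 2 + dotp x x) < rho ->
  forall y, dotp y y <= 1 -> `|dtrans mu g x (t *: y) - dtrans mu p x (t *: y)| <= eps.
Proof.
move=> cg pp Hgp Hrho y y1.
apply: (dtrans_dist Hrs Hmu cg (polyf_continuous pp) Hgp).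
have x0 := dotp_ge0 x; have t0 := sqr_ge0 t.
have : t ^+ 2 * dotp y y <= t ^+ 2 by rewrite -[leRHS]mulr1 ler_wpM2l.
by rewrite dotpZr dotpZl mulrA -expr2; lra.
Qed.

(** On the unit ball the translate of g is a uniform limit of translates of polynomials, which are
    polynomials; measurability is inherited from them. *)
Lemma sadm_dtrans g x t : continuous g -> sadm (fun y => dtrans mu g x (t *: y) * wk Rp k y).
Proof.
move=> cg; pose rho := 4 * (t ^+ 2 + dotp x x) + 1.
have Hrho : 4 * (t ^+ 2 + dotp x x) < rho by rewrite /rho ltrDl.
have ex (j : nat) : exists2 p, polyf p & forall z, dotp z z <= rho -> `|g z - p z| <= j.+1%:R^-1.
  by apply: weierstrass_ball => //; rewrite invr_gt0.
have ex' (j : nat) : exists p, polyf p /\ forall z, dotp z z <= rho -> `|g z - p z| <= j.+1%:R^-1.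
  by have [p pp Hp] := ex j; exists p.
have [P HP] := choice ex'.
have HD j y : dotp y y <= 1 -> `|dtrans mu g x (t *: y) - dtrans mu (P j) x (t *: y)| <= j.+1%:R^-1.
  by case: (HP j) => pP HPj; exact: (dtrans_ball_dist cg pP HPj Hrho).
have [Pol HPol] := @powR_poly_family R.
have [B HB] := wk_bounded Hrs Hps Hk HPol.
have pd j : polyf (fun y => dtrans mu (P j) x (t *: y)) by apply: polyf_dtrans; case: (HP j).
have [M HM] := polyf_bounded 1 (pd 0%N).
apply: (@sadm_lim _ _ (fun j y => dtrans mu (P j) x (t *: y) * wk Rp k y) _ ((1 + M) * B)).
- by move=> j; exact: (sadm_wk Hrs Hps Hk HPol).
- move=> y y1; apply: (@cvg_of_harmonic _ _ _ B) => j.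
  rewrite -mulrBl normrM mulrC; apply: ler_pM => //; first exact: HB.
  by rewrite distrC; exact: HD.
move=> y y1; rewrite normrM; apply: ler_pM => //; last exact: HB.
rewrite -[dtrans mu g x _](subrK (dtrans mu (P 0%N) x (t *: y))) (le_trans (ler_normD _ _)) // lerD ?HM //.
by have := HD 0%N y y1; rewrite invr1.
Qed.

Lemma spherical_mean_ge0 f g x t : continuous f -> (forall x, 0 <= f x) -> continuous g ->
  (forall x, Vk mu g x = f x) -> 0 <= t -> 0 <= spherical_mean mu Rp k g x t.
Proof.
move=> cf f0 cg Hgf t0; rewrite /spherical_mean; set Z := sphere_int (wk Rp k).
have [->|Z0] := eqVneq Z 0; first by rewrite invr0 mulr0.
have [Pol HPol] := @powR_poly_family R.
have awk p : polyf p -> sadm (fun y => p y * wk Rp k y) by exact: (sadm_wk Hrs Hps Hk HPol).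
have HL := weighted_sphere_mean N0 Hrs Hps Hk HPol Z0.
have Tc := T_comm Hrs Hps HV.
have [B HB] := wk_bounded Hrs Hps Hk HPol.
(* The factor 4 is the growth rate of L on powers of |y|^2; the added 1 makes the inequality strict.
   The same ball contains every point at which the translate evaluates g. *)
pose rho := 4 * (t ^+ 2 + dotp x x) + 1.
have Hrho : 4 * (t ^+ 2 + dotp x x) < rho by rewrite /rho ltrDl.
set X := sphere_int _; pose S1 : R := sphere_int (fun _ : vec => 1); pose K := B * S1 / `|Z|.
have H eps : 0 < eps -> - eps <= X / Z + eps * K.
  move=> e0; have [p pp Hp] := weierstrass_ball rho cg e0.
  have [I [d [F [HF pE]]]] := polyf_graded pp.
  have pF i : polyf (F i) by case: (HF i).
  have hF i : hom (d i) (F i) by case: (HF i).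
  have pE' : p = fun z => \sum_i F i z by apply/funext.
  (* V at y only sees |z| <= |y|, so on the ball V p differs by at most eps from V g = f >= 0. *)
  have low y : dotp y y <= rho -> - eps <= \sum_i Vk mu (F i) y.
    move=> yr; rewrite -(V_sum HV) // -pE'.
    have : `|Vk mu g y - Vk mu p y| <= eps.
      apply: (Vk_dist Hrs Hmu) => //; first exact: polyf_continuous.
      by move=> z zy; apply: Hp; exact: le_trans zy yr.
    by rewrite Hgf ler_norml => /andP[_ ?]; have := f0 y; lra.
  have := Lop_family_ge N0 Hrs Hps Hk Tc HL HV (fun i => polyf_V HV (pF i)) (fun i => hom_V HV (pF i) (hF i)) t0 Hrho low.
  rewrite -(mean_dtr N0 Hrs Hps Hk HL HV x t pF hF) -pE' -/(dtrans mu p) => LE.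
  rewrite -/Z in LE; set Y := sphere_int _ in LE.
  have XY : `|X - Y| <= eps * B * S1.
    apply: sphere_int_dist; first exact: sadm_dtrans.
      by apply: awk; exact: polyf_dtrans.
    move=> y y1; rewrite -mulrBl normrM; apply: ler_pM => //; last exact: HB.
    exact: (dtrans_ball_dist cg pp Hp Hrho).
  have Zp : 0 < `|Z| by rewrite normr_gt0.
  have : `|X / Z - Y / Z| <= eps * K.
    rewrite -mulrBl normrM normfV (_ : eps * K = eps * B * S1 * `|Z|^-1); last by rewrite /K; ring.
    by apply: ler_wpM2r; [rewrite invr_ge0 | exact: XY].
  rewrite ler_norml => /andP[L1 _].
  by apply: le_trans LE _; rewrite -lerBlDl; lra.
have K1 : 0 < 1 + `|K| by have := normr_ge0 K; lra.
rewrite leNgt; apply/negP => Xn.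
(* For this eps the bound would give -X / Z <= eps (1 + K), which is at most half of -X / Z. *)
have [eps e0 E] : exists2 eps, 0 < eps & eps * (2 * (1 + `|K|)) = - (X / Z).
  exists (- (X / Z) / (2 * (1 + `|K|))); first by rewrite divr_gt0 ?oppr_gt0 // mulr_gt0.
  by rewrite divfK // gt_eqF // mulr_gt0.
have HK := ler_wpM2l (ltW e0) (ler_norm K).
have HK0 := mulr_ge0 (ltW e0) (normr_ge0 K).
have := H eps e0; move: E HK HK0; move: (X / Z) `|K| => u v; lra.
Qed.

End Positivity.

Theorem mainTheorem2 (R : realType) (N : nat)
  (Rs Rp : seq 'rV[R]_N) (k : 'rV[R]_N -> R)
  (mu : 'rV[R]_N -> probability (borelV R N) R) :
  (0 < N)%N ->
  reduced_root_system Rs ->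
  positive_subsystem Rs Rp ->
  multiplicity Rs k ->
  (forall x, mu x (~` conv_orbit Rs x) = 0%E) ->
  intertwiner Rp k (Vk mu) ->
  forall f g : 'rV[R]_N -> R,
    smooth f -> (forall x, 0 <= f x) ->
    smooth g -> (forall x, Vk mu g x = f x) ->
    forall (x : 'rV[R]_N) (t : R), 0 <= t ->
      0 <= spherical_mean mu Rp k g x t.
Proof.
move=> N0 Hrs Hps Hk Hmu HI f g sf f0 sg Hgf x t t0.
have [cf _] := sf [::]; have [cg _] := sg [::].
exact: (spherical_mean_ge0 N0 Hrs Hps Hk Hmu HI x cf f0 cg Hgf t0).
Qed.
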